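(* Let $R\ge1$, let $C\subseteq\mathbb{R}^2$ be an $R$-fat rectangle and let $S$ be the family of $R$-fat rectangles. For every integer $n\ge1$, $$\mathrm{PropEF}(C,n,S)\ \ge\ \frac{1}{2^{2\lceil\log_2 n\rceil}}\ >\ \frac{1}{4n^2}.$$
   Context: For $R\ge1$, a $d$-dimensional piece (Borel subset of $\mathbb{R}^d$) is $R$-fat if it contains a $d$-dimensional cube $B^-$ and is contained in a $d$-dimensional cube $B^+$ parallel to $B^-$ with $\mathrm{len}(B^+)/\mathrm{len}(B^-)\le R$ (len = side length). A value measure on $C$ is $V(X)=\int_X v$ with $v$ non-negative, bounded, integrable on $C$, $V(C)<\infty$; $V^S(X):=\sup\{V(s):s\in S,s\subseteq X\}$. For $n$ agents with value measures $V_1,\dots,V_n$, an $S$-allocation is $(X_1,\dots,X_n)$ with $X_i\in S$ pairwise disjoint and $\bigcup_i X_i\subseteq C$; it is envy-free if $V_i^S(X_i)\ge V_i^S(X_j)$ for all $i,j$. $\mathrm{PropEF}(C,n,S):=\inf_{V_1,\dots,V_n}\sup_X\min_i V_i(X_i)/V_i(C)$, the infimum over all $n$-tuples of value measures on $C$ and the supremum over envy-free $S$-allocations. *)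

(* Defs.v *)
From Stdlib Require Import Reals Lra Lia List Classical ClassicalEpsilon.
Open Scope R_scope.

Definition pt := (R * R)%type.
Definition pset := pt -> Prop.

Definition subset (A B : pset) : Prop := forall q, A q -> B q.

(** * Supremum / infimum of a set of reals (conventional value 0 when the set
    is empty or unbounded; only used on nonempty bounded sets below). *)
Definition Rsup (P : R -> Prop) : R :=
  match excluded_middle_informative (bound P /\ exists x, P x) with
  | left h => proj1_sig (completeness P (proj1 h) (proj2 h))
  | right _ => 0
  end.

Definition Rinf (P : R -> Prop) : R := - Rsup (fun x => P (- x)).

Definition sumN (f : nat -> R) (N : nat) : R :=
  fold_right (fun k acc => f k + acc) 0 (seq 0 N).
Definition minN (f : nat -> R) (n : nat) : R :=
  fold_right (fun k acc => Rmin (f k) acc) (f 0%nat) (seq 0 n).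

Definition open_set (U : pset) : Prop :=
  forall q, U q -> exists eps, 0 < eps /\
    forall q', (fst q' - fst q) ^ 2 + (snd q' - snd q) ^ 2 < eps ^ 2 -> U q'.

Inductive borel : pset -> Prop :=
| borel_open : forall U, open_set U -> borel U
| borel_compl : forall A, borel A -> borel (fun q => ~ A q)
| borel_union : forall A : nat -> pset,
    (forall k, borel (A k)) -> borel (fun q => exists k, A k q).

Record box := Box { bx1 : R; bx2 : R; by1 : R; by2 : R }.
Definition box_ok (b : box) : Prop := bx1 b <= bx2 b /\ by1 b <= by2 b.
Definition in_box (b : box) (q : pt) : Prop :=
  bx1 b <= fst q <= bx2 b /\ by1 b <= snd q <= by2 b.
Definition box_area (b : box) : R := (bx2 b - bx1 b) * (by2 b - by1 b).

Definition outer (A : pset) : R :=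
  Rinf (fun s => exists bs : nat -> box,
          (forall k, box_ok (bs k)) /\
          (forall q, A q -> exists k, in_box (bs k) q) /\
          Un_cv (fun N => sum_f_R0 (fun k => box_area (bs k)) N) s).

(** Carathéodory measurability (test sets: boxes, which suffices for
    Lebesgue outer measure). *)
Definition lmeas (E : pset) : Prop :=
  forall b, box_ok b ->
    outer (in_box b) = outer (fun q => in_box b q /\ E q)
                       + outer (fun q => in_box b q /\ ~ E q).

(** * Integral of a non-negative function over X (sup of integrals of
    non-negative simple functions below v on X). Used for measurable v and
    bounded measurable X, where it is the Lebesgue integral. *)
Definition integral (v : pt -> R) (X : pset) : R :=
  Rsup (fun t => exists (N : nat) (A : nat -> pset) (c : nat -> R),
          (forall k, (k < N)%nat ->
             lmeas (A k) /\ 0 <= c k /\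
             forall q, A k q -> X q /\ c k <= v q) /\
          (forall j k, (j < N)%nat -> (k < N)%nat -> j <> k ->
             forall q, ~ (A j q /\ A k q)) /\
          t = sumN (fun k => c k * outer (A k)) N).

Definition Vm (v : pt -> R) (X : pset) : R := integral v X.

(** v is an admissible density of a value measure on C: non-negative, bounded,
    measurable (hence integrable) on C, with V(C) > 0 (needed so that the
    normalized value V(X)/V(C) makes sense). *)
Definition value_density (C : pset) (v : pt -> R) : Prop :=
  (forall q, C q -> 0 <= v q) /\
  (exists M, forall q, C q -> v q <= M) /\
  (forall t, lmeas (fun q => C q /\ t < v q)) /\
  0 < Vm v C.

(** * Rectangles and squares of arbitrary orientation.
    Orientation: unit vector u = (c,s); frame point p + x u + y u^perp. *)
Definition frame_pt (p : pt) (c s x y : R) : pt :=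
  (fst p + x * c - y * s, snd p + x * s + y * c).

Definition closed_rect (p : pt) (c s a b : R) : pset :=
  fun q => exists x y, 0 <= x <= a /\ 0 <= y <= b /\ q = frame_pt p c s x y.
Definition open_rect (p : pt) (c s a b : R) : pset :=
  fun q => exists x y, 0 < x < a /\ 0 < y < b /\ q = frame_pt p c s x y.

(** X is a (non-degenerate) rectangle with orientation (c,s) and side lengths
    a, b: it lies between the open and the closed rectangle (any boundary
    convention is allowed). *)
Definition rect_with (c s a b : R) (X : pset) : Prop :=
  0 < a /\ 0 < b /\ exists p,
    subset (open_rect p c s a b) X /\ subset X (closed_rect p c s a b).

Definition unit_dir (c s : R) : Prop := c ^ 2 + s ^ 2 = 1.

Definition is_rect (X : pset) : Prop :=
  exists c s a b, unit_dir c s /\ rect_with c s a b X.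

Definition is_cube (c s L : R) (B : pset) : Prop := rect_with c s L L B.

(** R-fat: contains a square B- and is contained in a parallel square B+
    with len(B+)/len(B-) <= R.  (Two parallel squares can always be described
    with the same orientation vector.) *)
Definition fat (Rf : R) (X : pset) : Prop :=
  exists c s Bm Bp Lm Lp, unit_dir c s /\
    is_cube c s Lm Bm /\ is_cube c s Lp Bp /\
    subset Bm X /\ subset X Bp /\ Lp / Lm <= Rf.

Definition fat_rect (Rf : R) (X : pset) : Prop :=
  borel X /\ is_rect X /\ fat Rf X.

Definition VS (Rf : R) (v : pt -> R) (X : pset) : R :=
  Rsup (fun t => exists s, fat_rect Rf s /\ subset s X /\ t = Vm v s).

Definition EF_alloc (C : pset) (n : nat) (Rf : R) (v : nat -> pt -> R)
    (X : nat -> pset) : Prop :=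
  (forall i, (i < n)%nat -> fat_rect Rf (X i) /\ subset (X i) C) /\
  (forall i j, (i < n)%nat -> (j < n)%nat -> i <> j ->
     forall q, ~ (X i q /\ X j q)) /\
  (forall i j, (i < n)%nat -> (j < n)%nat ->
     VS Rf (v i) (X j) <= VS Rf (v i) (X i)).

Definition PropEF (C : pset) (n : nat) (Rf : R) : R :=
  Rinf (fun p => exists v : nat -> pt -> R,
          (forall i, (i < n)%nat -> value_density C (v i)) /\
          p = Rsup (fun r => exists X, EF_alloc C n Rf v X /\
                     r = minN (fun i => Vm (v i) (X i) / Vm (v i) C) n)).

(* Main.v *)
(** An affine map turns the rectangle into the unit square and the pieces we use into
    squares.  The words of length at most [n] over the four corners form a tree; the square
    of a node is the corner square of its parent, with a ratio which is a parameter.  The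
    ratios of the four children of a node move in a star with five legs: towards the end of
    one leg all four children grow into copies of the parent, towards the end of another
    leg one child shrinks to a point while the others grow.  The children always cover the
    parent, hence the values are subadditive along the tree.

    Every agent distributes a unit of weight continuously over the leaves whose squares are
    almost optimal for it.  The parameters are chosen as a solution of a complementarity
    problem, obtained from a cubical Sperner lemma, which compares the load of each subtree
    with a capacity slightly smaller than [n / (n - 1)].  At a solution a node below its
    capacity has all the leaves under it equal to its own square; a node above it sits at
    the centre of the star, or on a leg where the three growing children have together a
    load within the capacity.  Collecting leaves accordingly gives regions with loads below
    [n / (n - 1)] such that squares of different regions do not overlap.  By Hall's theorem
    the agents can be matched with distinct regions in which they have positive weight, so
    that everyone receives an almost optimal square, and an induction on the tree bounds the
    value of the unit square by almost [6 n - 8] times the value received.  A limit makes the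
    division exact, and [6 n - 8 <= 4 ^ ceil (log2 n)]. *)

(* Two opposite demands fix the capacity: below $n/(n-1)$ for Hall's condition, and above 1 so that
   each descent into an overloaded child leaves more than one of the [n] units of load behind. The
   obstacle is a square cut into four halves of which one child takes nearly all the load:
   descending makes no progress. The leg of that child shrinks it while the others grow, until these
   carry about a capacity; they may then overlap and are kept as one region. The common leg undoes
   the cut of a square with little load, whose value would otherwise be lost. The star holds just
   these configurations and is a retract of a cube, so all choices can be made continuously at once.
   Envy is controlled by the weights alone, since they sit on almost optimal leaves. The bound $6 t
   - 2$ on the value of a node, with its load $t$ in units of the capacity, is the least affine one
   that admits four light children at $t = 1$ and two overloaded children beside two light ones. At
   the root $t$ tends to $n - 1$, whence $6 n - 8$; this equals $4^{\lceil \log_2 n \rceil}$ at $n =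
   2$ and $n = 4$. *)
Require Import Defs.
From Stdlib Require Import Reals.
From Stdlib Require Import Lra ZArith Lia List Permutation ClassicalEpsilon Compare_dec Cantor.
From HB Require Import structures.
From mathcomp Require all_boot.
Import ListNotations.
Open Scope R_scope.
Set Warnings "-notation-overridden".

(** * A combinatorial lemma of Kuhn *)

Module Kuhn.
Import all_boot.
Set Implicit Arguments.
Unset Strict Implicit.
Local Open Scope nat_scope.

Local Notation "\xor_ ( i | P ) F" := (\big[addb/false]_(i | P) F)
  (at level 41, F at level 41, i, P at level 50).
Local Notation "\xor_ ( i 'in' A ) F" := (\big[addb/false]_(i in A) F)
  (at level 41, F at level 41, i, A at level 50).

Section KuhnLemma.
Variables (I : finType) (p : nat).
Local Notation V := {ffun I -> 'I_p.+1}.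
Variable l : I -> V -> bool.

(** At [v k = p] the successor overflows and [inord] falls back to 0, so [up k] is cyclic;
    [xor_telescope] relies on this default. *)
Definition up (k : I) (v : V) : V :=
  [ffun i => if i == k then inord (v i).+1 else v i].

Lemma upC k k' v : up k (up k' v) = up k' (up k v).
Proof.
apply/ffunP=> i; rewrite !ffunE; case: (altP (i =P k)) => [->|ik]; last by [].
by case: (altP (k =P k')) => [->|].
Qed.

(* Modulo 2, the labels are 0-cochains of the cubical complex and [cup] evaluates the cup
   product of their coboundaries on the face at [v] spanned by [J].  This product is a
   cocycle, and telescoping it along each coordinate shows that its sum over all top cells
   is odd, so some cell sees every label change. *)
Fixpoint cup (ls : seq I) (v : V) (J : {set I}) : bool :=
  if ls is i :: ls' then
    \xor_(k in J) ((l i v (+) l i (up k v)) && cup ls' (up k v) (J :\ k))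
  else true.

(** The pairs [(k, k')] and [(k', k)] cancel modulo 2. *)
Lemma xor_sym (s : I -> I -> bool) (J : {set I}) :
  (forall k k', s k k' = s k' k) ->
  \xor_(k in J) \xor_(k' in J :\ k) s k k' = false.
Proof.
move=> sC; elim: {J}#|J| {-2}J (erefl #|J|) => [|n IH] J cJ.
  by rewrite (cards0_eq cJ) big_set0.
have /card_gt0P[x xJ] : 0 < #|J| by rewrite cJ.
rewrite (big_setD1 x) //=.
under [X in _ (+) X]eq_bigr => k kJ.
  have xJk : x \in J :\ k by move: kJ; rewrite !inE xJ eq_sym => /andP[-> _].
  rewrite (big_setD1 x) //= sC.
  have -> : (J :\ k) :\ x = (J :\ x) :\ k by rewrite !setDDl setUC.
  over.
rewrite big_split /= IH ?addbF ?addbb //.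
by move: cJ; rewrite (cardsD1 x) xJ => -[].
Qed.

(** This is the Leibniz rule with $\delta\delta = 0$. Once the first label is peeled off, some terms
    are symmetric in the two removed directions, or become so by [step], and cancel in pairs. The
    others carry the factor [l i (up k' b)] and vanish by the induction hypothesis at the base point
    [up k' b]. *)
Lemma cup_cocycle ls b (J : {set I}) :
  \xor_(k in J) (cup ls b (J :\ k) (+) cup ls (up k b) (J :\ k)) = false.
Proof.
elim: ls b J => [|i ls IH] b J /=; first by rewrite big1.
have step c (K : {set I}) : \xor_(k in K) cup ls c (K :\ k) = \xor_(k in K) cup ls (up k c) (K :\ k).
  have addb_eq x y : x (+) y = false -> x = y by case: x y => [] [].
  by apply: addb_eq; rewrite -big_split /= IH.
pose t k k' := cup ls (up k' b) ((J :\ k) :\ k').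
pose q k k' := cup ls (up k' (up k b)) ((J :\ k) :\ k').
have qC k k' : q k k' = q k' k by rewrite /q upC !setDDl setUC.
transitivity (\xor_(k in J) \xor_(k' in J :\ k) 
   ((l i b && t k k') (+) ((l i (up k' b) && t k k') (+) (l i (up k b) && q k k'))
    (+) (l i (up k' (up k b)) && q k k'))).
  apply: eq_bigr => k _; rewrite -big_split /=; apply: eq_bigr => k' _.
  rewrite -/(t k k') -/(q k k').
  by move: (l i b) (l i (up k' b)) (l i (up k b)) (l i (up k' (up k b))) (t k k') (q k k')
    => [] [] [] [] [] [].
under eq_bigr do rewrite big_split /=.
rewrite big_split /= [X in _ (+) X]xor_sym ?addbF; last first.
  by move=> k k'; rewrite qC upC.
under eq_bigr do rewrite big_split /=.
rewrite big_split /=.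
have -> : \xor_(k in J) \xor_(k' in J :\ k) (l i b && t k k') = false.
  under eq_bigr do rewrite -big_distrr /= /t -step big_distrr /=.
  by rewrite xor_sym // => k k'; rewrite !setDDl setUC.
rewrite /=.
under eq_bigr do rewrite big_split /=.
rewrite big_split /=.
have swap (s : I -> I -> bool) : \xor_(k in J) \xor_(k' in J :\ k) s k k' =
     \xor_(k' in J) \xor_(k in J :\ k') s k k'.
  rewrite (exchange_big_dep (mem J)) /=; last by move=> k k' _; rewrite !inE => /andP[].
  by apply: eq_bigr => k' k'J; apply: eq_bigl => k; rewrite !inE k'J andbT eq_sym andbC.
rewrite swap -big_split /= big1 // => k' k'J.
rewrite -!big_distrr /= -andb_addr.
rewrite /t.
have -> : \xor_(k in J :\ k') t k k' = \xor_(k in J :\ k') cup ls (up k' b) ((J :\ k') :\ k).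
  by apply: eq_bigr => k _; rewrite /t !setDDl setUC.
rewrite step addbb andbF //.
Qed.

Hypothesis p_gt0 : 0 < p.
Hypothesis l_low : forall i (v : V), v i = 0 :> nat -> l i v = false.
Hypothesis l_high : forall i (v : V), v i = p :> nat -> l i v = true.

Lemma up_neq k i (v : V) : i != k -> up k v i = v i.
Proof. by move=> ik; rewrite ffunE (negbTE ik). Qed.

Lemma up_eq k (v : V) : v k < p -> up k v k = (v k).+1 :> nat.
Proof. by move=> vk; rewrite ffunE eqxx inordK. Qed.

(** No step in [K] leaves the side of the cube on which coordinate [k] is extreme. Label [k] is
    constant there, so its coboundary is zero. *)
Lemma cup_face ls k (v : V) (K : {set I}) : k \in ls -> k \notin K ->
  v k = 0 :> nat \/ v k = p :> nat -> cup ls v K = false.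
Proof.
elim: ls v K => [|i ls IH] v K //=; rewrite inE => kls kK vk.
apply: big1 => k' k'K.
have kk' : k != k' by apply: contraNneq kK => ->.
case: (altP (k =P i)) kls => [<- _|ki /= kls].
  have -> : l k v = l k (up k' v).
    by case: vk => vk; [rewrite !l_low ?up_neq | rewrite !l_high ?up_neq].
  by rewrite addbb.
rewrite (IH _ (K :\ k')) ?andbF // ?up_neq //.
by rewrite !inE (negbTE kK) andbF.
Qed.

(** Base points of the unit cells with directions [J] in the face of the cube where all other
    coordinates are maximal; [rest] drops the condition on [k]. *)
Definition base (J : {set I}) (b : V) :=
  [forall i, if i \in J then b i < p else b i == p :> nat].

Definition rest k (J : {set I}) (b : V) :=
  [forall i, (i != k) ==> if i \in J then b i < p else b i == p :> nat].

Lemma baseE k (J : {set I}) b : base J b =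
  rest k J b && (if k \in J then b k < p else b k == p :> nat).
Proof.
apply/forallP/andP => [H|[/forallP H Hk] i].
  by split; [apply/forallP => i; apply/implyP => _|]; exact: H.
by case: (altP (i =P k)) => [->|ik]; [|move/implyP: (H i); apply].
Qed.

Lemma xor_telescope k (J : {set I}) (h : V -> bool) : k \in J ->
  \xor_(b | base J b) (h b (+) h (up k b)) =
  (\xor_(b | rest k J b && (b k == 0 :> nat)) h b) (+)
  (\xor_(b | rest k J b && (b k == p :> nat)) h b).
Proof.
move=> kJ; rewrite big_split /=.
pose down (c : V) : V := [ffun i => if i == k then inord (c i).-1 else c i].
have -> : \xor_(b | base J b) h (up k b) = \xor_(c | rest k J c && (0 < c k)) h c.
  rewrite [RHS](reindex_onto (up k) down) /=; last first.
    move=> c /andP[_ ck]; apply/ffunP=> i; rewrite !ffunE.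
    case: (altP (i =P k)) => [->|//]; apply: val_inj => /=.
    have lt := ltn_ord (c k).
    have e1 : (inord (c k).-1 : 'I_p.+1) = (c k).-1 :> nat.
      by rewrite inordK // (leq_ltn_trans (leq_pred _)).
    by rewrite e1 prednK // inordK.
  apply: eq_bigl => b; rewrite (baseE k) kJ.
  have -> : rest k J (up k b) = rest k J b.
    by apply: eq_forallb => i; case: (altP (i =P k)) => // ik; rewrite up_neq.
  case: (rest k J b) => //=.
  case: ltnP => bk.
    rewrite up_eq //=; apply/esym/eqP/ffunP=> i; rewrite !ffunE.
    case: (altP (i =P k)) => [->|//]; apply: val_inj => /=.
    have e2 : (inord (b k).+1 : 'I_p.+1) = (b k).+1 :> nat by rewrite inordK.
    by rewrite e2 /= inordK.
  (* Here [up k b] wraps around to 0, a value that the other side excludes as well, so the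
     reindexing is exact. *)
  have bkp : b k = p :> nat.
    by apply/eqP; rewrite eqn_leq bk andbT -ltnS ltn_ord.
  rewrite (_ : (up k b k : nat) = 0) // ffunE eqxx bkp /inord /insubd insubN //.
  by rewrite -leqNgt.
have split3 P : \xor_(c | rest k J c && P c) h c =
   (\xor_(c | rest k J c && P c && (0 < c k < p)) h c) (+)
   (\xor_(c | rest k J c && P c && ~~ (0 < c k < p)) h c).
  by rewrite -bigID.
under eq_bigl do rewrite (baseE k) kJ.
rewrite (split3 (fun c => c k < p)) (split3 (fun c => 0 < c k)).
set A := bigop _ _ _; set B := bigop _ _ _; set A' := bigop _ _ _.
have -> : A' = A.
  by apply: eq_bigl => c; case: (0 < _); case: (_ < p); rewrite ?andbF ?andbT.
rewrite addbACA addbb addFb; congr (_ (+) _).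
  apply: eq_bigl => c; case: (rest _ _ _) => //=.
  by rewrite negb_and -leqNgt leqn0; case: eqP => [->|_]; rewrite ?p_gt0 // andbN.
apply: eq_bigl => c; case: (rest _ _ _) => //=.
have := ltn_ord (c k); rewrite ltnS => lt.
rewrite negb_and -!leqNgt leqn0 [RHS]eqn_leq lt /=.
by case: (posnP (c k)) => [->|//]; rewrite leqNgt p_gt0.
Qed.

(** By the cocycle identity the sum over the cells becomes a sum of differences along each direction
    [k]. For [k] in [ls] both boundary terms vanish by [cup_face]. For [k = i] the label is false at
    0 and true at [p], which leaves the same sum for [ls] on the face [b i = p]. *)
Lemma cup_parity ls : uniq ls ->
  \xor_(b | base [set i in ls] b) cup ls b [set i in ls] = true.
Proof.
elim: ls => [_|i ls IH /= /andP[ils uls]].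
  rewrite (big_pred1 [ffun=> ord_max]) // => b.
  apply/forallP/idP => [H|/eqP -> i]; last by rewrite !inE ffunE eqxx.
  apply/eqP/ffunP=> i; apply: val_inj; rewrite ffunE; apply/eqP; by move: (H i); rewrite !inE.
set J := [set _ in _ :: _].
have iJ : i \in J by rewrite !inE eqxx.
have Ji : J :\ i = [set j in ls].
  apply/setP=> j; rewrite !inE; case: (altP (j =P i)) => [->|//].
  by rewrite (negbTE ils).
pose h k v := l i v && cup ls v (J :\ k).
transitivity (\xor_(k in J) \xor_(b | base J b) (h k b (+) h k (up k b))).
  rewrite [RHS]exchange_big /=; apply: eq_bigr => b _.
  rewrite [RHS]big_split /=.
  under eq_bigr do rewrite andb_addl.
  rewrite big_split /=; congr (_ (+) _).
  rewrite /h -!big_distrr /=; congr (_ && _).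
  have addb_eq x y : x (+) y = false -> x = y by case: x y => [] [].
  by apply/esym/addb_eq; rewrite -big_split /= cup_cocycle.
rewrite (big_setD1 i) //= [X in _ (+) X]big1 ?addbF; last first.
  move=> k /[!inE] /andP[ki /orP[/eqP kk|kls]]; first by rewrite kk eqxx in ki.
  have kJ : k \in J by rewrite !inE kls orbT.
  rewrite xor_telescope // !big1 // => b /andP[_ /eqP bk]; rewrite /h.
    by rewrite (@cup_face _ k) ?andbF ?inE ?eqxx //; right.
  by rewrite (@cup_face _ k) ?andbF ?inE ?eqxx //; left.
rewrite xor_telescope // big1 ?addFb; last first.
  by move=> b /andP[_ /eqP bk]; rewrite /h l_low.
rewrite -[RHS](IH uls); apply: eq_big => b.
  rewrite (baseE i) !inE (negbTE ils); congr (_ && _).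
  by apply: eq_forallb => j; rewrite !inE; case: (altP (j =P i)).
by move=> /andP[_ /eqP bi]; rewrite /h l_high //= Ji.
Qed.

(** A nonzero product has a nonzero term, which is a monotone lattice path through the cell with one
    edge for each label, along which that label changes. *)
Lemma cup_path ls (v : V) (J : {set I}) : (forall j, j \in J -> v j < p) ->
  cup ls v J -> forall i, i \in ls -> exists u w : V,
  [/\ l i u != l i w, forall j, v j <= u j <= v j + (j \in J)
    & forall j, v j <= w j <= v j + (j \in J)].
Proof.
elim: ls v J => [|i ls IH] v J vJ //= cv j.
have [k kJ /andP[lk ck]] : exists2 k, k \in J &
    (l i v (+) l i (up k v)) && cup ls (up k v) (J :\ k).
  apply/exists_inP; apply: contraLR cv => /exists_inPn H.
  by rewrite big1 // => k kJ; apply/negbTE/H.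
rewrite inE => /orP[/eqP ->|jls].
  exists v, (up k v); split=> [|j'|j']; last 1 first.
  - case: (altP (j' =P k)) => [->|jk]; last by rewrite up_neq // leqnn leq_addr.
    by rewrite kJ up_eq ?vJ // addn1 leqnn leqnSn.
  - by case: (l _ _) (l _ _) lk => [] [].
  - by rewrite leqnn leq_addr.
have upJ j' : j' \in J :\ k -> up k v j' < p.
  by rewrite !inE => /andP[jk jJ]; rewrite up_neq // vJ.
have [u [w [luw hu hw]]] := IH (up k v) (J :\ k) upJ ck j jls.
have bnd (t : V) : (forall j', up k v j' <= t j' <= up k v j' + (j' \in J :\ k)) ->
    forall j', v j' <= t j' <= v j' + (j' \in J).
  move=> ht j'; move: (ht j'); rewrite !inE; case: (altP (j' =P k)) => [->|jk].
    by rewrite kJ up_eq ?vJ //= addn0 addn1 => /andP[/ltnW -> ->].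
  by rewrite up_neq.
by exists u, w; split; [|exact: bnd|exact: bnd].
Qed.

Lemma kuhn : exists b : V, forall i, exists u w : V,
  [/\ ~~ l i u, l i w, forall j, b j <= u j <= (b j).+1 & forall j, b j <= w j <= (b j).+1].
Proof.
have /exists_inP[b /forallP bb cb] : [exists b in base [set i in enum I],
    cup (enum I) b [set i in enum I]].
  have := cup_parity (enum_uniq I); apply: contraTT => /exists_inPn H.
  by rewrite big1 // => b bb; apply/negbTE/H.
exists b => i.
have bp j : j \in [set i in enum I] -> b j < p by move: (bb j) => /[swap] ->.
have ie : i \in enum I by rewrite mem_enum.
have [u [w [luw hu hw]]] := cup_path bp cb ie.
have wk (t : V) : (forall j, b j <= t j <= b j + (j \in [set i in enum I])) ->
    forall j, b j <= t j <= (b j).+1.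
  by move=> ht j; move: (ht j); rewrite !inE mem_enum addn1.
case lu: (l i u) luw => lw.
  by exists w, u; split; [case: (l i w) lw | | exact: wk | exact: wk].
by exists u, w; split; [rewrite lu | case: (l i w) lw | exact: wk | exact: wk].
Qed.

End KuhnLemma.
End Kuhn.

(** * Complementarity *)

(** Continuity is asked along sequences in the unit cube only: the solution is a limit of grid
    points, and the denominators of the weights are known to be nonzero only there. *)
Definition scont {I : Type} (G : (I -> R) -> R) : Prop :=
  forall (x : nat -> I -> R) (y : I -> R),
    (forall n i, 0 <= x n i <= 1) -> (forall i, 0 <= y i <= 1) ->
    (forall i, Un_cv (fun n => x n i) (y i)) ->
    Un_cv (fun n => G (x n)) (G y).

Definition increasing (phi : nat -> nat) : Prop := forall n, (phi n < phi (S n))%nat.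

Lemma increasing_ge (phi : nat -> nat) : increasing phi -> forall n, (n <= phi n)%nat.
Proof. intros H n; induction n as [|n IH]; [lia|specialize (H n); lia]. Qed.

Lemma increasing_lt (phi : nat -> nat) : increasing phi ->
  forall n m, (n < m)%nat -> (phi n < phi m)%nat.
Proof. intros H n m nm; induction nm; [apply H|specialize (H m); lia]. Qed.

Lemma Un_cv_subseq (u : nat -> R) (l : R) (phi : nat -> nat) :
  increasing phi -> Un_cv u l -> Un_cv (fun n => u (phi n)) l.
Proof.
intros Hphi Hu eps Heps; destruct (Hu eps Heps) as [N HN].
exists N; intros n Hn; apply HN.
generalize (increasing_ge phi Hphi n); lia.
Qed.

Lemma Un_cv_between (u : nat -> R) (l a b : R) :
  (forall n, a <= u n <= b) -> Un_cv u l -> a <= l <= b.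
Proof.
intros H Hu; split; apply Rnot_lt_le; intros Hl.
- destruct (Hu (a - l)) as [N HN]; [lra|].
  generalize (HN N (le_n N)) (H N); unfold R_dist; split_Rabs; lra.
- destruct (Hu (l - b)) as [N HN]; [lra|].
  generalize (HN N (le_n N)) (H N); unfold R_dist; split_Rabs; lra.
Qed.

Lemma subseq_cv (u : nat -> R) : (forall n, 0 <= u n <= 1) ->
  exists phi l, increasing phi /\ Un_cv (fun n => u (phi n)) l.
Proof.
intros H.
destruct (Bolzano_Weierstrass u (fun x => 0 <= x <= 1) (compact_P3 0 1) H) as [l Hl].
assert (step : forall n N : nat, exists m, (N < m)%nat /\ Rabs (u m - l) < / (INR n + 1)).
{ intros n N.
  assert (Hp : 0 < / (INR n + 1)) by (apply Rinv_0_lt_compat; generalize (pos_INR n); lra).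
  destruct (Hl (disc l (mkposreal _ Hp)) (S N)) as [m [Hm1 Hm2]].
  - exists (mkposreal _ Hp); intros y Hy; exact Hy.
  - exists m; split; [lia|exact Hm2]. }
pose (next := fun n N => proj1_sig (constructive_indefinite_description _ (step n N))).
assert (Hnext : forall n N, (N < next n N)%nat /\ Rabs (u (next n N) - l) < / (INR n + 1)).
{ intros n N; exact (proj2_sig (constructive_indefinite_description _ (step n N))). }
pose (phi := fix phi n := match n with O => next O O | S k => next (S k) (phi k) end).
exists phi, l; split.
- intros n; apply (Hnext (S n) (phi n)).
- intros eps Heps.
  destruct (archimed_cor1 eps Heps) as [N [HN HN0]].
  exists N; intros n Hn.
  assert (Hb : Rabs (u (phi n) - l) < / (INR n + 1)) by (destruct n; apply Hnext).
  unfold R_dist; eapply Rlt_trans; [exact Hb|].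
  eapply Rle_lt_trans; [|exact HN].
  apply Rinv_le_contravar; [apply lt_0_INR; lia|].
  apply le_INR in Hn; lra.
Qed.

Lemma subseq_cv_list {A : Type} (L : list A) (u : A -> nat -> R) :
  (forall a n, 0 <= u a n <= 1) ->
  exists phi (l : A -> R), increasing phi /\
    forall a, In a L -> Un_cv (fun n => u a (phi n)) (l a).
Proof.
intros H.
assert (G : exists phi, increasing phi /\
   forall a, In a L -> exists l, Un_cv (fun n => u a (phi n)) l).
{ induction L as [|a L [phi [Hphi IH]]].
  - exists (fun n => n); split; [intros n; lia|intros a []].
  - destruct (subseq_cv (fun n => u a (phi n)) (fun n => H a (phi n))) as [psi [l [Hpsi Hl]]].
    exists (fun n => phi (psi n)); split.
    + intros n; apply increasing_lt; [exact Hphi|apply Hpsi].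
    + intros b [<-|Hb]; [exists l; exact Hl|].
      destruct (IH b Hb) as [l' Hl']; exists l'.
      exact (Un_cv_subseq (fun n => u b (phi n)) l' psi Hpsi Hl'). }
destruct G as [phi [Hphi G]].
assert (C : forall a, exists l, In a L -> Un_cv (fun n => u a (phi n)) l).
{ intros a; destruct (excluded_middle_informative (In a L)) as [i|i].
  - destruct (G a i) as [l Hl]; exists l; intros _; exact Hl.
  - exists 0; intros; contradiction. }
exists phi, (fun a => proj1_sig (constructive_indefinite_description _ (C a))).
split; [exact Hphi|].
intros a Ha; exact (proj2_sig (constructive_indefinite_description _ (C a)) Ha).
Qed.

Module Complementarity.
Import all_boot.
Set Implicit Arguments.
Unset Strict Implicit.
Local Open Scope R_scope.

Section Complementarity.
Variables (I : finType) (F : (I -> R) -> I -> R).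
Hypothesis Fcont : forall i, scont (fun x => F x i).

Definition grid_pt (p : nat) (v : {ffun I -> 'I_p.+2}) : I -> R :=
  fun i => INR (v i) / INR p.+1.

(** On the two extreme sides the value is the one that Kuhn's lemma prescribes; in between it
    records the sign of [F]. There are [p.+1] steps, so the mesh makes sense for [p = 0] too. *)
Definition label (p : nat) (i : I) (v : {ffun I -> 'I_p.+2}) : bool :=
  (nat_of_ord (v i) == p.+1) || ((nat_of_ord (v i) != 0%N) &&
     (if Rlt_dec (F (grid_pt v) i) 0 then true else false)).

Lemma grid_pt_bounds p (v : {ffun I -> 'I_p.+2}) i : 0 <= grid_pt v i <= 1.
Proof.
have hp : 0 < INR p.+1 by apply: lt_0_INR; lia.
have hv : INR (v i) <= INR p.+1 by apply/le_INR/leP; rewrite -ltnS ltn_ord.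
split; first by apply: Rle_mult_inv_pos => //; exact: pos_INR.
by apply: (Rmult_le_reg_r (INR p.+1)) => //; rewrite /grid_pt /Rdiv Rmult_assoc Rinv_l; lra.
Qed.

Lemma grid_pt_close p (b u : {ffun I -> 'I_p.+2}) i :
  (forall j, b j <= u j <= (b j).+1)%N ->
  Rabs (grid_pt u i - grid_pt b i) <= / (INR p + 1).
Proof.
move=> /(_ i)/andP[/leP/le_INR h1 /leP/le_INR]; rewrite !S_INR => h2.
have hp : 0 < INR p + 1 by have := pos_INR p; lra.
have hi := Rinv_0_lt_compat _ hp.
rewrite /grid_pt S_INR /Rdiv -Rmult_minus_distr_r Rabs_pos_eq.
  by rewrite -{2}(Rmult_1_l (/ _)); apply: Rmult_le_compat_r; lra.
by apply: Rmult_le_pos; lra.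
Qed.

(** In ever finer grids Kuhn's cells accumulate at a point [x]. If [F x i] is positive, nearby
    vertices with a true label must lie on the side 1; if it is negative, those with a false label
    must lie on the side 0. Each cell has vertices of both kinds. *)
Lemma complementarity : exists x : I -> R, (forall i, 0 <= x i <= 1) /\
  forall i, (0 < F x i -> x i = 1) /\ (F x i < 0 -> x i = 0).
Proof.
have K p : exists b : {ffun I -> 'I_p.+2}, forall i, exists u w : {ffun I -> 'I_p.+2},
  [/\ ~~ label i u, label i w, forall j, (b j <= u j <= (b j).+1)%N
     & forall j, (b j <= w j <= (b j).+1)%N].
  apply: (@Kuhn.kuhn I p.+1 (@label p)) => // i v vi; rewrite /label vi //=.
  by rewrite eqxx.
have [b Hb] : exists b : forall p, {ffun I -> 'I_p.+2}, forall p i,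
  exists u w : {ffun I -> 'I_p.+2},
  [/\ ~~ label i u, label i w, forall j, (b p j <= u j <= (b p j).+1)%N
     & forall j, (b p j <= w j <= (b p j).+1)%N].
  exists (fun p => proj1_sig (constructive_indefinite_description _ (K p))) => p.
  exact: (proj2_sig (constructive_indefinite_description _ (K p))).
have [phi [x [Hphi Hx]]] := subseq_cv_list (enum I) (fun i n => grid_pt (b n) i)
   (fun i n => grid_pt_bounds (b n) i).
have inI (i : I) : List.In i (enum I).
  have : i \in enum I by rewrite mem_enum.
  elim: (enum I) => //= a l IH; rewrite inE => /orP[/eqP ->|/IH]; by [left|right].
have {}Hx i : Un_cv (fun n => grid_pt (b (phi n)) i) (x i) by exact: Hx.
have x01 i : 0 <= x i <= 1.
  by apply: (Un_cv_between _ _ 0 1) (Hx i) => n; exact: grid_pt_bounds.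
exists x; split=> // i.
have near (u : forall n, {ffun I -> 'I_(phi n).+2}) :
   (forall n j, (b (phi n) j <= u n j <= (b (phi n) j).+1)%N) ->
   (forall j, Un_cv (fun n => grid_pt (u n) j) (x j)) /\
   Un_cv (fun n => F (grid_pt (u n)) i) (F x i).
  move=> Hu.
  have cv j : Un_cv (fun n => grid_pt (u n) j) (x j).
    move=> e He; have [N1 H1] := Hx j (e / 2) ltac:(lra).
    have [N2 [H2 H2']] := archimed_cor1 (e / 2) ltac:(lra).
    exists (N1 + N2)%coq_nat => n Hn.
    have {}H1 := H1 n ltac:(lia).
    have H3 := grid_pt_close j (Hu n).
    have H4 : / (INR (phi n) + 1) <= / INR N2.
      apply: Rinv_le_contravar; first by apply: lt_0_INR; lia.
      have h := increasing_ge phi Hphi n.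
      have : INR N2 <= INR (phi n) by apply: le_INR; lia.
      lra.
    rewrite /R_dist in H1 *; move: H1 H3; split_Rabs; lra.
  split=> //; exact: (@Fcont i (fun n => grid_pt (u n)) x (fun n => grid_pt_bounds (u n)) x01 cv).
have [u Hu] : exists u : forall n, {ffun I -> 'I_(phi n).+2}, forall n,
   ~~ label i (u n) /\ (forall j, (b (phi n) j <= u n j <= (b (phi n) j).+1)%N).
  have E n : exists u : {ffun I -> 'I_(phi n).+2}, 
     ~~ label i u /\ (forall j, (b (phi n) j <= u j <= (b (phi n) j).+1)%N).
    by have [u [w [h1 h2 h3 h4]]] := Hb (phi n) i; exists u.
  exists (fun n => proj1_sig (constructive_indefinite_description _ (E n))) => n.
  exact: (proj2_sig (constructive_indefinite_description _ (E n))).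
have [w Hw] : exists u : forall n, {ffun I -> 'I_(phi n).+2}, forall n,
   label i (u n) /\ (forall j, (b (phi n) j <= u n j <= (b (phi n) j).+1)%N).
  have E n : exists u : {ffun I -> 'I_(phi n).+2}, 
     label i u /\ (forall j, (b (phi n) j <= u j <= (b (phi n) j).+1)%N).
    by have [u' [w [h1 h2 h3 h4]]] := Hb (phi n) i; exists w.
  exists (fun n => proj1_sig (constructive_indefinite_description _ (E n))) => n.
  exact: (proj2_sig (constructive_indefinite_description _ (E n))).
have [cvu cvFu] := near u (fun n => proj2 (Hu n)).
have [cvw cvFw] := near w (fun n => proj2 (Hw n)).
have evconst (a : nat -> R) (l c : R) N : Un_cv a l -> (forall n, (n >= N)%coq_nat -> a n = c) -> l = c.
  move=> ha hc; apply: (UL_sequence a) => // e He; exists N => n Hn.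
  by rewrite hc // R_dist_eq.
split=> HF.
- have [N HN] := cvFw (F x i) HF.
  apply: (evconst _ _ _ N (cvw i)) => n Hn; have := HN n Hn.
  have [+ _] := Hw n; rewrite /label => /orP[/eqP e _|/andP[_]].
    by rewrite /grid_pt e; field; apply: not_0_INR.
  case: Rlt_dec => // h _; rewrite /R_dist; split_Rabs; lra.
- have [N HN] := cvFu (- F x i) ltac:(lra).
  apply: (evconst _ _ _ N (cvu i)) => n Hn; have := HN n Hn.
  have [+ _] := Hu n; rewrite /label negb_or negb_and negbK => /andP[_ /orP[/eqP e _|]].
    by rewrite /grid_pt e /= /Rdiv Rmult_0_l.
  case: Rlt_dec => // h _; rewrite /R_dist; split_Rabs; lra.
Qed.
End Complementarity.
End Complementarity.

(** * Matching *)

Definition corner := (bool * bool)%type.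
Definition coord := (list corner * option corner)%type.

Module Matching.
Import all_boot.
Set Implicit Arguments.
Unset Strict Implicit.

Local Open Scope nat_scope.

(** * Hall's marriage theorem *)

Section Hall.
Variables (A B : finType) (E : A -> B -> bool) (b0 : B).

Definition nbh (S : {set A}) : {set B} := [set b | [exists a in S, E a b]].

Lemma nbhU S1 S2 : nbh (S1 :|: S2) = nbh S1 :|: nbh S2.
Proof.
apply/setP=> b; rewrite !inE; apply/exists_inP/orP.
  by case=> a /[!inE] /orP[aS|aS] ab; [left|right]; apply/exists_inP; exists a.
by case=> /exists_inP[a aS ab]; exists a; rewrite // inE aS ?orbT.
Qed.

(** The argument of Halmos and Vaughan. If a nonempty proper subset is tight, it is matched within
    its neighbours and the rest outside them. Otherwise each such subset has a neighbour to spare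
    and any one pair can be removed. The set [T] of partners still free makes the induction go
    through. *)
Lemma hall_in n (S : {set A}) (T : {set B}) : #|S| <= n ->
  (forall S' : {set A}, S' \subset S -> #|S'| <= #|nbh S' :&: T|) ->
  exists f : A -> B, {in S &, injective f} /\
    forall a, a \in S -> (f a \in T) && E a (f a).
Proof.
elim: n S T => [|n IH] S T cS hall.
  move: cS; rewrite leqn0 cards_eq0 => /eqP S0.
  by exists (fun=> b0); split=> [a a'|a]; rewrite S0 inE.
have [->|/set0Pn[a0 a0S]] := eqVneq S set0.
  by exists (fun=> b0); split=> [a a'|a]; rewrite inE.
case: (boolP [exists S' : {set A}, [&& S' \proper S, S' != set0 & #|nbh S' :&: T| <= #|S'|]]).
  move=> /existsP[S' /and3P[pS' S'0 tight]].
  have [S'S ltS'] : S' \subset S /\ #|S'| < #|S| by split; [exact: proper_sub|exact: proper_card].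
  have [|f1 [inj1 f1P]] := IH S' T (leq_trans ltS' cS : #|S'| <= n).
    by move=> S'' sS; apply/hall/(subset_trans sS).
  have cD : #|S :\: S'| <= n.
    rewrite cardsD (setIidPr S'S) -ltnS (leq_trans _ cS) // ltn_subrL.
    by rewrite !card_gt0 S'0 /=; apply/set0Pn; exists a0.
  (* Hall's condition for the rest follows from that for [S'' :|: S'], since the tight set [S']
     accounts for at most [#|S'|] of the neighbours. *)
  have [|f2 [inj2 f2P]] := IH (S :\: S') (T :\: nbh S') cD.
    move=> S'' sS''.
    have dis : S'' :&: S' = set0.
      apply/eqP; rewrite setI_eq0 disjoint_subset; apply: (subset_trans sS'').
      by apply/subsetP=> x /[!inE] /andP[].
    have cU : #|S'' :|: S'| = #|S''| + #|S'| by rewrite cardsU dis cards0 subn0.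
    rewrite -(leq_add2r #|S'|) -cU.
    apply: leq_trans (hall _ _) _.
      by rewrite subUset S'S andbT (subset_trans sS'') ?subsetDl.
    apply: leq_trans (leq_add (leqnn _) tight).
    rewrite nbhU.
    apply: (@leq_trans #|(nbh S'' :&: (T :\: nbh S')) :|: (nbh S' :&: T)|); last by rewrite leq_card_setU.
    apply/subset_leq_card/subsetP=> b.
    rewrite !in_setI !in_setU !in_setI in_setD.
    by move: (b \in nbh S'') (b \in nbh S') (b \in T) => [] [] [].
  exists (fun a => if a \in S' then f1 a else f2 a); split=> [a a'|a] aS.
    move=> a'S; case: ifPn => h; case: ifPn => h'.
    - exact: inj1.
    - have /andP[_ e1] := f1P _ h; have := f2P a'; rewrite inE h' a'S => /(_ isT)/andP[+ _].
      rewrite !inE => /andP[/negP nb _] eqf; case: nb; apply/exists_inP; exists a => //.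
      by rewrite -eqf.
    - have /andP[_ e1] := f1P _ h'; have := f2P a; rewrite inE h aS => /(_ isT)/andP[+ _].
      rewrite !inE => /andP[/negP nb _] eqf; case: nb; apply/exists_inP; exists a' => //.
      by rewrite eqf.
    - by apply: inj2; rewrite inE ?h ?h' ?aS ?a'S.
  case: ifPn => h; first exact: f1P.
  by have := f2P a; rewrite !inE h aS => /(_ isT)/andP[/andP[_ ->] ->].
move=> /existsPn notight.
have [b] : exists b, b \in nbh [set a0] :&: T.
  apply/set0Pn; rewrite -card_gt0; apply: leq_trans (hall [set a0] _); first by rewrite cards1.
  by rewrite sub1set.
rewrite !inE => /andP[/exists_inP[a /[!inE]/eqP -> a0b] bT].
have cD : #|S :\ a0| <= n by rewrite -ltnS (leq_trans _ cS) // (cardsD1 a0 S) a0S.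
have [|f [injf fP]] := IH (S :\ a0) (T :\ b) cD.
  move=> S' sS'; have [->|S'0] := eqVneq S' set0; first by rewrite cards0.
  have pS : S' \proper S.
    apply: (sub_proper_trans sS'); exact: properD1.
  have := notight S'; rewrite pS S'0 /= -ltnNge => lt.
  rewrite -ltnS; apply: (leq_trans lt).
  rewrite (cardsD1 b (nbh S' :&: T)) -[X in _ <= X]add1n; apply: leq_add; first exact: leq_b1.
  by apply/subset_leq_card/subsetP=> x; rewrite !inE => /and3P[-> -> ->].
exists (fun x => if x == a0 then b else f x); split=> [x y|x] xS.
  move=> yS; case: (altP (x =P a0)) => hx; case: (altP (y =P a0)) => hy.
  - by rewrite hx hy.
  - by move=> e; have := fP y; rewrite !inE hy yS -e eqxx => /(_ isT).
  - by move=> e; have := fP x; rewrite !inE hx xS e eqxx => /(_ isT).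
  - by apply: injf; rewrite !inE ?hx ?hy ?xS ?yS.
case: (altP (x =P a0)) => [->|hx]; first by rewrite bT a0b.
by have := fP x; rewrite !inE hx xS => /(_ isT)/andP[/andP[_ ->] ->].
Qed.

End Hall.
Local Open Scope R_scope.

(** * Matchings from real weights *)

Lemma RplusA : associative Rplus. Proof. by move=> x y z; rewrite Rplus_assoc. Qed.
HB.instance Definition _ := Monoid.isComLaw.Build R 0 Rplus RplusA Rplus_comm Rplus_0_l.

Local Notation "\Rsum_ ( i | P ) G" := (\big[Rplus/0]_(i | P) G)
  (at level 41, G at level 41, i, P at level 50).

Lemma sumN_big (g : nat -> R) n : sumN g n = \big[Rplus/0]_(i < n) g i.
Proof.
rewrite -(big_mkord xpredT) /sumN /index_iota subn0 unlock /reducebig /=.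
by move: 0%N; elim: n => [|n IH] k //=; rewrite IH.
Qed.

Lemma Rsum_le (I : finType) (P : pred I) (g h : I -> R) :
  (forall i, P i -> g i <= h i) -> \Rsum_(i | P i) g i <= \Rsum_(i | P i) h i.
Proof.
move=> gh; apply: (big_ind2 (fun x y => x <= y)) => //; first by lra.
by move=> x1 x2 y1 y2; lra.
Qed.

Lemma Rsum_const (I : finType) (P : pred I) (c : R) :
  \Rsum_(i | P i) c = INR #|P| * c.
Proof.
rewrite big_const; elim: #|P| => [|n IH]; first by rewrite /= Rmult_0_l.
by rewrite iterS IH S_INR; ring.
Qed.

(** If the positive weights of [k] agents met at most [k - 1] columns, these would receive at least
    [k] in all, hence one of them at least $k/(k-1) \ge n/(n-1)$, which exceeds [c]. *)
Lemma fractional_matching (n m : nat) (W : nat -> nat -> R) (c : R) :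
  (forall i j, 0 <= W i j) ->
  (forall i, (i < n)%coq_nat -> 1 <= sumN (W i) m) ->
  (forall j, (j < m)%coq_nat -> sumN (fun i => W i j) n <= c) ->
  c * (INR n - 1) < INR n ->
  exists f : nat -> nat,
    (forall i, (i < n)%coq_nat -> (f i < m)%coq_nat /\ 0 < W i (f i)) /\
    (forall i j, (i < n)%coq_nat -> (j < n)%coq_nat -> i <> j -> f i <> f j).
Proof.
case: n => [|n] W0 W1 Wc cn; first by exists id; split=> [i|i j] /ltP.
have m0 : (0 < m)%N.
  case: m W1 {Wc} => [|//] W1; have := W1 0%N ltac:(lia); rewrite /sumN /=; lra.
pose E (i : 'I_n.+1) (j : 'I_m) : bool := if Rlt_dec 0 (W i j) then true else false.
have cT : (#|[set: 'I_n.+1]| <= n.+1)%N by rewrite cardsT card_ord.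
have hallE (S : {set 'I_n.+1}) : S \subset setT -> (#|S| <= #|nbh E S :&: setT|)%N.
  move=> _; rewrite setIT.
  have h1 : INR #|S| <= \Rsum_(i | i \in S) \Rsum_(j | j \in nbh E S) W i j.
    rewrite -[INR _]Rmult_1_r -Rsum_const; apply: Rsum_le => i iS.
    apply: Rle_trans (W1 i ltac:(exact/ltP)) _; rewrite sumN_big.
    rewrite (bigID (mem (nbh E S))) /= [X in _ + X]big1 ?Rplus_0_r; first exact: Rle_refl.
    move=> j jS; apply: Rle_antisym => //; apply: Rnot_lt_le => Wij.
    case/negP: jS; rewrite inE; apply/exists_inP; exists i => //.
    by rewrite /E; case: Rlt_dec.
  have h2 : \Rsum_(i | i \in S) \Rsum_(j | j \in nbh E S) W i j <= INR #|nbh E S| * c.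
    rewrite exchange_big /= -Rsum_const; apply: Rsum_le => j jS.
    apply: Rle_trans (Wc j ltac:(exact/ltP)); rewrite sumN_big.
    rewrite [X in _ <= X](bigID (mem S)) /=.
    rewrite -{1}[bigop _ _ _]Rplus_0_r; apply: Rplus_le_compat_l.
    by apply: (big_ind (fun x => 0 <= x)) => //; [lra|move=> x y; lra].
  rewrite leqNgt; apply/negP => lt.
  have h3 : INR #|nbh E S| + 1 <= INR #|S| by rewrite -S_INR; apply/le_INR/leP.
  have h4 : INR #|S| <= INR n.+1 by apply/le_INR/leP; rewrite -[X in (_ <= X)%N]card_ord max_card.
  have ha := pos_INR #|nbh E S|; rewrite S_INR in cn h4; have hn := pos_INR n.
  have hac : 1 <= INR #|nbh E S| * c by lra.
  have ha0 : 0 < INR #|nbh E S| by case: (Rle_lt_or_eq_dec _ _ ha) hac => // <-; lra.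
  have h5 : INR #|nbh E S| * (c * INR n) < INR #|nbh E S| * (INR n + 1).
    by apply: Rmult_lt_compat_l => //; lra.
  have h6 : INR #|S| * INR n <= INR #|nbh E S| * c * INR n.
    by apply: Rmult_le_compat_r => //; lra.
  have h7 : INR #|nbh E S| * (INR n + 1) <= (INR #|S| - 1) * (INR n + 1).
    by apply: Rmult_le_compat_r; lra.
  lra.
have [f [injf fP]] := hall_in (Ordinal m0) cT hallE.
exists (fun i => nat_of_ord (f (inord i))); split=> [i /ltP hi|i j /ltP hi /ltP hj ij].
  split; first exact/ltP.
  have /andP[_] := fP (inord i) (in_setT _).
  by rewrite /E; case: Rlt_dec => //; rewrite inordK.
move=> e; apply: ij.
have e' : f (inord i) = f (inord j) by exact: val_inj.
by rewrite -(inordK hi) -(inordK hj) (injf _ _ (in_setT _) (in_setT _) e').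
Qed.

(** The unknowns are those of the words of length at most [D]. On longer words [insub_bseq] yields a
    default word, so [ext] still reads a number of the unit interval there, and nothing further is
    claimed about it. *)
Lemma complementarity_list (D : nat) (F : (coord -> R) -> coord -> R) :
  (forall i, scont (fun x => F x i)) ->
  exists x : coord -> R, (forall i, 0 <= x i <= 1) /\
    forall nu k, (length nu <= D)%coq_nat ->
      (0 < F x (nu, k) -> x (nu, k) = 1) /\ (F x (nu, k) < 0 -> x (nu, k) = 0).
Proof.
move=> Fc.
pose I := (D.-bseq (bool * bool) * option (bool * bool))%type : finType.
pose ext (y : I -> R) : coord -> R := fun p => y (insub_bseq D p.1, p.2).
pose G (y : I -> R) (i : I) := F (ext y) (bseqval i.1, i.2).
have Gc i : scont (fun y => G y i).
  move=> x z x01 z01 xz.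
  by apply: (Fc (bseqval i.1, i.2) (fun n => ext (x n)) (ext z)) => *;
    [exact: x01|exact: z01|exact: xz].
have [y [y01 yG]] := Complementarity.complementarity Gc.
exists (ext y); split=> [i|nu k hnu]; first exact: y01.
have := yG (insub_bseq D nu, k); rewrite /G /= /ext /=.
have -> : bseqval (insub_bseq D nu) = nu by rewrite [LHS]insubdK //; apply/leP.
by [].
Qed.

End Matching.

(** * Finite sums and maxima over lists *)

Definition lsum {A : Type} (f : A -> R) (l : list A) : R :=
  fold_right (fun a acc => f a + acc) 0 l.

Lemma lsum_ext {A} (f g : A -> R) l : (forall a, In a l -> f a = g a) -> lsum f l = lsum g l.
Proof.
induction l as [|a l IH]; simpl; intros H; [reflexivity|].
rewrite (H a) by (left; reflexivity); rewrite IH; auto.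
Qed.

Lemma lsum_le {A} (f g : A -> R) l : (forall a, In a l -> f a <= g a) -> lsum f l <= lsum g l.
Proof.
induction l as [|a l IH]; simpl; intros H; [lra|].
assert (f a <= g a) by auto; assert (lsum f l <= lsum g l) by auto; lra.
Qed.

Lemma lsum_app {A} (f : A -> R) l1 l2 : lsum f (l1 ++ l2) = lsum f l1 + lsum f l2.
Proof. induction l1 as [|a l IH]; simpl; [lra|rewrite IH; lra]. Qed.

Lemma lsum_plus {A} (f g : A -> R) l : lsum (fun a => f a + g a) l = lsum f l + lsum g l.
Proof. induction l as [|a l IH]; simpl; [lra|rewrite IH; lra]. Qed.

Lemma lsum_scal {A} (c : R) (f : A -> R) l : lsum (fun a => c * f a) l = c * lsum f l.
Proof. induction l as [|a l IH]; simpl; [ring|rewrite IH; ring]. Qed.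

Lemma lsum_nonneg {A} (f : A -> R) l : (forall a, In a l -> 0 <= f a) -> 0 <= lsum f l.
Proof.
intros H; replace 0 with (lsum (fun _ : A => 0) l); [apply lsum_le; exact H|].
clear H; induction l as [|a l IH]; simpl; [reflexivity|rewrite IH; ring].
Qed.

Lemma lsum_zero {A} (f : A -> R) l : (forall a, In a l -> f a = 0) -> lsum f l = 0.
Proof. induction l as [|a l IH]; simpl; intros H; [reflexivity|rewrite H, IH; auto; ring]. Qed.

Lemma lsum_ge_in {A} (f : A -> R) l a : (forall b, 0 <= f b) -> In a l -> f a <= lsum f l.
Proof.
intros H; induction l as [|b l IH]; simpl; [intros []|intros [->|h]].
- assert (0 <= lsum f l) by (apply lsum_nonneg; auto); lra.
- generalize (H b) (IH h); lra.
Qed.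

Lemma lsum_perm {A} (f : A -> R) l1 l2 : Permutation l1 l2 -> lsum f l1 = lsum f l2.
Proof. induction 1; simpl; lra. Qed.

Lemma lsum_swap {A B} (f : A -> B -> R) la lb :
  lsum (fun a => lsum (f a) lb) la = lsum (fun b => lsum (fun a => f a b) la) lb.
Proof.
induction la as [|a la IH]; simpl.
- rewrite lsum_zero; auto.
- rewrite IH, <- lsum_plus; apply lsum_ext; reflexivity.
Qed.

Lemma lsum_flat_map {A B} (f : B -> R) (g : A -> list B) l :
  lsum f (flat_map g l) = lsum (fun a => lsum f (g a)) l.
Proof. induction l as [|a l IH]; simpl; [reflexivity|rewrite lsum_app, IH; reflexivity]. Qed.

Lemma lsum_concat {A} (f : A -> R) ls : lsum f (concat ls) = lsum (lsum f) ls.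
Proof. induction ls as [|a l IH]; simpl; [reflexivity|rewrite lsum_app, IH; reflexivity]. Qed.

Lemma lsum_seq_nth {A} (f : A -> R) (d : A) l :
  lsum (fun i => f (nth i l d)) (seq 0 (length l)) = lsum f l.
Proof.
assert (G : forall pre, lsum (fun i => f (nth i (pre ++ l) d)) (seq (length pre) (length l)) = lsum f l).
{ induction l as [|a l IH]; intros pre; simpl; [reflexivity|].
  rewrite nth_middle; f_equal.
  replace (pre ++ a :: l) with ((pre ++ [a]) ++ l) by (rewrite <- app_assoc; reflexivity).
  replace (S (length pre)) with (length (pre ++ [a])) by (rewrite length_app; simpl; lia).
  apply IH. }
exact (G []).
Qed.

Lemma lsum_pos_ex {A} (f : A -> R) l : 0 < lsum f l -> exists a, In a l /\ 0 < f a.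
Proof.
induction l as [|a l IH]; simpl; intros H; [lra|].
destruct (Rlt_dec 0 (f a)) as [h|h]; [exists a; auto|].
destruct IH as [b [Hb H']]; [lra|exists b; auto].
Qed.

Definition lmax {A : Type} (f : A -> R) (l : list A) : R :=
  fold_right (fun a acc => Rmax (f a) acc) 0 l.

Lemma lmax_ge {A} (f : A -> R) l a : In a l -> f a <= lmax f l.
Proof.
induction l as [|b l IH]; simpl; [intros []|intros [->|H]].
- apply Rmax_l.
- eapply Rle_trans; [apply IH, H|apply Rmax_r].
Qed.

Lemma lmax_nonneg {A} (f : A -> R) l : 0 <= lmax f l.
Proof. destruct l; simpl; [lra|]. induction l in a |- *; simpl; [apply Rmax_r|].
eapply Rle_trans; [apply (IHl a0)|apply Rmax_r]. Qed.

Lemma lmax_le {A} (f : A -> R) l M : 0 <= M -> (forall a, In a l -> f a <= M) -> lmax f l <= M.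
Proof.
intros HM; induction l as [|b l IH]; simpl; intros H; [exact HM|].
apply Rmax_lub; auto.
Qed.

(** * Continuity along the cube *)

Section Scont.
Context {I : Type}.
Implicit Types G H : (I -> R) -> R.

Lemma scont_const c : scont (fun _ : I -> R => c).
Proof. intros x y _ _ _ e He; exists 0%nat; intros; rewrite R_dist_eq; exact He. Qed.

Lemma scont_coord i : scont (fun x : I -> R => x i).
Proof. intros x y _ _ H; exact (H i). Qed.

Lemma scont_plus G H : scont G -> scont H -> scont (fun x => G x + H x).
Proof. intros HG HH x y hx hy hc; apply (CV_plus (fun n => G (x n)) (fun n => H (x n))); auto. Qed.

Lemma scont_minus G H : scont G -> scont H -> scont (fun x => G x - H x).
Proof. intros HG HH x y hx hy hc; apply (CV_minus (fun n => G (x n)) (fun n => H (x n))); auto. Qed.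

Lemma scont_mult G H : scont G -> scont H -> scont (fun x => G x * H x).
Proof. intros HG HH x y hx hy hc; apply (CV_mult (fun n => G (x n)) (fun n => H (x n))); auto. Qed.

Lemma scont_max G H : scont G -> scont H -> scont (fun x => Rmax (G x) (H x)).
Proof.
intros HG HH x y hx hy hc e He.
destruct (HG x y hx hy hc e He) as [N1 H1]; destruct (HH x y hx hy hc e He) as [N2 H2].
exists (N1 + N2)%nat; intros m Hm.
specialize (H1 m ltac:(lia)); specialize (H2 m ltac:(lia)); revert H1 H2.
unfold R_dist, Rmax; repeat destruct Rle_dec; split_Rabs; lra.
Qed.

Lemma scont_min G H : scont G -> scont H -> scont (fun x => Rmin (G x) (H x)).
Proof.
intros HG HH x y hx hy hc e He.
destruct (HG x y hx hy hc e He) as [N1 H1]; destruct (HH x y hx hy hc e He) as [N2 H2].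
exists (N1 + N2)%nat; intros m Hm.
specialize (H1 m ltac:(lia)); specialize (H2 m ltac:(lia)); revert H1 H2.
unfold R_dist, Rmin; repeat destruct Rle_dec; split_Rabs; lra.
Qed.

Lemma scont_div G H : scont G -> scont H ->
  (forall x, (forall i, 0 <= x i <= 1) -> H x <> 0) -> scont (fun x => G x / H x).
Proof.
intros HG HH H0 x y hx hy hc.
apply (CV_mult (fun n => G (x n)) (fun n => / H (x n))); auto.
apply (continuity_seq (fun t => / t) (fun n => H (x n))); auto.
apply continuity_pt_inv; [apply derivable_continuous_pt, derivable_pt_id|apply H0, hy].
Qed.

Lemma scont_lsum {A} (G : A -> (I -> R) -> R) l :
  (forall a, scont (G a)) -> scont (fun x => lsum (fun a => G a x) l).
Proof. intros HG; induction l; simpl; [apply scont_const|apply scont_plus; auto]. Qed.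

Lemma scont_lmax {A} (G : A -> (I -> R) -> R) l :
  (forall a, scont (G a)) -> scont (fun x => lmax (fun a => G a x) l).
Proof. intros HG; induction l; simpl; [apply scont_const|apply scont_max; auto]. Qed.

End Scont.

(** * Squares *)

Record square := Square { sx : R; sy : R; side : R }.

Definition valid (Q : square) : Prop :=
  0 <= sx Q /\ 0 <= sy Q /\ 0 <= side Q /\ sx Q + side Q <= 1 /\ sy Q + side Q <= 1.

Definition unit_square : square := Square 0 0 1.

Definition bit (b : bool) : R := if b then 1 else 0.

(** The image of [Q] under the homothety of ratio [r] that fixes its corner [j]. *)
Definition child (Q : square) (j : corner) (r : R) : square :=
  Square (sx Q + bit (fst j) * (side Q * (1 - r))) (sy Q + bit (snd j) * (side Q * (1 - r)))
    (side Q * r).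

(** Weak inequalities make this a closed condition, which survives the final limit; it still keeps
    the open squares disjoint. *)
Definition separated (P Q : square) : Prop :=
  sx P + side P <= sx Q \/ sx Q + side Q <= sx P \/
  sy P + side P <= sy Q \/ sy Q + side Q <= sy P.

Definition within (P Q : square) : Prop :=
  sx Q <= sx P /\ sx P + side P <= sx Q + side Q /\
  sy Q <= sy P /\ sy P + side P <= sy Q + side Q.

Lemma separated_sym P Q : separated P Q -> separated Q P.
Proof. unfold separated; tauto. Qed.

Lemma separated_within P Q P' Q' :
  within P' P -> within Q' Q -> separated P Q -> separated P' Q'.
Proof. unfold separated, within; intuition lra. Qed.

Lemma within_trans P Q T : within P Q -> within Q T -> within P T.
Proof. unfold within; intuition lra. Qed.

Lemma within_refl P : within P P.
Proof. unfold within; intuition lra. Qed.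

Lemma child_within Q j r : 0 <= side Q -> 0 <= r <= 1 -> within (child Q j r) Q.
Proof.
intros hs hr; destruct j as [[|] [|]]; unfold within, child, bit; simpl;
  repeat split; nra.
Qed.

Lemma child_valid Q j r : valid Q -> 0 <= r <= 1 -> valid (child Q j r).
Proof.
intros (h1 & h2 & h3 & h4 & h5) hr; destruct (child_within Q j r h3 hr) as (a & b & c & d).
assert (0 <= side (child Q j r)) by (simpl; nra).
unfold valid; repeat split; lra.
Qed.

Lemma child_1 Q j : child Q j 1 = Q.
Proof. destruct Q as [a b c]; unfold child; simpl; f_equal; ring. Qed.

Lemma child_separated Q j j' r r' : 0 <= side Q -> j <> j' -> r + r' <= 1 ->
  separated (child Q j r) (child Q j' r').
Proof.
intros hs hj hr; unfold separated, child, bit; simpl.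
assert (side Q * r + side Q * r' <= side Q) by nra.
destruct j as [[|] [|]], j' as [[|] [|]]; simpl; try congruence; lra.
Qed.

(** * The five-legged star of a node *)

Definition leg_eq_dec (k k' : option corner) : {k = k'} + {k <> k'}.
Proof. repeat decide equality. Defined.

Definition corners : list corner := [(false, false); (false, true); (true, false); (true, true)].

Definition legs : list (option corner) := None :: map Some corners.

Lemma in_corners j : In j corners.
Proof. destruct j as [[|] [|]]; simpl; tauto. Qed.

Lemma in_legs k : In k legs.
Proof. destruct k as [j|]; simpl; [right; apply (in_map Some corners), in_corners|auto]. Qed.

Definition other_legs (k : option corner) : list (option corner) :=
  filter (fun k' => if leg_eq_dec k k' then false else true) legs.

Lemma in_other_legs k k' : In k' (other_legs k) <-> k' <> k.
Proof.
unfold other_legs; rewrite filter_In; destruct (leg_eq_dec k k'); split.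
- intros [_ H]; discriminate.
- congruence.
- congruence.
- intros _; split; [apply in_legs|reflexivity].
Qed.

(* [0,1]^5 retracts onto a star with five legs: the largest of the five
   coordinates selects the leg, its excess over the second largest one is the
   distance to the centre. *)
Definition excess (X : option corner -> R) (k : option corner) : R :=
  Rmax 0 (X k - lmax X (other_legs k)).

(** Affine in the excesses, hence continuous in [X]. As at most one excess is nonzero, the four
    ratios are those of [pattern k t] on leg [k] at distance [t] from the centre, where all of them
    are 1/2. Leg [Some j] shrinks child [j], and [None] is the leg on which all four grow. *)
Definition ratio (X : option corner -> R) (j : corner) : R :=
  (1 - excess X (Some j) + lsum (excess X) (other_legs (Some j))) / 2.

Definition pattern (k : option corner) (t : R) (j : corner) : R :=
  if leg_eq_dec k (Some j) then (1 - t) / 2 else (1 + t) / 2.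

Section Node.
Variable X : option corner -> R.
Hypothesis X01 : forall k, 0 <= X k <= 1.

Lemma excess_bounds k : 0 <= excess X k <= 1.
Proof.
unfold excess; generalize (lmax_nonneg X (other_legs k)) (X01 k).
unfold Rmax; destruct Rle_dec; lra.
Qed.

Lemma excess_le k : excess X k <= X k.
Proof.
unfold excess; generalize (lmax_nonneg X (other_legs k)) (X01 k).
unfold Rmax; destruct Rle_dec; lra.
Qed.

Lemma excess_unique k k' : 0 < excess X k -> k' <> k -> excess X k' = 0.
Proof.
intros h hk.
assert (X k' <= lmax X (other_legs k)) by (apply lmax_ge, in_other_legs, hk).
assert (X k <= lmax X (other_legs k')) by (apply lmax_ge, in_other_legs; congruence).
revert h; unfold excess, Rmax; repeat destruct Rle_dec; lra.
Qed.

Lemma excess_alone k : (forall k', k' <> k -> X k' = 0) -> excess X k = X k.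
Proof.
intros h; unfold excess.
assert (e : lmax X (other_legs k) = 0).
{ apply Rle_antisym; [|apply lmax_nonneg].
  apply lmax_le; [lra|intros a Ha; rewrite h; [lra|apply in_other_legs, Ha]]. }
rewrite e, Rminus_0_r, Rmax_right; [reflexivity|apply X01].
Qed.

Lemma ratio_pattern : exists k, forall j, ratio X j = pattern k (excess X k) j.
Proof.
destruct (classic (exists k, 0 < excess X k)) as [[k hk]|hno].
- exists k; intros j; unfold ratio, pattern; destruct leg_eq_dec as [->|ne].
  + rewrite (lsum_zero (excess X)); [lra|].
    intros k' hk'; apply (excess_unique (Some j)); [exact hk|apply in_other_legs, hk'].
  + rewrite (excess_unique k (Some j)) by congruence.
    assert (e : forall l, NoDup l -> In k l -> lsum (excess X) l = excess X k).
    { clear ne; induction l as [|a l IH]; intros nd; [intros []|].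
      inversion nd; subst; intros [->|hin]; simpl.
      - rewrite lsum_zero; [lra|]; intros b hb; apply (excess_unique k); [exact hk|congruence].
      - rewrite IH by assumption; rewrite (excess_unique k a); [lra|exact hk|congruence]. }
    rewrite e; [lra| |apply in_other_legs; exact ne].
    apply NoDup_filter; repeat constructor; simpl; intuition discriminate.
- exists None; intros j.
  assert (z : forall k, excess X k = 0).
  { intros k; destruct (excess_bounds k) as [h _]; apply Rle_antisym; [|exact h].
    apply Rnot_lt_le; intros hk; apply hno; exists k; exact hk. }
  unfold ratio, pattern; rewrite lsum_zero by (intros; apply z).
  rewrite !z; destruct leg_eq_dec; lra.
Qed.

Lemma pattern_bounds k t j : 0 <= t <= 1 -> 0 <= pattern k t j <= 1.
Proof. unfold pattern; destruct leg_eq_dec; lra. Qed.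

Lemma ratio_bounds j : 0 <= ratio X j <= 1.
Proof.
destruct ratio_pattern as [k hk]; rewrite hk; apply pattern_bounds, excess_bounds.
Qed.

(* [L j] is the load of child [j], [c] the capacity of the node, [c + d] that of its children. *)
Lemma node_cases (L : corner -> R) (c d : R) :
  0 < c -> 0 < d -> (forall j, 0 <= L j) ->
  (forall j, ratio X j = 0 -> L j = 0) ->
  (0 < c - lsum L corners -> X None = 1) -> (c - lsum L corners < 0 -> X None = 0) ->
  (forall j, 0 < Rmin (c - (lsum L corners - L j)) (lsum L corners - c) -> X (Some j) = 1) ->
  (forall j, Rmin (c - (lsum L corners - L j)) (lsum L corners - c) < 0 -> X (Some j) = 0) ->
  exists k t, 0 <= t <= 1 /\ (forall j, ratio X j = pattern k t j) /\
    (lsum L corners < c -> k = None /\ t = 1) /\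
    (c < lsum L corners ->
       (t = 0 \/ exists j, k = Some j /\ lsum L corners - L j <= c) /\
       forall j, c + d <= L j -> c <= lsum L corners - L j).
Proof.
intros hc hd L0 Lr F1 F0 G1 G0; set (l := lsum L corners) in *.
destruct ratio_pattern as [k hk].
assert (two : forall j j', j <> j' -> L j + L j' <= l).
{ intros j j' hj; unfold l; simpl.
  generalize (L0 (false, false)) (L0 (false, true)) (L0 (true, false)) (L0 (true, true)).
  destruct j as [[|] [|]], j' as [[|] [|]]; try congruence; lra. }
(* Below the capacity the condition for [None] forces 1 and those for the other legs force 0, so [X]
   is the end of the common leg. *)
assert (light : l < c -> k = None /\ excess X k = 1).
{ intros hl.
  assert (z : forall k', k' <> None -> X k' = 0).
  { intros [j|]; [intros _|congruence]; apply G0.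
    eapply Rle_lt_trans; [apply Rmin_r|lra]. }
  assert (e : excess X None = 1) by (rewrite excess_alone; [apply F1; lra|exact z]).
  (* The pattern of [Some j] at distance 0 would give child [j] the ratio 1/2, whereas the excess 1
     of [None] gives it at least 1. *)
  destruct k as [j|]; [exfalso|split; [reflexivity|exact e]].
  assert (e' : excess X (Some j) = 0) by (apply (excess_unique None); [lra|discriminate]).
  generalize (hk j); unfold pattern; destruct leg_eq_dec; [|congruence].
  rewrite e'; unfold ratio; rewrite e'.
  assert (1 <= lsum (excess X) (other_legs (Some j))); [|lra].
  rewrite <- e; apply lsum_ge_in; [intros; apply excess_bounds|].
  apply in_other_legs; discriminate. }
exists k, (excess X k); split; [apply excess_bounds|split; [exact hk|split; [exact light|]]].
intros hl.
assert (xN : X None = 0) by (apply F0; lra).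
split.
(* Away from the centre the leg is not [None], since [X None = 0]. On leg [j], a load above [c] in
   the other children would make [X (Some j)] vanish. *)
- destruct (Req_dec (excess X k) 0) as [e|ne]; [left; exact e|right].
  assert (hpos : 0 < excess X k) by (generalize (excess_bounds k); lra).
  destruct k as [j|]; [|generalize (excess_le None); lra].
  exists j; split; [reflexivity|].
  apply Rnot_lt_le; intros hlt.
  generalize (excess_le (Some j)); rewrite (G0 j); [lra|].
  eapply Rle_lt_trans; [apply Rmin_l|lra].
(* Otherwise [X (Some j)] is 1, and every other leg is at 0 because [L j] alone exceeds [c]. So [X]
   is the end of leg [j], where child [j] is a point and carries no load. *)
- intros j hj; apply Rnot_lt_le; intros hlt.
  assert (z : forall k', k' <> Some j -> X k' = 0).
  { intros [j'|] hj'; [apply G0|exact xN].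
    assert (h := two j j' ltac:(congruence)).
    eapply Rle_lt_trans; [apply Rmin_l|lra]. }
  assert (e : excess X (Some j) = 1).
  { rewrite excess_alone by exact z; apply G1; apply Rmin_glb_lt; lra. }
  assert (L j = 0); [|lra].
  apply Lr; unfold ratio; rewrite e, lsum_zero; [lra|].
  intros k' hk'; apply (excess_unique (Some j)); [lra|apply in_other_legs, hk'].
Qed.

End Node.

(** The head of a word is its deepest letter: descending is consing, and the parent is the tail. *)
Fixpoint leaves (k : nat) (nu : list corner) : list (list corner) :=
  match k with
  | O => [nu]
  | S k' => flat_map (fun j => leaves k' (j :: nu)) corners
  end.

Lemma leaves_S k nu : leaves (S k) nu = flat_map (fun j => leaves k (j :: nu)) corners.
Proof. reflexivity. Qed.

Lemma leaves_nonempty k nu : exists w, In w (leaves k nu).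
Proof.
revert nu; induction k as [|k IH]; intros nu; [exists nu; left; reflexivity|].
destruct (IH ((false, false) :: nu)) as [w hw]; exists w; simpl.
apply in_or_app; left; exact hw.
Qed.

Lemma ForallOrdPairs_app {A} (P : A -> A -> Prop) l1 l2 :
  ForallOrdPairs P l1 -> ForallOrdPairs P l2 ->
  (forall a b, In a l1 -> In b l2 -> P a b) -> ForallOrdPairs P (l1 ++ l2).
Proof.
induction 1 as [|a l Ha Hl IH]; simpl; intros H2 H; [exact H2|].
constructor; [|apply IH; auto].
apply Forall_app; split; [exact Ha|apply Forall_forall; auto].
Qed.

Lemma ForallOrdPairs_nth {A} (P : A -> A -> Prop) (d : A) l : (forall a b, P a b -> P b a) ->
  ForallOrdPairs P l -> forall i j, (i < length l)%nat -> (j < length l)%nat -> i <> j ->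
  P (nth i l d) (nth j l d).
Proof.
intros Psym; induction 1 as [|a l Ha Hl IH]; simpl; intros i j hi hj hij; [lia|].
rewrite Forall_forall in Ha.
destruct i as [|i], j as [|j]; try lia.
- apply Ha, nth_In; lia.
- apply Psym, Ha, nth_In; lia.
- apply IH; lia.
Qed.

(** * Regions of the tree at an equilibrium *)

Section Regions.
Variables (n : nat) (kap d : R).
Variable rho : list corner -> corner -> R.
Variable sq : list corner -> square.
Variable load : list corner -> R.
Variables (V : nat -> square -> R) (U : nat -> R).

(** The increment [d] deals with a node exactly at its capacity, where complementarity leaves the
    position on the star open: its children are then strictly below theirs. *)
Definition cap (nu : list corner) : R := kap + INR (length nu) * d.
Definition below (k : nat) (nu : list corner) : R := lsum load (leaves k nu).

Hypothesis kap1 : 1 < kap.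
Hypothesis d0 : 0 < d.
Hypothesis n1 : (1 <= n)%nat.
Hypothesis load0 : forall w, 0 <= load w.
Hypothesis sq_child : forall j nu, sq (j :: nu) = child (sq nu) j (rho nu j).
Hypothesis rho01 : forall nu j, 0 <= rho nu j <= 1.
Hypothesis side0 : forall nu, 0 <= side (sq nu).
Hypothesis U0 : forall i, 0 <= U i.
Hypothesis V_leaf : forall i nu, length nu = n -> V i (sq nu) <= U i.
Hypothesis V_node : forall i nu, V i (sq nu) <= lsum (fun j => V i (sq (j :: nu))) corners.
Hypothesis node : forall nu k, (length nu + S k = n)%nat ->
  exists g t, 0 <= t <= 1 /\ (forall j, rho nu j = pattern g t j) /\
    (below (S k) nu < cap nu -> g = None /\ t = 1) /\
    (cap nu < below (S k) nu ->
       (t = 0 \/ exists j, g = Some j /\ below (S k) nu - below k (j :: nu) <= cap nu) /\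
       forall j, cap nu + d <= below k (j :: nu) ->
         cap nu <= below (S k) nu - below k (j :: nu)).

Lemma below_nonneg k nu : 0 <= below k nu.
Proof. apply lsum_nonneg; auto. Qed.

Lemma below_S k nu : below (S k) nu = lsum (fun j => below k (j :: nu)) corners.
Proof. unfold below; rewrite leaves_S; apply lsum_flat_map. Qed.

Lemma below_child k nu j : below k (j :: nu) <= below (S k) nu.
Proof.
rewrite below_S.
exact (lsum_ge_in (fun j => below k (j :: nu)) corners j (fun j' => below_nonneg _ _) (in_corners j)).
Qed.

Lemma cap_child j nu : cap (j :: nu) = cap nu + d.
Proof. unfold cap; simpl length; rewrite S_INR; ring. Qed.

Lemma cap_ge nu : kap <= cap nu.
Proof. unfold cap; generalize (pos_INR (length nu)); nra. Qed.

Lemma cap_le nu : (length nu <= n)%nat -> cap nu <= kap + INR n * d.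
Proof. intros h; apply le_INR in h; unfold cap; nra. Qed.

Lemma leaves_length k nu w : In w (leaves k nu) -> length w = (length nu + k)%nat.
Proof.
revert nu; induction k as [|k IH]; intros nu; [intros [<-|[]]; lia|].
rewrite leaves_S, in_flat_map; intros [j [_ h]]; apply IH in h; simpl in h; lia.
Qed.

Lemma leaves_within k nu w : In w (leaves k nu) -> within (sq w) (sq nu).
Proof.
revert nu; induction k as [|k IH]; intros nu; [intros [<-|[]]; apply within_refl|].
rewrite leaves_S, in_flat_map; intros [j [_ h]]; apply IH in h.
eapply within_trans; [exact h|rewrite sq_child; apply child_within; auto].
Qed.

(** On the way down loads do not grow and capacities increase, so all descendants are light too and
    every ratio met is 1. *)
Lemma light_leaves k nu w : (length nu + k = n)%nat -> below k nu < cap nu ->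
  In w (leaves k nu) -> sq w = sq nu.
Proof.
revert nu; induction k as [|k IH]; intros nu hk hl; [intros [<-|[]]; reflexivity|].
rewrite leaves_S, in_flat_map; intros [j [_ h]].
destruct (node nu k hk) as (g & t & ht & hr & h1 & _).
destruct (h1 hl) as [-> ->].
rewrite (IH (j :: nu)); [|simpl; lia| |exact h].
- rewrite sq_child, hr; unfold pattern; destruct leg_eq_dec; [discriminate|].
  replace ((1 + 1) / 2) with 1 by field; apply child_1.
- rewrite cap_child; generalize (below_child k nu j); lra.
Qed.

Lemma light_value k nu i : (length nu + k = n)%nat -> below k nu < cap nu -> V i (sq nu) <= U i.
Proof.
intros hk hl; destruct (leaves_nonempty k nu) as [w hw].
rewrite <- (light_leaves k nu w hk hl hw); apply V_leaf; rewrite (leaves_length _ _ _ hw); lia.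
Qed.

Definition region_disjoint (r r' : list (list corner)) : Prop :=
  forall w w', In w r -> In w' r' -> separated (sq w) (sq w').

(** In units of [u], and of [kap] for loads, a light child counts 1 and a heavy one $6 t - 2$. Four
    light children give $4 = 6 - 2$. Beside one heavy child, the load of at least 1 elsewhere pays 6
    for the three others. With two heavy children the second $-2$ pays exactly for the two light
    ones. The first and the last case determine the constants 6 and 2. *)
Lemma value_bound l (L B : corner -> R) u :
  kap <= l -> l = lsum L corners -> (forall j, 0 <= L j) -> 0 <= u ->
  (forall j, B j <= u \/ (kap <= L j /\ kap <= l - L j /\ B j <= (6 * L j / kap - 2) * u)) ->
  lsum B corners <= (6 * l / kap - 2) * u.
Proof.
intros hl -> L0 hu HB.
assert (hk : 0 < kap) by lra.
assert (HB' : forall j, exists b, B j <= b * u /\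
   (b = 1 \/ (b = 6 * (L j / kap) - 2 /\ 1 <= L j / kap /\ 1 <= (lsum L corners) / kap - L j / kap))).
{ intros j; destruct (HB j) as [h|(h1 & h2 & h3)]; [exists 1; split; [lra|auto]|].
  exists (6 * (L j / kap) - 2); split; [unfold Rdiv in *; rewrite <- Rmult_assoc; exact h3|right].
  split; [reflexivity|split].
  - apply (Rmult_le_reg_r kap); [exact hk|]; unfold Rdiv; rewrite Rmult_assoc, Rinv_l; lra.
  - rewrite <- Rdiv_minus_distr; apply (Rmult_le_reg_r kap); [exact hk|].
    unfold Rdiv; rewrite Rmult_assoc, Rinv_l; lra. }
assert (hT : 1 <= lsum L corners / kap).
{ apply (Rmult_le_reg_r kap); [exact hk|]; unfold Rdiv; rewrite Rmult_assoc, Rinv_l; lra. }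
replace (6 * lsum L corners / kap) with (6 * (lsum L corners / kap)) by (unfold Rdiv; ring).
assert (hD : forall j, 0 <= L j / kap) by (intros j; apply Rle_mult_inv_pos; auto).
assert (eT : lsum L corners / kap = lsum (fun j => L j / kap) corners).
{ unfold Rdiv; rewrite Rmult_comm, <- lsum_scal; apply lsum_ext; intros; ring. }
generalize (HB' (false, false)) (HB' (false, true)) (HB' (true, false)) (HB' (true, true)).
generalize (hD (false, false)) (hD (false, true)) (hD (true, false)) (hD (true, true)).
rewrite eT in *; clear - hT hu; simpl in *.
generalize dependent (L (false, false) / kap); intros t1.
generalize dependent (L (false, true) / kap); intros t2.
generalize dependent (L (true, false) / kap); intros t3.
generalize dependent (L (true, true) / kap); intros t4.
intros hT p1 p2 p3 p4 (b1 & e1 & c1) (b2 & e2 & c2) (b3 & e3 & c3) (b4 & e4 & c4).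
assert (hb : b1 + b2 + b3 + b4 <= 6 * (t1 + (t2 + (t3 + (t4 + 0)))) - 2).
{ destruct c1 as [->|(-> & ? & ?)], c2 as [->|(-> & ? & ?)],
    c3 as [->|(-> & ? & ?)], c4 as [->|(-> & ? & ?)]; lra. }
apply (Rmult_le_compat_r u) in hb; [lra|exact hu].
Qed.

(* Below a node above its capacity, either the squares of all four subtrees are separated,
   or the three growing subtrees together form one region and only the fourth is divided
   further.  A child above its capacity takes more than [kap] away from the load, so none
   is left at depth [n]. *)
Lemma regions k nu : (length nu + k = n)%nat ->
  (below k nu < cap nu \/ below k nu <= INR n - INR (length nu) * kap) ->
  exists regs,
    Permutation (concat regs) (leaves k nu) /\
    (forall r, In r regs -> lsum load r <= kap + INR n * d) /\
    ForallOrdPairs region_disjoint regs /\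
    forall i, (below k nu < cap nu -> V i (sq nu) <= U i) /\
      (cap nu <= below k nu -> V i (sq nu) <= (6 * below k nu / kap - 2) * U i).
Proof.
revert nu; induction k as [|k IH]; intros nu hk hb.
- assert (hlt : below 0 nu < cap nu).
  { destruct hb as [h|h]; [exact h|exfalso].
    assert (e : length nu = n) by lia; rewrite e in h.
    generalize (below_nonneg 0 nu); apply le_INR in n1; simpl in n1; nra. }
  exists [[nu]]; split; [simpl; apply Permutation_refl|split; [|split]].
  + intros r [<-|[]]; change (below 0 nu <= kap + INR n * d).
    generalize (cap_le nu ltac:(lia)); lra.
  + repeat constructor.
  + intros i; split; [intros _; apply V_leaf; lia|lra].
(* Equality belongs to the first case: the node stays one region, and its value is at most that of
   four children which are strictly light. *)
- destruct (Rle_lt_dec (below (S k) nu) (cap nu)) as [hle|hgt].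
  + exists [leaves (S k) nu]; split; [|split; [|split]].
    * simpl concat; rewrite app_nil_r; apply Permutation_refl.
    * intros r [<-|[]]; change (below (S k) nu <= kap + INR n * d).
      generalize (cap_le nu ltac:(lia)); lra.
    * repeat constructor.
    * intros i; split; [intros h; apply (light_value (S k)); assumption|intros h].
      apply Rle_trans with (lsum (fun j => V i (sq (j :: nu))) corners); [apply V_node|].
      apply (value_bound _ (fun j => below k (j :: nu))).
      -- generalize (cap_ge nu); lra.
      -- apply below_S.
      -- intros; apply below_nonneg.
      -- apply U0.
      -- intros j; left; apply (light_value k); [simpl; lia|].
         rewrite cap_child; generalize (below_child k nu j); lra.
  + destruct (node nu k hk) as (g & t & ht & hr & _ & h2).
    destruct (h2 hgt) as [hleg hheavy].
    assert (hN : below (S k) nu <= INR n - INR (length nu) * kap) by (destruct hb; lra).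
    assert (hc : forall j, exists regs,
      Permutation (concat regs) (leaves k (j :: nu)) /\
      (forall r, In r regs -> lsum load r <= kap + INR n * d) /\
      ForallOrdPairs region_disjoint regs /\
      forall i, (below k (j :: nu) < cap (j :: nu) -> V i (sq (j :: nu)) <= U i) /\
        (cap (j :: nu) <= below k (j :: nu) ->
           V i (sq (j :: nu)) <= (6 * below k (j :: nu) / kap - 2) * U i)).
    { intros j; apply IH; [simpl; lia|].
      destruct (Rlt_le_dec (below k (j :: nu)) (cap (j :: nu))) as [h|h]; [left; exact h|right].
      rewrite cap_child in h; apply hheavy in h; simpl length; rewrite S_INR.
      generalize (cap_ge nu); lra. }
    destruct (choice _ hc) as [regs Hregs]; clear hc.
    assert (hin : forall j r w, In r (regs j) -> In w r -> In w (leaves k (j :: nu))).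
    { intros j r w h1 h3; apply (Permutation_in w (proj1 (Hregs j))).
      apply in_concat; exists r; split; assumption. }
    assert (hval : forall i, (below (S k) nu < cap nu -> V i (sq nu) <= U i) /\
      (cap nu <= below (S k) nu -> V i (sq nu) <= (6 * below (S k) nu / kap - 2) * U i)).
    { intros i; split; [intros; lra|intros _].
      apply Rle_trans with (lsum (fun j => V i (sq (j :: nu))) corners); [apply V_node|].
      apply (value_bound _ (fun j => below k (j :: nu))).
      - generalize (cap_ge nu); lra.
      - apply below_S.
      - intros; apply below_nonneg.
      - apply U0.
      - intros j; destruct (Hregs j) as (_ & _ & _ & hv); destruct (hv i) as [v1 v2].
        destruct (Rlt_le_dec (below k (j :: nu)) (cap (j :: nu))) as [h|h].
        + left; auto.
        + right; generalize (v2 h); rewrite cap_child in h.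
          generalize (hheavy j h) (cap_ge nu); intros; repeat split; lra. }
    assert (sepc : forall j j' w w', j <> j' -> rho nu j + rho nu j' <= 1 ->
      In w (leaves k (j :: nu)) -> In w' (leaves k (j' :: nu)) -> separated (sq w) (sq w')).
    { intros j j' w w' hj hrr hw hw'.
      apply (separated_within (sq (j :: nu)) (sq (j' :: nu))); [eapply leaves_within; eassumption..|].
      rewrite !sq_child; apply child_separated; auto. }
    (* At the centre any two ratios add up to 1. On leg [j0] this holds only for pairs that contain
       [j0], so the other three children have to share a region. *)
    destruct hleg as [->|[j0 [-> hj0]]].
    * exists (flat_map regs corners); split; [|split; [|split; [|exact hval]]].
      -- rewrite leaves_S; unfold corners; simpl flat_map; rewrite !concat_app; simpl concat.
         repeat apply Permutation_app; try apply Hregs; apply Permutation_refl.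
      -- intros r hr'; apply in_flat_map in hr'; destruct hr' as [j [_ h]].
         exact (proj1 (proj2 (Hregs j)) r h).
      -- assert (nd : NoDup corners) by (repeat constructor; simpl; intuition discriminate).
         revert nd; generalize corners; intros l; induction 1 as [|j l hj nd IHl].
         ++ constructor.
         ++ simpl; apply ForallOrdPairs_app; [apply (Hregs j)|exact IHl|].
            intros r r' h1 h3 w w' hw hw'; apply in_flat_map in h3; destruct h3 as [j' [hj' h3]].
            apply (sepc j j'); [intros ->; contradiction| |eauto..].
            rewrite !hr; unfold pattern; repeat destruct leg_eq_dec; lra.
    * pose (others := filter (fun j => if leg_eq_dec (Some j) (Some j0) then false else true) corners).
      assert (hoth : forall j, In j others <-> j <> j0).
      { intros j; unfold others; rewrite filter_In; generalize (in_corners j).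
        destruct leg_eq_dec; intuition congruence. }
      assert (hperm : Permutation (others ++ [j0]) corners).
      { apply NoDup_Permutation.
        - apply NoDup_app.
          + apply NoDup_filter; repeat constructor; simpl; intuition discriminate.
          + repeat constructor; simpl; tauto.
          + intros a h [<-|[]]; apply hoth in h; congruence.
        - repeat constructor; simpl; intuition discriminate.
        - intros x; split; [intros _; apply in_corners|intros _; apply in_or_app].
          destruct (leg_eq_dec (Some x) (Some j0)) as [e|ne].
          + right; left; congruence.
          + left; apply hoth; congruence. }
      exists (flat_map (fun j => leaves k (j :: nu)) others :: regs j0).
      split; [|split; [|split; [|exact hval]]].
      -- simpl concat.
         apply Permutation_trans with (flat_map (fun j => leaves k (j :: nu)) (others ++ [j0])).
         ++ rewrite flat_map_app; apply Permutation_app_head.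
            simpl; rewrite app_nil_r; apply Hregs.
         ++ rewrite leaves_S; apply Permutation_flat_map, hperm.
      -- intros r [<-|h]; [|exact (proj1 (proj2 (Hregs j0)) r h)].
         assert (e : lsum load (flat_map (fun j => leaves k (j :: nu)) others) + below k (j0 :: nu) =
           below (S k) nu).
         { rewrite below_S, <- (lsum_perm _ _ _ hperm), lsum_app, lsum_flat_map; simpl.
           unfold below; lra. }
         generalize (cap_le nu ltac:(lia)); lra.
      -- constructor; [|apply (Hregs j0)].
         apply Forall_forall; intros r h w w' hw hw'.
         apply in_flat_map in hw; destruct hw as [j [hj hw]]; apply hoth in hj.
         apply (sepc j j0); [exact hj| |exact hw|eauto].
         rewrite !hr; unfold pattern; repeat destruct leg_eq_dec; try congruence; lra.
Qed.

End Regions.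

Lemma leaves_complete w nu : In (w ++ nu) (leaves (length w) nu).
Proof.
revert nu; induction w as [|j w IH] using rev_ind; intros nu; [left; reflexivity|].
rewrite <- app_assoc, length_app, Nat.add_1_r, leaves_S.
apply in_flat_map; exists j; split; [apply in_corners|apply IH].
Qed.

Lemma lmax_attained {A} (f : A -> R) l : l <> [] -> (forall a, 0 <= f a) ->
  exists a, In a l /\ f a = lmax f l.
Proof.
intros hl f0; induction l as [|a l IH]; [congruence|simpl].
destruct l as [|b l].
- exists a; split; [auto|simpl; rewrite Rmax_left; auto].
- destruct IH as [c [hc e]]; [discriminate|].
  destruct (Rle_dec (f a) (lmax f (b :: l))) as [h|h].
  + exists c; rewrite Rmax_right; auto.
  + exists a; rewrite Rmax_left; [auto|lra].
Qed.

(** * Equilibria *)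

Lemma Un_cv_le (u v : nat -> R) (a b : R) :
  (forall m, u m <= v m) -> Un_cv u a -> Un_cv v b -> a <= b.
Proof.
intros h hu hv; apply Rnot_lt_le; intros hab.
destruct (hu ((a - b) / 2) ltac:(lra)) as [N1 H1]; destruct (hv ((a - b) / 2) ltac:(lra)) as [N2 H2].
specialize (H1 (N1 + N2)%nat ltac:(lia)); specialize (H2 (N1 + N2)%nat ltac:(lia)).
specialize (h (N1 + N2)%nat); revert H1 H2; unfold R_dist; split_Rabs; lra.
Qed.

Lemma Un_cv_const (a : R) : Un_cv (fun _ => a) a.
Proof. intros e He; exists 0%nat; intros; rewrite R_dist_eq; exact He. Qed.

Lemma common_lower_bound (f : nat -> R) m : (forall i, 0 < f i) ->
  exists h, 0 < h /\ forall i, (i < m)%nat -> h <= f i.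
Proof.
intros hf; induction m as [|m [h [h0 hm]]]; [exists 1; split; [lra|lia]|].
exists (Rmin h (f m)); split; [apply Rmin_glb_lt; auto|intros i hi].
destruct (Nat.eq_dec i m) as [->|ne]; [apply Rmin_r|].
eapply Rle_trans; [apply Rmin_l|apply hm; lia].
Qed.

(** If the limits violated all four inequalities, each by at least [3 * e], then the same would hold
    far out in the sequence: each inequality involves three numbers, and each of them is eventually
    within [e] of its limit. *)
Lemma separated_limit (P Q : nat -> square) (P' Q' : square) :
  (forall m, separated (P m) (Q m)) ->
  Un_cv (fun m => sx (P m)) (sx P') -> Un_cv (fun m => sy (P m)) (sy P') ->
  Un_cv (fun m => side (P m)) (side P') ->
  Un_cv (fun m => sx (Q m)) (sx Q') -> Un_cv (fun m => sy (Q m)) (sy Q') ->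
  Un_cv (fun m => side (Q m)) (side Q') -> separated P' Q'.
Proof.
intros hs px py ps qx qy qs.
apply NNPP; intros hn; unfold separated in hn.
apply not_or_and in hn; destruct hn as [n1 hn].
apply not_or_and in hn; destruct hn as [n2' hn].
apply not_or_and in hn; destruct hn as [n3 n4].
apply Rnot_le_lt in n1, n2', n3, n4.
set (e := Rmin (Rmin (sx P' + side P' - sx Q') (sx Q' + side Q' - sx P'))
               (Rmin (sy P' + side P' - sy Q') (sy Q' + side Q' - sy P')) / 3).
assert (he : 0 < e).
{ unfold e; apply Rdiv_lt_0_compat; [repeat apply Rmin_glb_lt; lra|lra]. }
assert (hle : 3 * e <= sx P' + side P' - sx Q' /\ 3 * e <= sx Q' + side Q' - sx P' /\
              3 * e <= sy P' + side P' - sy Q' /\ 3 * e <= sy Q' + side Q' - sy P').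
{ unfold e, Rmin; repeat destruct Rle_dec; lra. }
clearbody e.
destruct (px e he) as [N1 H1], (py e he) as [N2 H2], (ps e he) as [N3 H3],
  (qx e he) as [N4 H4], (qy e he) as [N5 H5], (qs e he) as [N6 H6].
pose (m := (N1 + N2 + N3 + N4 + N5 + N6)%nat).
specialize (H1 m ltac:(lia)); specialize (H2 m ltac:(lia)); specialize (H3 m ltac:(lia)).
specialize (H4 m ltac:(lia)); specialize (H5 m ltac:(lia)); specialize (H6 m ltac:(lia)).
unfold R_dist in *.
apply Rabs_def2 in H1, H2, H3, H4, H5, H6.
destruct (hs m) as [h|[h|[h|h]]]; lra.
Qed.

Section Equilibrium.
Variables (n : nat) (V : nat -> square -> R).
Hypothesis n2 : (2 <= n)%nat.
Hypothesis V_nonneg : forall i Q, valid Q -> 0 <= V i Q.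
Hypothesis V_point : forall i Q, valid Q -> side Q = 0 -> V i Q = 0.
Hypothesis V_cover : forall i Q g t, valid Q -> 0 <= t <= 1 ->
  V i Q <= lsum (fun j => V i (child Q j (pattern g t j))) corners.
Hypothesis V_cont : forall i (Qs : nat -> square) Q, (forall m, valid (Qs m)) -> valid Q ->
  Un_cv (fun m => sx (Qs m)) (sx Q) -> Un_cv (fun m => sy (Qs m)) (sy Q) ->
  Un_cv (fun m => side (Qs m)) (side Q) -> Un_cv (fun m => V i (Qs m)) (V i Q).
Hypothesis V_unit : forall i, 0 < V i unit_square.

Section Approximate.
Variables (kap d eps : R).
Hypothesis kap1 : 1 < kap.
Hypothesis d0 : 0 < d.
Hypothesis eps0 : 0 < eps.
Hypothesis caps : (kap + INR n * d) * (INR n - 1) < INR n.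
Hypothesis eps_small : forall i, (i < n)%nat -> eps * 4 ^ n <= V i unit_square.

Definition rhoX (x : coord -> R) (nu : list corner) (j : corner) : R :=
  ratio (fun g => x (nu, g)) j.

Fixpoint sqX (x : coord -> R) (nu : list corner) : square :=
  match nu with
  | [] => unit_square
  | j :: mu => child (sqX x mu) j (rhoX x mu j)
  end.

Definition topX (x : coord -> R) (i : nat) : R :=
  lmax (fun w => V i (sqX x w)) (leaves n []).

(* Positive only on leaves which are optimal up to [eps]. *)
Definition rawX (x : coord -> R) (i : nat) (w : list corner) : R :=
  Rmax 0 (V i (sqX x w) - topX x i + eps).

Definition weightX (x : coord -> R) (i : nat) (w : list corner) : R :=
  rawX x i w / lsum (rawX x i) (leaves n []).

Definition loadX (x : coord -> R) (w : list corner) : R :=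
  lsum (fun i => weightX x i w) (seq 0 n).

(* Complementarity pushes a parameter to 1 where its slack is positive and to 0 where it is
   negative. *)
Definition slackX (x : coord -> R) (p : coord) : R :=
  let nu := fst p in
  let k := (n - length nu)%nat in
  let total := below (loadX x) k nu in
  match snd p with
  | None => cap kap d nu - total
  | Some j => Rmin (cap kap d nu - (total - below (loadX x) (k - 1) (j :: nu)))
                (total - cap kap d nu)
  end.

Definition cube (x : coord -> R) : Prop := forall p, 0 <= x p <= 1.

Lemma rhoX_bounds x nu j : cube x -> 0 <= rhoX x nu j <= 1.
Proof. intros h; apply ratio_bounds; intros g; apply h. Qed.

Lemma sqX_valid x nu : cube x -> valid (sqX x nu).
Proof.
intros h; induction nu as [|j mu IH]; simpl.
- unfold valid, unit_square; simpl; lra.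
- apply child_valid; [exact IH|apply rhoX_bounds, h].
Qed.

Lemma scont_excess nu g : scont (fun x : coord -> R => excess (fun g' => x (nu, g')) g).
Proof.
unfold excess; apply scont_max; [apply scont_const|apply scont_minus; [apply scont_coord|]].
apply (scont_lmax (fun g' x => x (nu, g'))); intros g'; apply scont_coord.
Qed.

Lemma scont_rhoX nu j : scont (fun x => rhoX x nu j).
Proof.
unfold rhoX, ratio; apply scont_mult; [|apply scont_const].
apply scont_plus; [apply scont_minus; [apply scont_const|apply scont_excess]|].
apply (scont_lsum (fun g x => excess (fun g' => x (nu, g')) g)); intros g; apply scont_excess.
Qed.

Lemma scont_sqX nu : scont (fun x => sx (sqX x nu)) /\ scont (fun x => sy (sqX x nu)) /\
  scont (fun x => side (sqX x nu)).
Proof.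
induction nu as [|j mu (h1 & h2 & h3)]; simpl.
- split; [|split]; apply scont_const.
- assert (hr := scont_minus _ _ (scont_const 1) (scont_rhoX mu j)).
  assert (hb : forall b, scont (fun x => bit b * (side (sqX x mu) * (1 - rhoX x mu j)))).
  { intros b; apply scont_mult; [apply scont_const|apply scont_mult; assumption]. }
  split; [|split].
  + apply scont_plus; [exact h1|apply hb].
  + apply scont_plus; [exact h2|apply hb].
  + apply scont_mult; [exact h3|apply scont_rhoX].
Qed.

Lemma scont_V i nu : scont (fun x => V i (sqX x nu)).
Proof.
destruct (scont_sqX nu) as (h1 & h2 & h3); intros x y hx hy hc.
apply (V_cont i (fun m => sqX (x m) nu)).
- intros m; apply sqX_valid; exact (hx m).
- apply sqX_valid; exact hy.
- exact (h1 x y hx hy hc).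
- exact (h2 x y hx hy hc).
- exact (h3 x y hx hy hc).
Qed.

Lemma scont_rawX i w : scont (fun x => rawX x i w).
Proof.
unfold rawX, topX; apply scont_max; [apply scont_const|].
apply scont_plus; [apply scont_minus; [apply scont_V|]|apply scont_const].
apply (scont_lmax (fun w x => V i (sqX x w))); intros; apply scont_V.
Qed.

Lemma rawX_nonneg x i w : 0 <= rawX x i w.
Proof. apply Rmax_l. Qed.

Lemma leaves_not_nil : leaves n [] <> [].
Proof. destruct (leaves_nonempty n []) as [w hw]; destruct (leaves n []); [destruct hw|discriminate]. Qed.

Lemma topX_attained x i : cube x -> exists w, In w (leaves n []) /\ V i (sqX x w) = topX x i.
Proof.
intros hx; apply (lmax_attained (fun w => V i (sqX x w)) _ leaves_not_nil).
intros w; apply V_nonneg, sqX_valid, hx.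
Qed.

Lemma rawX_total x i : cube x -> 0 < lsum (rawX x i) (leaves n []).
Proof.
intros hx; destruct (topX_attained x i hx) as [w [hw e]].
apply Rlt_le_trans with (rawX x i w).
- unfold rawX; rewrite e, Rmax_right; lra.
- apply lsum_ge_in; [apply rawX_nonneg|exact hw].
Qed.

Lemma scont_weightX i w : scont (fun x => weightX x i w).
Proof.
apply scont_div; [apply scont_rawX| |].
- apply (scont_lsum (fun w x => rawX x i w)); intros; apply scont_rawX.
- intros x hx; apply Rgt_not_eq, rawX_total; exact hx.
Qed.

Lemma weightX_nonneg x i w : cube x -> 0 <= weightX x i w.
Proof. intros hx; apply Rle_mult_inv_pos; [apply rawX_nonneg|apply rawX_total, hx]. Qed.

Lemma weightX_total x i : cube x -> lsum (weightX x i) (leaves n []) = 1.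
Proof.
intros hx; assert (h := rawX_total x i hx); unfold weightX.
rewrite (lsum_ext _ (fun w => / lsum (rawX x i) (leaves n []) * rawX x i w)).
- rewrite lsum_scal; field; lra.
- intros; unfold Rdiv; ring.
Qed.

Lemma weightX_pos x i w : cube x -> 0 < weightX x i w -> topX x i - eps < V i (sqX x w).
Proof.
intros hx h; apply Rnot_le_lt; intros hle.
revert h; unfold weightX, rawX at 1; rewrite Rmax_left by lra.
unfold Rdiv; rewrite Rmult_0_l; lra.
Qed.

Lemma scont_below k nu : scont (fun x => below (loadX x) k nu).
Proof.
apply (scont_lsum (fun w x => loadX x w)); intros w.
apply (scont_lsum (fun i x => weightX x i w)); intros i; apply scont_weightX.
Qed.

Lemma scont_slackX p : scont (fun x => slackX x p).
Proof.
destruct p as [nu [j|]]; unfold slackX; simpl.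
- apply scont_min; repeat apply scont_minus; try apply scont_const; apply scont_below.
- apply scont_minus; [apply scont_const|apply scont_below].
Qed.

Lemma V_leaves x i k nu : cube x -> (length nu + k = n)%nat ->
  V i (sqX x nu) <= 4 ^ k * topX x i.
Proof.
intros hx; revert nu; induction k as [|k IH]; intros nu hk.
- simpl; rewrite Rmult_1_l; apply (lmax_ge (fun w => V i (sqX x w))).
  assert (e : length nu = n) by lia; rewrite <- e, <- (app_nil_r nu) at 1.
  rewrite app_nil_r; generalize (leaves_complete nu []); rewrite app_nil_r; trivial.
- destruct (ratio_pattern (fun g => x (nu, g)) (fun g => hx (nu, g))) as [g hg].
  eapply Rle_trans; [apply (V_cover i (sqX x nu) g (excess (fun g => x (nu, g)) g))|].
  + apply sqX_valid, hx.
  + apply excess_bounds; intros; apply hx.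
  + rewrite (lsum_ext _ (fun j => V i (sqX x (j :: nu)))).
    * apply Rle_trans with (lsum (fun _ => 4 ^ k * topX x i) corners).
      -- apply lsum_le; intros j _; apply IH; simpl; lia.
      -- simpl; lra.
    * intros j _; simpl; unfold rhoX; rewrite hg; reflexivity.
Qed.

Lemma topX_ge x i : cube x -> (i < n)%nat -> eps <= topX x i.
Proof.
intros hx hi; generalize (eps_small i hi) (V_leaves x i n [] hx eq_refl); simpl sqX; intros h1 h2.
apply (Rmult_le_reg_r (4 ^ n)); [apply pow_lt; lra|lra].
Qed.

(** A point has value 0, while the best leaf is worth at least $4^{-n}$ of the unit square, hence at
    least [eps]. So nobody puts weight on a point. *)
Lemma loadX_point x w : cube x -> side (sqX x w) = 0 -> loadX x w = 0.
Proof.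
intros hx hw; apply lsum_zero; intros i hi; apply in_seq in hi.
apply Rle_antisym; [apply Rnot_lt_le; intros h|apply weightX_nonneg, hx].
apply (weightX_pos x i w hx) in h.
rewrite V_point in h; [|apply sqX_valid, hx|exact hw].
generalize (topX_ge x i hx ltac:(lia)); lra.
Qed.

Lemma approximate_division : exists S : nat -> square,
  (forall i, valid (S i)) /\
  (forall i j, (i < n)%nat -> (j < n)%nat -> i <> j -> separated (S i) (S j)) /\
  (forall i j, (i < n)%nat -> (j < n)%nat -> V i (S j) <= V i (S i) + eps) /\
  (forall i, (i < n)%nat ->
     kap * V i unit_square <= (6 * INR n - 2 * kap) * (V i (S i) + eps)).
Proof.
destruct (@Matching.complementarity_list n slackX scont_slackX) as [x [hx hslack]].
change (cube x) in hx.
assert (load0 : forall w, 0 <= loadX x w).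
{ intros w; apply lsum_nonneg; intros; apply weightX_nonneg, hx. }
assert (hnode : forall nu k, (length nu + S k = n)%nat ->
  exists g t, 0 <= t <= 1 /\ (forall j, rhoX x nu j = pattern g t j) /\
    (below (loadX x) (S k) nu < cap kap d nu -> g = None /\ t = 1) /\
    (cap kap d nu < below (loadX x) (S k) nu ->
       (t = 0 \/ exists j, g = Some j /\
          below (loadX x) (S k) nu - below (loadX x) k (j :: nu) <= cap kap d nu) /\
       forall j, cap kap d nu + d <= below (loadX x) k (j :: nu) ->
         cap kap d nu <= below (loadX x) (S k) nu - below (loadX x) k (j :: nu))).
{ intros nu k hk.
  assert (hs := hslack nu); unfold slackX in hs; simpl fst in hs; simpl snd in hs.
  replace (n - length nu)%nat with (S k) in hs by lia.
  replace (S k - 1)%nat with k in hs by lia.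
  rewrite (below_S (loadX x) k nu) in *.
  apply (node_cases (fun g => x (nu, g)) (fun g => hx (nu, g))
    (fun j => below (loadX x) k (j :: nu)) (cap kap d nu) d).
  - generalize (cap_ge kap d d0 nu); lra.
  - exact d0.
  - intros j; apply below_nonneg, load0.
  (* A child of ratio 0 is a point, and so is every leaf square within it. *)
  - intros j hj; apply lsum_zero; intros w hw; apply loadX_point; [exact hx|].
    assert (hin : within (sqX x w) (sqX x (j :: nu))).
    { apply (leaves_within (rhoX x) (sqX x)) with k; [reflexivity| | |exact hw].
      - intros; apply rhoX_bounds, hx.
      - intros mu; apply (sqX_valid x mu hx). }
    destruct hin as (a & b & _); simpl in a, b; unfold rhoX in a, b; rewrite hj in a, b.
    generalize (proj1 (proj2 (proj2 (sqX_valid x w hx)))); nra.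
  - apply (hs None); lia.
  - apply (hs None); lia.
  - intros j; apply (hs (Some j)); lia.
  - intros j; apply (hs (Some j)); lia. }
assert (htot : below (loadX x) n [] = INR n).
{ unfold below, loadX; rewrite lsum_swap.
  rewrite (lsum_ext _ (fun _ => 1)) by (intros; apply weightX_total, hx).
  clear; generalize 0%nat; induction n as [|m IH]; intros a; [reflexivity|].
  simpl lsum; rewrite IH; simpl; destruct m; simpl; lra. }
assert (n1 : 1 <= INR n) by (apply (le_INR 1); lia).
destruct (regions n kap d (rhoX x) (sqX x) (loadX x) V (topX x)) with (k := n) (nu := @nil corner)
  as (regs & hperm & hload & hdisj & hval); auto; try lia.
{ intros; apply rhoX_bounds, hx. }
{ intros nu; apply (sqX_valid x nu hx). }
{ intros; apply lmax_nonneg. }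
{ intros i nu hnu; generalize (V_leaves x i 0 nu hx ltac:(lia)); simpl; lra. }
{ intros i nu.
  destruct (ratio_pattern (fun g => x (nu, g)) (fun g => hx (nu, g))) as [g hg].
  eapply Rle_trans; [apply (V_cover i (sqX x nu) g (excess (fun g => x (nu, g)) g))|].
  - apply sqX_valid, hx.
  - apply excess_bounds; intros; apply hx.
  - apply Req_le, lsum_ext; intros j _; simpl; unfold rhoX; rewrite hg; reflexivity. }
{ right; rewrite htot; simpl; lra. }
pose (W := fun i r => lsum (weightX x i) (nth r regs [])).
destruct (@Matching.fractional_matching n (length regs) W (kap + INR n * d)) as [f [hf hinj]].
{ intros; apply lsum_nonneg; intros; apply weightX_nonneg, hx. }
{ intros i hi; apply Req_le; symmetry.
  change (sumN (W i) (length regs)) with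
    (lsum (fun r => lsum (weightX x i) (nth r regs [])) (seq 0 (length regs))).
  rewrite (lsum_seq_nth (lsum (weightX x i)) []), <- lsum_concat, (lsum_perm _ _ _ hperm).
  apply weightX_total, hx. }
{ intros r hr; change (sumN (fun i => W i r) n) with
    (lsum (fun i => lsum (weightX x i) (nth r regs [])) (seq 0 n)).
  rewrite lsum_swap; apply hload, nth_In, hr. }
{ exact caps. }
assert (hS : forall i, exists w, (i < n)%nat -> In w (nth (f i) regs []) /\ 0 < weightX x i w).
{ intros i; destruct (Nat.lt_ge_cases i n) as [hi|hi]; [|exists []; lia].
  destruct (hf i hi) as [_ h]; apply lsum_pos_ex in h; destruct h as [w h]; exists w; auto. }
destruct (choice _ hS) as [ws hws].
exists (fun i => sqX x (ws i)).
assert (htop : forall i, (i < n)%nat -> topX x i <= V i (sqX x (ws i)) + eps).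
{ intros i hi; generalize (weightX_pos x i (ws i) hx (proj2 (hws i hi))); lra. }
split; [|split; [|split]].
- intros i; apply sqX_valid, hx.
- intros i j hi hj hij.
  apply (ForallOrdPairs_nth _ [] regs) with (i := f i) (j := f j) in hdisj.
  + apply hdisj; [apply (hws i hi)|apply (hws j hj)].
  + intros r r' h w w' hw hw'; apply separated_sym; auto.
  + apply hf, hi.
  + apply hf, hj.
  + auto.
(* Every piece is the square of some leaf, so its value to agent [i] is at most the maximum over the
   leaves. *)
- intros i j hi hj; apply Rle_trans with (topX x i); [|apply htop, hi].
  apply (lmax_ge (fun w => V i (sqX x w))), (Permutation_in _ hperm).
  apply in_concat; exists (nth (f j) regs []); split; [apply nth_In, hf, hj|apply hws, hj].
- intros i hi.
  assert (hv : V i unit_square <= (6 * INR n / kap - 2) * topX x i).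
  { rewrite <- htot; apply (proj2 (hval i)).
    rewrite htot; unfold cap; simpl.
    (* For [n >= 2] the bound [caps] excludes [kap > n], so the root is not light and the second
       bound of [regions] applies to it. *)
    apply Rnot_lt_le; intros hlt.
    assert (0 < (INR n - 1) * (kap - 1)).
    { apply (le_INR 2) in n2; simpl in n2; apply Rmult_lt_0_compat; lra. }
    assert (0 <= INR n * d * (INR n - 1)) by (repeat apply Rmult_le_pos; lra).
    apply (le_INR 2) in n2; simpl in n2; nra. }
  apply Rle_trans with ((6 * INR n - 2 * kap) * topX x i).
  + apply (Rmult_le_compat_l kap) in hv; [|lra].
    replace ((6 * INR n - 2 * kap) * topX x i) with (kap * ((6 * INR n / kap - 2) * topX x i))
      by (field; lra); exact hv.
  + apply Rmult_le_compat_l; [|apply htop, hi].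
    apply (le_INR 2) in n2; simpl in n2.
    assert (0 <= INR n * d * (INR n - 1)) by (repeat apply Rmult_le_pos; lra).
    nra.
Qed.

End Approximate.

Lemma envy_free_squares : exists T : nat -> square,
  (forall i, valid (T i)) /\
  (forall i j, (i < n)%nat -> (j < n)%nat -> i <> j -> separated (T i) (T j)) /\
  (forall i j, (i < n)%nat -> (j < n)%nat -> V i (T j) <= V i (T i)) /\
  (forall i, (i < n)%nat -> V i unit_square <= (6 * INR n - 8) * V i (T i)).
Proof.
assert (hn : 2 <= INR n) by (apply (le_INR 2); exact n2).
destruct (common_lower_bound (fun i => V i unit_square / 4 ^ n) n) as [h0 [h0pos hV]].
{ intros i; apply Rdiv_lt_0_compat; [apply V_unit|apply pow_lt; lra]. }
(* The critical capacity. The choice [kap = c - 2 * h], [d = h / n], [eps = h] makes the largest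
   capacity [kap + n * d] equal to [c - h], just below it. *)
set (c := INR n / (INR n - 1)).
assert (hc : c * (INR n - 1) = INR n) by (unfold c; field; lra).
(* The bound [h0] keeps [eps * 4 ^ n] below each agent's value of the unit square; the other one
   keeps [c - 2 * h] above 1, since [c - 1 = / (INR n - 1)]. *)
pose (h1 := Rmin h0 (/ (4 * (INR n - 1)))).
assert (h1pos : 0 < h1).
{ apply Rmin_glb_lt; [exact h0pos|apply Rinv_0_lt_compat; lra]. }
pose (h := fun m : nat => h1 * / (INR m + 1)).
assert (hh : forall m, 0 < h m <= h1).
{ intros m; generalize (pos_INR m); intros hm.
  assert (0 < / (INR m + 1) <= 1).
  { split; [apply Rinv_0_lt_compat; lra|].
    rewrite <- Rinv_1; apply Rinv_le_contravar; lra. }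
  unfold h; split; nra. }
assert (hcv : Un_cv h 0).
{ intros e He; destruct (archimed_cor1 (e / h1)) as [N [HN HN0]]; [apply Rdiv_lt_0_compat; lra|].
  exists N; intros m Hm; unfold R_dist; rewrite Rminus_0_r, Rabs_pos_eq by (generalize (hh m); lra).
  apply Rle_lt_trans with (h1 * / INR N).
  - apply Rmult_le_compat_l; [lra|apply Rinv_le_contravar; [apply lt_0_INR; lia|]].
    apply le_INR in Hm; lra.
  - apply (Rmult_lt_compat_l h1) in HN; [|exact h1pos].
    replace (h1 * (e / h1)) with e in HN by (field; lra); exact HN. }
assert (step : forall m, exists S : nat -> square,
  (forall i, valid (S i)) /\
  (forall i j, (i < n)%nat -> (j < n)%nat -> i <> j -> separated (S i) (S j)) /\
  (forall i j, (i < n)%nat -> (j < n)%nat -> V i (S j) <= V i (S i) + h m) /\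
  (forall i, (i < n)%nat ->
     (c - 2 * h m) * V i unit_square <= (6 * INR n - 2 * (c - 2 * h m)) * (V i (S i) + h m))).
{ intros m; destruct (hh m) as [p1 p2].
  assert (b1 : h m <= / (4 * (INR n - 1))) by (eapply Rle_trans; [exact p2|apply Rmin_r]).
  assert (b2 : h m * (4 * (INR n - 1)) <= 1).
  { apply (Rmult_le_compat_r (4 * (INR n - 1))) in b1; [|lra].
    rewrite Rinv_l in b1; lra. }
  assert (b3 : h m <= h0) by (eapply Rle_trans; [exact p2|apply Rmin_l]).
  apply approximate_division with (d := h m / INR n).
  - assert (0 < (c - 2 * h m - 1) * (INR n - 1)) by nra.
    apply Rnot_le_lt; intros hle; nra.
  - apply Rdiv_lt_0_compat; lra.
  - exact p1.
  - replace (INR n * (h m / INR n)) with (h m) by (field; lra); nra.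
  - intros i hi; generalize (hV i hi); intros hVi.
    assert (h4 : 0 < 4 ^ n) by (apply pow_lt; lra).
    apply (Rmult_le_compat_r (4 ^ n)) in hVi; [|lra].
    replace (V i unit_square / 4 ^ n * 4 ^ n) with (V i unit_square) in hVi by (field; lra).
    apply Rle_trans with (h0 * 4 ^ n); [apply Rmult_le_compat_r; lra|exact hVi]. }
destruct (choice _ step) as [S HS]; clear step.
pose (u := fun (a : nat * nat) m =>
  match snd a with O => sx (S m (fst a)) | 1%nat => sy (S m (fst a)) | _ => side (S m (fst a)) end).
destruct (subseq_cv_list (list_prod (seq 0 n) [0; 1; 2]%nat) u) as [phi [l [hphi hl]]].
{ intros [i k] m; destruct (proj1 (HS m) i) as (v1 & v2 & v3 & v4 & v5).
  unfold u; simpl; destruct k as [|[|k]]; lra. }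
pose (T := fun i => if lt_dec i n then Square (l (i, 0%nat)) (l (i, 1%nat)) (l (i, 2%nat))
                   else unit_square).
assert (cvT : forall i, (i < n)%nat ->
  Un_cv (fun m => sx (S (phi m) i)) (sx (T i)) /\ Un_cv (fun m => sy (S (phi m) i)) (sy (T i)) /\
  Un_cv (fun m => side (S (phi m) i)) (side (T i))).
{ intros i hi; unfold T; destruct lt_dec; [|lia]; simpl.
  split; [|split]; [apply (hl (i, 0%nat))|apply (hl (i, 1%nat))|apply (hl (i, 2%nat))];
    apply in_prod; try (apply in_seq; lia); simpl; tauto. }
assert (hT : forall i, valid (T i)).
{ intros i; destruct (lt_dec i n) as [hi|hi].
  - destruct (cvT i hi) as (c1 & c2 & c3).
    assert (hval : forall m, valid (S (phi m) i)) by (intros; apply HS).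
    unfold valid in *; split; [|split; [|split; [|split]]].
    + apply (Un_cv_le (fun _ => 0) (fun m => sx (S (phi m) i))); [apply hval|apply Un_cv_const|exact c1].
    + apply (Un_cv_le (fun _ => 0) (fun m => sy (S (phi m) i))); [apply hval|apply Un_cv_const|exact c2].
    + apply (Un_cv_le (fun _ => 0) (fun m => side (S (phi m) i))); [apply hval|apply Un_cv_const|exact c3].
    + apply (Un_cv_le (fun m => sx (S (phi m) i) + side (S (phi m) i)) (fun _ => 1));
        [apply hval|apply CV_plus; assumption|apply Un_cv_const].
    + apply (Un_cv_le (fun m => sy (S (phi m) i) + side (S (phi m) i)) (fun _ => 1));
        [apply hval|apply CV_plus; assumption|apply Un_cv_const].
  - unfold T; destruct lt_dec; [lia|]; unfold valid; simpl; lra. }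
assert (cvV : forall i j, (j < n)%nat -> Un_cv (fun m => V i (S (phi m) j)) (V i (T j))).
{ intros i j hj; destruct (cvT j hj) as (c1 & c2 & c3).
  apply (V_cont i (fun m => S (phi m) j)); auto; intros m; apply HS. }
assert (hphi0 : Un_cv (fun m => h (phi m)) 0) by (apply (Un_cv_subseq h); assumption).
exists T; split; [exact hT|split; [|split]].
- intros i j hi hj hij; destruct (cvT i hi) as (? & ? & ?), (cvT j hj) as (? & ? & ?).
  apply (separated_limit (fun m => S (phi m) i) (fun m => S (phi m) j)); auto.
  intros m; apply (HS (phi m)); assumption.
- intros i j hi hj; rewrite <- (Rplus_0_r (V i (T i))).
  apply (Un_cv_le (fun m => V i (S (phi m) j)) (fun m => V i (S (phi m) i) + h (phi m))).
  + intros m; apply (HS (phi m)); assumption.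
  + apply cvV, hj.
  + apply CV_plus; [apply cvV, hi|exact hphi0].
- intros i hi.
  assert (hlim : (c - 2 * 0) * V i unit_square <= (6 * INR n - 2 * (c - 2 * 0)) * (V i (T i) + 0)).
  { assert (hk : Un_cv (fun m => c - 2 * h (phi m)) (c - 2 * 0)).
    { apply (CV_minus (fun _ => c) (fun m => 2 * h (phi m))); [apply Un_cv_const|].
      apply (CV_mult (fun _ => 2) (fun m => h (phi m))); [apply Un_cv_const|exact hphi0]. }
    apply (Un_cv_le (fun m => (c - 2 * h (phi m)) * V i unit_square)
      (fun m => (6 * INR n - 2 * (c - 2 * h (phi m))) * (V i (S (phi m) i) + h (phi m)))).
    - intros m; apply (HS (phi m)); assumption.
    - apply (CV_mult (fun m => c - 2 * h (phi m)) (fun _ => V i unit_square));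
        [exact hk|apply Un_cv_const].
    - apply (CV_mult (fun m => 6 * INR n - 2 * (c - 2 * h (phi m)))
        (fun m => V i (S (phi m) i) + h (phi m))).
      + apply (CV_minus (fun _ => 6 * INR n) (fun m => 2 * (c - 2 * h (phi m)))); [apply Un_cv_const|].
        apply (CV_mult (fun _ => 2) (fun m => c - 2 * h (phi m))); [apply Un_cv_const|exact hk].
      + apply CV_plus; [apply cvV, hi|exact hphi0]. }
  replace (c - 2 * 0) with c in hlim by ring; rewrite Rplus_0_r in hlim.
  (* Multiplication by [n - 1] turns [c] into [n]; the common factor [n] then leaves
     [6 * (n - 1) - 2]. *)
  apply (Rmult_le_compat_r (INR n - 1)) in hlim; [|lra].
  apply (Rmult_le_reg_l (INR n)); [lra|].
  replace (c * V i unit_square * (INR n - 1)) with (c * (INR n - 1) * V i unit_square) in hlim by ring.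
  replace ((6 * INR n - 2 * c) * V i (T i) * (INR n - 1)) with
    ((6 * INR n * (INR n - 1) - 2 * (c * (INR n - 1))) * V i (T i)) in hlim by ring.
  rewrite hc in hlim; lra.
Qed.

End Equilibrium.

(** * Suprema and infima *)

Lemma Rsup_ge (P : R -> Prop) x : bound P -> P x -> x <= Rsup P.
Proof.
intros hb hx; unfold Rsup; destruct excluded_middle_informative as [h|h].
- destruct (completeness P (proj1 h) (proj2 h)) as [l [hl hl']]; simpl; apply hl, hx.
- exfalso; apply h; split; [exact hb|exists x; exact hx].
Qed.

Lemma Rsup_le (P : R -> Prop) M : (exists x, P x) -> (forall x, P x -> x <= M) -> Rsup P <= M.
Proof.
intros hx hM; unfold Rsup; destruct excluded_middle_informative as [h|h].
- destruct (completeness P (proj1 h) (proj2 h)) as [l [hl' hl]]; simpl; apply hl; exact hM.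
- exfalso; apply h; split; [exists M; exact hM|exact hx].
Qed.

Lemma Rinf_le (P : R -> Prop) m x : (forall y, P y -> m <= y) -> P x -> Rinf P <= x.
Proof.
intros hm hx; unfold Rinf.
assert (- x <= Rsup (fun y => P (- y))); [|lra].
apply Rsup_ge; [exists (- m); intros y hy; specialize (hm _ hy); lra|].
rewrite Ropp_involutive; exact hx.
Qed.

Lemma Rinf_ge (P : R -> Prop) m : (exists x, P x) -> (forall y, P y -> m <= y) -> m <= Rinf P.
Proof.
intros [x hx] hm; unfold Rinf.
assert (Rsup (fun y => P (- y)) <= - m); [|lra].
apply Rsup_le; [exists (- x); rewrite Ropp_involutive; exact hx|].
intros y hy; specialize (hm _ hy); lra.
Qed.

Lemma Rinf_approx (P : R -> Prop) e : (exists x, P x) -> 0 < e ->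
  exists x, P x /\ x <= Rinf P + e.
Proof.
intros hx he; apply NNPP; intros hn.
assert (Rinf P + e <= Rinf P); [|lra].
apply Rinf_ge; [exact hx|].
intros y hy; apply Rnot_lt_le; intros hlt; apply hn; exists y; split; [exact hy|lra].
Qed.

(** * Nonnegative series *)

Lemma lsum_seq_S (f : nat -> R) N : lsum f (seq 0 (S N)) = lsum f (seq 0 N) + f N.
Proof. rewrite seq_S, lsum_app; simpl; ring. Qed.

Lemma sum_f_R0_lsum f N : sum_f_R0 f N = lsum f (seq 0 (S N)).
Proof.
induction N as [|N IH]; [simpl; ring|].
rewrite lsum_seq_S, <- IH; reflexivity.
Qed.

Lemma lsum_incl {A} (f : A -> R) l l' : (forall a, 0 <= f a) -> NoDup l -> incl l l' ->
  lsum f l <= lsum f l'.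
Proof.
intros f0; revert l'; induction l as [|a l IH]; intros l' nd hin.
- apply lsum_nonneg; auto.
- inversion nd; subst.
  destruct (in_split a l') as (l1 & l2 & ->); [apply hin; left; reflexivity|].
  rewrite lsum_app; simpl.
  assert (lsum f l <= lsum f (l1 ++ l2)).
  { apply IH; [assumption|]; intros b hb.
    assert (hb' := hin b (or_intror hb)); apply in_app_or in hb'.
    apply in_or_app; destruct hb' as [h|[->|h]]; auto; contradiction. }
  rewrite lsum_app in H; lra.
Qed.

Lemma lsum_seq_mono (f : nat -> R) N M : (forall k, 0 <= f k) -> (N <= M)%nat ->
  lsum f (seq 0 N) <= lsum f (seq 0 M).
Proof.
intros f0 h; apply lsum_incl; [exact f0|apply seq_NoDup|].
intros a; rewrite !in_seq; lia.
Qed.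

Lemma series_le (f : nat -> R) S : (forall k, 0 <= f k) ->
  (forall N, lsum f (seq 0 N) <= S) -> exists s, s <= S /\ Un_cv (fun N => sum_f_R0 f N) s.
Proof.
intros f0 hS.
destruct (growing_cv (fun N => sum_f_R0 f N)) as [s hs].
- intros N; simpl; generalize (f0 (Datatypes.S N)); lra.
- exists S; intros x [N ->]; rewrite sum_f_R0_lsum; apply hS.
- exists s; split; [|exact hs].
  apply Rnot_lt_le; intros hlt; destruct (hs (s - S)) as [N HN]; [lra|].
  specialize (HN N (le_n N)); rewrite sum_f_R0_lsum in HN; specialize (hS (Datatypes.S N)).
  revert HN; unfold R_dist; split_Rabs; lra.
Qed.

Lemma series_partial_le (f : nat -> R) s : (forall k, 0 <= f k) ->
  Un_cv (fun N => sum_f_R0 f N) s -> forall N, lsum f (seq 0 N) <= s.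
Proof.
intros f0 hs N; apply Rle_trans with (sum_f_R0 f N).
- rewrite sum_f_R0_lsum; apply lsum_seq_mono; [exact f0|lia].
- apply (growing_ineq (fun N => sum_f_R0 f N)); [|exact hs].
  intros m; simpl; generalize (f0 (S m)); lra.
Qed.

Lemma split_series (a e : nat -> R) S : (forall k, 0 <= a k) -> (forall k, 0 <= e k) ->
  (forall N, lsum (fun k => a k + e k) (seq 0 N) <= S) ->
  exists Sa Se, (forall N, lsum a (seq 0 N) <= Sa) /\ (forall N, lsum e (seq 0 N) <= Se) /\
    Sa + Se <= S.
Proof.
intros a0 e0 hS.
assert (hadd : forall N, lsum a (seq 0 N) + lsum e (seq 0 N) <= S).
{ intros N; rewrite <- lsum_plus; apply hS. }
destruct (series_le a S a0) as [Sa [_ hSa]].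
{ intros N; generalize (hadd N) (lsum_nonneg e (seq 0 N) (fun k _ => e0 k)); lra. }
destruct (series_le e S e0) as [Se [_ hSe]].
{ intros N; generalize (hadd N) (lsum_nonneg a (seq 0 N) (fun k _ => a0 k)); lra. }
exists Sa, Se; split; [apply series_partial_le; assumption|split; [apply series_partial_le; assumption|]].
apply Rnot_lt_le; intros hlt.
destruct (CV_plus _ _ _ _ hSa hSe (Sa + Se - S)) as [N HN]; [lra|].
specialize (HN N (le_n N)); cbv beta in HN; rewrite !sum_f_R0_lsum in HN.
generalize (hadd (Datatypes.S N)); revert HN; unfold R_dist; split_Rabs; lra.
Qed.

Lemma geometric_partial e N : 0 <= e -> lsum (fun k => e / 2 ^ S k) (seq 0 N) <= e.
Proof.
intros he.
assert (h : lsum (fun k => e / 2 ^ S k) (seq 0 N) = e - e / 2 ^ N).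
{ induction N as [|N IH]; [simpl; field|].
  rewrite lsum_seq_S, IH; simpl; field; apply pow_nonzero; lra. }
rewrite h; assert (0 <= e / 2 ^ N); [|lra].
apply Rle_mult_inv_pos; [exact he|apply pow_lt; lra].
Qed.

(** * Lebesgue outer measure *)

(** A set without a cover of finite total area gets the conventional value 0 from [outer]. Therefore
    monotonicity and subadditivity ask for bounded sets on the larger side. *)
Definition bounded_set (A : pset) : Prop := exists b, box_ok b /\ subset A (in_box b).

Definition setI (A B : pset) : pset := fun q => A q /\ B q.
Definition setD (A B : pset) : pset := fun q => A q /\ ~ B q.
Definition setC (A : pset) : pset := fun q => ~ A q.

Definition box0 : box := Box 0 0 0 0.

Lemma box0_ok : box_ok box0.
Proof. unfold box_ok; simpl; lra. Qed.

Lemma box0_area : box_area box0 = 0.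
Proof. unfold box_area; simpl; ring. Qed.

Lemma box_area_nonneg b : box_ok b -> 0 <= box_area b.
Proof. intros [h1 h2]; unfold box_area; apply Rmult_le_pos; lra. Qed.

Lemma bounded_subset A B : subset A B -> bounded_set B -> bounded_set A.
Proof. intros h [b [hb hB]]; exists b; split; [exact hb|intros q hq; apply hB, h, hq]. Qed.

(** Cantor's pairing merges the double sequence into one; finitely many of its terms always lie in a
    rectangle of indices, whose sum is at most [S]. *)
Lemma outer_le_double (A : pset) (b : nat -> nat -> box) S :
  (forall k j, box_ok (b k j)) ->
  (forall q, A q -> exists k j, in_box (b k j) q) ->
  (forall K L, lsum (fun k => lsum (fun j => box_area (b k j)) (seq 0 L)) (seq 0 K) <= S) ->
  outer A <= S.
Proof.
intros hok hcov hS.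
pose (bs := fun m => let (k, j) := Cantor.of_nat m in b k j).
assert (hbs : forall m, box_ok (bs m)) by (intros m; unfold bs; destruct (Cantor.of_nat m); apply hok).
destruct (series_le (fun m => box_area (bs m)) S) as [s [hs1 hs2]].
- intros m; apply box_area_nonneg, hbs.
- intros N.
  pose (l := map Cantor.of_nat (seq 0 N)).
  assert (hl : exists K L, incl l (list_prod (seq 0 K) (seq 0 L))).
  { clearbody l; induction l as [|[k j] l [K [L IH]]]; [exists 0%nat, 0%nat; intros a []|].
    exists (K + k + 1)%nat, (L + j + 1)%nat; intros [k' j'] [e|h].
    - injection e; intros; subst; apply in_prod; apply in_seq; lia.
    - apply IH, in_prod_iff in h; rewrite !in_seq in h; apply in_prod; apply in_seq; lia. }
  destruct hl as [K [L hl]].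
  assert (hprod : forall l1 l2, lsum (fun p => box_area (b (fst p) (snd p))) (list_prod l1 l2) =
    lsum (fun k => lsum (fun j => box_area (b k j)) l2) l1).
  { intros l1 l2; induction l1 as [|k l1 IH]; [reflexivity|].
    simpl; rewrite lsum_app, IH; f_equal; clear.
    induction l2 as [|j l2 IH]; [reflexivity|simpl; rewrite IH; reflexivity]. }
  apply Rle_trans with (2 := hS K L); rewrite <- hprod.
  apply Rle_trans with (lsum (fun p => box_area (b (fst p) (snd p))) l).
  + apply Req_le; unfold l; generalize (seq 0 N); intros s'; induction s' as [|m s' IH]; [reflexivity|].
    simpl; rewrite IH; f_equal; unfold bs; destruct (Cantor.of_nat m); reflexivity.
  + apply lsum_incl; [intros p; apply box_area_nonneg, hok| |exact hl].
    apply FinFun.Injective_map_NoDup; [|apply seq_NoDup].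
    intros x y h; rewrite <- (Cantor.cancel_to_of x), <- (Cantor.cancel_to_of y), h; reflexivity.
- apply Rle_trans with s; [|exact hs1].
  apply (Rinf_le _ 0).
  + intros y [bs' [h1 [_ h2]]].
    apply (Un_cv_between (fun N => sum_f_R0 (fun k => box_area (bs' k)) N) y 0 y); [|exact h2].
    intros N; split.
    * rewrite sum_f_R0_lsum; apply lsum_nonneg; intros; apply box_area_nonneg, h1.
    * rewrite sum_f_R0_lsum; apply series_partial_le; [|exact h2].
      intros; apply box_area_nonneg, h1.
  + exists bs; split; [exact hbs|split; [|exact hs2]].
    intros q hq; destruct (hcov q hq) as [k [j h]]; exists (Cantor.to_nat (k, j)).
    unfold bs; rewrite Cantor.cancel_of_to; exact h.
Qed.

Lemma outer_le_list (A : pset) (l : list box) : (forall b, In b l -> box_ok b) ->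
  (forall q, A q -> exists b, In b l /\ in_box b q) -> outer A <= lsum box_area l.
Proof.
intros hok hcov.
apply (outer_le_double _ (fun k j => if Nat.eq_dec k 0 then nth j l box0 else box0)).
- intros k j; destruct Nat.eq_dec; [|apply box0_ok].
  destruct (nth_in_or_default j l box0) as [h| ->]; [apply hok, h|apply box0_ok].
- intros q hq; destruct (hcov q hq) as [b [hb h]].
  apply (In_nth _ _ box0) in hb; destruct hb as [j [_ <-]]; exists 0%nat, j; exact h.
- intros K L.
  assert (h0 : forall b, In b l -> 0 <= box_area b) by (intros; apply box_area_nonneg; auto).
  assert (hpos : forall j, 0 <= box_area (nth j l box0)).
  { intros j; destruct (nth_in_or_default j l box0) as [h| ->]; [apply h0, h|rewrite box0_area; lra]. }
  assert (hrow : lsum (fun j => box_area (nth j l box0)) (seq 0 L) <= lsum box_area l).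
  { rewrite <- (lsum_seq_nth box_area box0 l).
    destruct (Nat.le_ge_cases L (length l)) as [h|h]; [apply lsum_seq_mono; assumption|].
    replace L with (length l + (L - length l))%nat by lia.
    rewrite seq_app, lsum_app, (lsum_zero _ (seq (0 + length l) _)); [lra|].
    intros j hj; apply in_seq in hj; rewrite nth_overflow by lia; apply box0_area. }
  destruct K as [|K]; [simpl; apply lsum_nonneg; exact h0|].
  simpl seq; simpl lsum at 1.
  rewrite (lsum_zero _ (seq 1 K)); [lra|].
  intros k hk; apply in_seq in hk; destruct Nat.eq_dec; [lia|].
  apply lsum_zero; intros; apply box0_area.
Qed.

Lemma outer_box b : box_ok b -> outer (in_box b) <= box_area b.
Proof.
intros hb; generalize (outer_le_list (in_box b) [b]); simpl; rewrite Rplus_0_r; intros h; apply h.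
- intros b' [<-|[]]; exact hb.
- intros q hq; exists b; auto.
Qed.

Lemma outer_approx A e : bounded_set A -> 0 < e -> exists bs : nat -> box,
  (forall k, box_ok (bs k)) /\ (forall q, A q -> exists k, in_box (bs k) q) /\
  forall N, lsum (fun k => box_area (bs k)) (seq 0 N) <= outer A + e.
Proof.
intros [b [hb hA]] he.
destruct (Rinf_approx (fun s => exists bs : nat -> box,
          (forall k, box_ok (bs k)) /\
          (forall q, A q -> exists k, in_box (bs k) q) /\
          Un_cv (fun N => sum_f_R0 (fun k => box_area (bs k)) N) s) e) as [s [[bs (h1 & h2 & h3)] hs]].
- pose (bs := fun k : nat => if Nat.eq_dec k 0 then b else box0).
  assert (hbs : forall k, box_ok (bs k)).
  { intros k; unfold bs; destruct Nat.eq_dec; [exact hb|apply box0_ok]. }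
  destruct (series_le (fun k => box_area (bs k)) (box_area b)) as [s [_ hs]].
  + intros; apply box_area_nonneg, hbs.
  + intros N; destruct N as [|N]; [simpl; apply box_area_nonneg, hb|].
    change (box_area b + lsum (fun k => box_area (bs k)) (seq 1 N) <= box_area b).
    rewrite lsum_zero; [lra|]; intros k hk; apply in_seq in hk; unfold bs.
    destruct Nat.eq_dec; [lia|apply box0_area].
  + exists s, bs; split; [exact hbs|split; [|exact hs]].
    intros q hq; exists 0%nat; apply hA, hq.
- exact he.
- exists bs; split; [exact h1|split; [exact h2|intros N]].
  apply Rle_trans with s; [|exact hs].
  apply series_partial_le; [intros; apply box_area_nonneg, h1|exact h3].
Qed.

Lemma outer_nonneg A : 0 <= outer A.
Proof.
destruct (classic (exists s, exists bs : nat -> box,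
          (forall k, box_ok (bs k)) /\
          (forall q, A q -> exists k, in_box (bs k) q) /\
          Un_cv (fun N => sum_f_R0 (fun k => box_area (bs k)) N) s)) as [hne|hne].
- apply Rinf_ge; [exact hne|].
  intros y [bs (h1 & _ & h3)].
  apply Rle_trans with (lsum (fun k => box_area (bs k)) (seq 0 0)); [simpl; lra|].
  apply series_partial_le; [intros; apply box_area_nonneg, h1|exact h3].
- unfold outer, Rinf, Rsup; destruct excluded_middle_informative as [[hb [x hx]]|hno]; [|lra].
  exfalso; apply hne; exists (- x); exact hx.
Qed.

Lemma outer_countable (A : pset) (B : nat -> pset) S :
  (forall k, bounded_set (B k)) -> (forall q, A q -> exists k, B k q) ->
  (forall N, lsum (fun k => outer (B k)) (seq 0 N) <= S) -> outer A <= S.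
Proof.
intros hb hcov hS; apply le_epsilon; intros e he.
assert (step : forall k, exists bs : nat -> box,
  (forall j, box_ok (bs j)) /\ (forall q, B k q -> exists j, in_box (bs j) q) /\
  forall N, lsum (fun j => box_area (bs j)) (seq 0 N) <= outer (B k) + e / 2 ^ Datatypes.S k).
{ intros k; apply outer_approx; [apply hb|].
  apply Rdiv_lt_0_compat; [exact he|apply pow_lt; lra]. }
destruct (choice _ step) as [bs hbs].
apply (outer_le_double A bs).
- intros k; apply hbs.
- intros q hq; destruct (hcov q hq) as [k hk]; exists k; apply hbs, hk.
- intros K L.
  apply Rle_trans with (lsum (fun k => outer (B k) + e / 2 ^ Datatypes.S k) (seq 0 K)).
  + apply lsum_le; intros k _; apply hbs.
  + rewrite lsum_plus; generalize (hS K) (geometric_partial e K); lra.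
Qed.

Lemma outer_union A B D : bounded_set A -> bounded_set B -> (forall q, D q -> A q \/ B q) ->
  outer D <= outer A + outer B.
Proof.
intros hA hB hD.
assert (h0 : outer (fun _ => False) = 0).
{ apply Rle_antisym; [|apply outer_nonneg].
  apply (outer_le_list _ []); [intros b []|intros q []]. }
apply (outer_countable D (fun k => match k with O => A | 1%nat => B | _ => fun _ => False end)).
- intros [|[|k]]; [exact hA|exact hB|exists box0; split; [apply box0_ok|intros q []]].
- intros q hq; destruct (hD q hq); [exists 0%nat|exists 1%nat]; assumption.
- intros [|[|N]]; simpl; try (generalize (outer_nonneg A) (outer_nonneg B); lra).
  rewrite lsum_zero; [lra|].
  intros k hk; apply in_seq in hk; destruct k as [|[|k]]; [lia|lia|exact h0].
Qed.

Lemma outer_mono A B : subset A B -> bounded_set B -> outer A <= outer B.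
Proof.
intros h hB; apply (outer_countable A (fun k => match k with O => B | _ => fun _ => False end)).
- intros [|k]; [exact hB|exists box0; split; [apply box0_ok|intros q []]].
- intros q hq; exists 0%nat; apply h, hq.
- assert (h0 : outer (fun _ => False) <= 0).
  { apply (outer_le_list _ []); [intros b []|intros q []]. }
  intros [|N]; simpl; [apply outer_nonneg|].
  rewrite lsum_zero; [lra|].
  intros k hk; apply in_seq in hk; destruct k as [|k]; [lia|].
  apply Rle_antisym; [exact h0|apply outer_nonneg].
Qed.

Lemma outer_ext A B : (forall q, A q <-> B q) -> bounded_set A -> outer A = outer B.
Proof.
intros h hA; apply Rle_antisym; apply outer_mono; try (intros q; apply h).
- apply (bounded_subset B A); [intros q; apply h|exact hA].
- exact hA.
Qed.

(** * Carathéodory splitting *)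

(** Carathéodory's condition with arbitrary bounded test sets, reduced to the inequality that is not
    automatic. Here, unlike with boxes, a test set can be cut by one set and then tested on another,
    as closure under intersection demands. *)
Definition splits (E : pset) : Prop :=
  forall T, bounded_set T -> outer (setI T E) + outer (setD T E) <= outer T.

Lemma splits_eq E T : splits E -> bounded_set T -> outer T = outer (setI T E) + outer (setD T E).
Proof.
intros hE hT; apply Rle_antisym; [|apply hE, hT].
apply outer_union.
- apply (bounded_subset _ T); [intros q []; assumption|exact hT].
- apply (bounded_subset _ T); [intros q []; assumption|exact hT].
- intros q hq; destruct (classic (E q)); [left|right]; split; assumption.
Qed.

Lemma bounded_box b : box_ok b -> bounded_set (in_box b).
Proof. intros hb; exists b; split; [exact hb|intros q hq; exact hq]. Qed.

Lemma splits_lmeas E : splits E -> lmeas E.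
Proof. intros hE b hb; apply (splits_eq E); [exact hE|apply bounded_box, hb]. Qed.

(** Cover [T] by boxes of almost minimal total area and split every box, with errors
    [e / 2 / 2 ^ S k]; the two families of pieces cover the two parts of [T]. *)
Lemma splits_of_boxes E :
  (forall b e, box_ok b -> 0 < e -> outer (setI (in_box b) E) + outer (setD (in_box b) E) <= box_area b + e) ->
  splits E.
Proof.
intros hE T hT; apply le_epsilon; intros e he.
destruct (outer_approx T (e / 2) hT) as (bs & h1 & h2 & h3); [lra|].
destruct (split_series (fun k => outer (setI (in_box (bs k)) E))
  (fun k => outer (setD (in_box (bs k)) E)) (outer T + e)) as (Sa & Se & hSa & hSe & hS).
- intros; apply outer_nonneg.
- intros; apply outer_nonneg.
- intros N; apply Rle_trans with (lsum (fun k => box_area (bs k) + e / 2 / 2 ^ S k) (seq 0 N)).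
  + apply lsum_le; intros k _; apply hE; [apply h1|].
    apply Rdiv_lt_0_compat; [lra|apply pow_lt; lra].
  + rewrite lsum_plus; generalize (h3 N) (geometric_partial (e / 2) N); lra.
- assert (outer (setI T E) <= Sa).
  { apply (outer_countable _ (fun k => setI (in_box (bs k)) E)); [| |exact hSa].
    - intros k; apply (bounded_subset _ (in_box (bs k))); [intros q []; assumption|apply bounded_box, h1].
    - intros q [hq hEq]; destruct (h2 q hq) as [k hk]; exists k; split; assumption. }
  assert (outer (setD T E) <= Se).
  { apply (outer_countable _ (fun k => setD (in_box (bs k)) E)); [| |exact hSe].
    - intros k; apply (bounded_subset _ (in_box (bs k))); [intros q []; assumption|apply bounded_box, h1].
    - intros q [hq hEq]; destruct (h2 q hq) as [k hk]; exists k; split; assumption. }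
  lra.
Qed.

Lemma lmeas_splits E : lmeas E -> splits E.
Proof.
intros hE; apply splits_of_boxes; intros b e hb he.
unfold setI, setD; rewrite <- (hE b hb); generalize (outer_box b hb); lra.
Qed.

Lemma splits_ext E F : (forall q, E q <-> F q) -> splits E -> splits F.
Proof.
intros h hE T hT.
rewrite <- (outer_ext (setI T E) (setI T F)), <- (outer_ext (setD T E) (setD T F)).
- apply hE, hT.
- intros q; unfold setD; rewrite h; tauto.
- apply (bounded_subset _ T); [intros q []; assumption|exact hT].
- intros q; unfold setI; rewrite h; tauto.
- apply (bounded_subset _ T); [intros q []; assumption|exact hT].
Qed.

Lemma splits_compl E : splits E -> splits (setC E).
Proof.
intros hE T hT.
rewrite (outer_ext (setD T (setC E)) (setI T E)).
- rewrite Rplus_comm; apply hE, hT.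
- intros q; unfold setD, setI, setC; split; [intros [h1 h2]; split; [exact h1|apply NNPP, h2]|tauto].
- apply (bounded_subset _ T); [intros q []; assumption|exact hT].
Qed.

Lemma splits_inter E F : splits E -> splits F -> splits (setI E F).
Proof.
intros hE hF T hT.
assert (bE : bounded_set (setI T E)) by (apply (bounded_subset _ T); [intros q []; assumption|exact hT]).
assert (bD : bounded_set (setD T E)) by (apply (bounded_subset _ T); [intros q []; assumption|exact hT]).
assert (h1 := hE T hT); assert (h2 := hF _ bE).
assert (h3 : outer (setI T (setI E F)) <= outer (setI (setI T E) F)).
{ apply outer_mono; [unfold subset, setI; tauto|].
  apply (bounded_subset _ (setI T E)); [intros q []; assumption|exact bE]. }
assert (h4 : outer (setD T (setI E F)) <= outer (setD (setI T E) F) + outer (setD T E)).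
{ apply outer_union.
  - apply (bounded_subset _ (setI T E)); [intros q []; assumption|exact bE].
  - exact bD.
  - intros q; unfold setD, setI; tauto. }
lra.
Qed.

Lemma splits_null E : outer E <= 0 -> bounded_set E -> splits E.
Proof.
intros h0 hb T hT.
assert (outer (setI T E) <= 0).
{ apply Rle_trans with (outer E); [apply outer_mono; [intros q []; assumption|exact hb]|exact h0]. }
assert (outer (setD T E) <= outer T) by (apply outer_mono; [intros q []; assumption|exact hT]).
lra.
Qed.

Lemma outer_disjoint_sum N (A : nat -> pset) X : bounded_set X ->
  (forall k, (k < N)%nat -> splits (A k) /\ subset (A k) X) ->
  (forall j k, (j < N)%nat -> (k < N)%nat -> j <> k -> forall q, ~ (A j q /\ A k q)) ->
  lsum (fun k => outer (A k)) (seq 0 N) <= outer X.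
Proof.
revert X; induction N as [|N IH]; intros X hX hA hd; [simpl; apply outer_nonneg|].
rewrite lsum_seq_S.
destruct (hA N ltac:(lia)) as [hs hsub].
assert (h := hs X hX).
assert (bD : bounded_set (setD X (A N))) by (apply (bounded_subset _ X); [intros q []; assumption|exact hX]).
assert (lsum (fun k => outer (A k)) (seq 0 N) <= outer (setD X (A N))).
{ apply IH; [exact bD| |intros; apply hd; lia].
  intros k hk; destruct (hA k ltac:(lia)) as [h1 h2]; split; [exact h1|].
  intros q hq; split; [apply h2, hq|intros hq'; apply (hd k N) with q; auto; lia]. }
assert (outer (A N) <= outer (setI X (A N))).
{ apply outer_mono; [intros q hq; split; auto|].
  apply (bounded_subset _ X); [intros q []; assumption|exact hX]. }
lra.
Qed.

(** * Half-planes split every set *)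

Lemma lsum_const {A} (c : R) (l : list A) : lsum (fun _ => c) l = INR (length l) * c.
Proof.
induction l as [|a l IH]; [simpl; ring|].
change (lsum (fun _ : A => c) (a :: l)) with (c + lsum (fun _ : A => c) l).
rewrite IH; simpl length; rewrite S_INR; ring.
Qed.

Lemma grid_index (w x0 x : R) (G : nat) : 0 < w -> x0 <= x <= x0 + INR G * w -> (0 < G)%nat ->
  exists i, (i < G)%nat /\ x0 + INR i * w <= x <= x0 + INR (S i) * w.
Proof.
intros hw hx hG; revert hx; induction G as [|G IH]; intros hx; [lia|].
destruct (Rle_lt_dec (x0 + INR G * w) x) as [h|h].
- exists G; split; [lia|lra].
- destruct G as [|G]; [simpl in h; lra|].
  destruct IH as [i [hi h']]; [lia|lra|exists i; split; [lia|exact h']].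
Qed.

(* A box is cut into thin vertical strips; in each of them the line is trapped in a
   flat box, and only these flat boxes are counted twice. *)
Lemma splits_graph (m k : R) (E : pset) :
  (forall q, E q -> snd q <= m * fst q + k) ->
  (forall q, ~ E q -> m * fst q + k <= snd q) -> splits E.
Proof.
intros hE hnE; apply splits_of_boxes; intros b e [hx hy] he.
set (W := bx2 b - bx1 b).
assert (hW : 0 <= W) by (unfold W; lra).
destruct (Rle_lt_or_eq_dec 0 W hW) as [hW0|hW0].
- set (slope := Rabs m).
  assert (hs : 0 <= slope) by apply Rabs_pos.
  (* In a strip of width [w = W / G] the two boxes overlap in height at most [2 * slope * w]. Over
     all strips the excess is [2 * slope * W * w], and this [G] brings it below [e]. *)
  destruct (archimed_cor1 (e / 2 / (slope * W * W + 1))) as [G [hG hG0]].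
  { apply Rdiv_lt_0_compat; [lra|]; assert (0 <= slope * W * W) by (repeat apply Rmult_le_pos; lra); lra. }
  assert (hGR : 0 < INR G) by (apply lt_0_INR; exact hG0).
  set (w := W / INR G).
  assert (hw : 0 < w) by (unfold w; apply Rdiv_lt_0_compat; lra).
  assert (hwG : INR G * w = W) by (unfold w; field; lra).
  pose (xl := fun i => bx1 b + INR i * w).
  pose (clip := fun y => Rmax (by1 b) (Rmin (by2 b) y)).
  pose (mid := fun i => m * xl i + k).
  pose (P := fun i => Box (xl i) (xl (S i)) (by1 b) (clip (mid i + slope * w))).
  pose (Q := fun i => Box (xl i) (xl (S i)) (clip (mid i - slope * w)) (by2 b)).
  assert (hxl : forall i, xl (S i) = xl i + w) by (intros i; unfold xl; rewrite S_INR; ring).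
  assert (hclip : forall y, by1 b <= clip y <= by2 b).
  { intros y; unfold clip, Rmax, Rmin; repeat destruct Rle_dec; lra. }
  assert (hline : forall i x, xl i <= x <= xl (S i) ->
     mid i - slope * w <= m * x + k <= mid i + slope * w).
  { intros i x hx'; rewrite hxl in hx'; unfold mid.
    assert (Rabs (m * (x - xl i)) <= slope * w).
    { rewrite Rabs_mult; apply Rmult_le_compat_l; [apply Rabs_pos|rewrite Rabs_pos_eq; lra]. }
    replace (m * x + k) with (m * xl i + k + m * (x - xl i)) by ring.
    revert H; split_Rabs; lra. }
  assert (hin : forall q, in_box b q -> exists i, (i < G)%nat /\ xl i <= fst q <= xl (S i)).
  { intros q [hq _]; apply grid_index; [exact hw| |exact hG0].
    unfold W in hwG; lra. }
  assert (h1 : outer (setI (in_box b) E) <= lsum (fun i => box_area (P i)) (seq 0 G)).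
  { replace (lsum (fun i => box_area (P i)) (seq 0 G)) with (lsum box_area (map P (seq 0 G)))
      by (generalize (seq 0 G); intros l; induction l as [|a l IH]; simpl; [reflexivity|rewrite IH; reflexivity]).
    apply outer_le_list.
    - intros b' hb'; apply in_map_iff in hb'; destruct hb' as [i [<- _]].
      unfold box_ok; simpl; generalize (hclip (mid i + slope * w)); rewrite hxl; lra.
    - intros q [hq hEq]; destruct (hin q hq) as [i [hi hxi]]; exists (P i).
      split; [apply in_map, in_seq; lia|]; destruct hq as [_ hq].
      unfold in_box; simpl; split; [exact hxi|split; [lra|]].
      generalize (hE q hEq) (hline i _ hxi); unfold clip, Rmax, Rmin; repeat destruct Rle_dec; lra. }
  assert (h2 : outer (setD (in_box b) E) <= lsum (fun i => box_area (Q i)) (seq 0 G)).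
  { replace (lsum (fun i => box_area (Q i)) (seq 0 G)) with (lsum box_area (map Q (seq 0 G)))
      by (generalize (seq 0 G); intros l; induction l as [|a l IH]; simpl; [reflexivity|rewrite IH; reflexivity]).
    apply outer_le_list.
    - intros b' hb'; apply in_map_iff in hb'; destruct hb' as [i [<- _]].
      unfold box_ok; simpl; generalize (hclip (mid i - slope * w)); rewrite hxl; lra.
    - intros q [hq hEq]; destruct (hin q hq) as [i [hi hxi]]; exists (Q i).
      split; [apply in_map, in_seq; lia|]; destruct hq as [_ hq].
      unfold in_box; simpl; split; [exact hxi|split; [|lra]].
      generalize (hnE q hEq) (hline i _ hxi); unfold clip, Rmax, Rmin; repeat destruct Rle_dec; lra. }
  assert (h3 : lsum (fun i => box_area (P i) + box_area (Q i)) (seq 0 G) <=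
    lsum (fun _ : nat => w * (by2 b - by1 b + 2 * slope * w)) (seq 0 G)).
  { apply lsum_le; intros i _; unfold box_area; simpl; rewrite hxl.
    replace (xl i + w - xl i) with w by ring; rewrite <- Rmult_plus_distr_l.
    apply Rmult_le_compat_l; [lra|].
    assert (0 <= slope * w) by (apply Rmult_le_pos; lra).
    unfold clip, Rmax, Rmin; repeat destruct Rle_dec; lra. }
  rewrite lsum_plus, lsum_const, length_seq in h3.
  assert (h4 : 2 * slope * W * w <= e).
  { unfold w; apply Rlt_le in hG.
    assert (0 <= slope * W * W) by (repeat apply Rmult_le_pos; lra).
    assert (slope * W * W * / INR G <= e / 2).
    { apply Rle_trans with ((slope * W * W + 1) * / INR G).
      - apply Rmult_le_compat_r; [left; apply Rinv_0_lt_compat; lra|lra].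
      - apply (Rmult_le_compat_l (slope * W * W + 1)) in hG; [|lra].
        replace ((slope * W * W + 1) * (e / 2 / (slope * W * W + 1))) with (e / 2) in hG by (field; lra).
        exact hG. }
    unfold Rdiv; lra. }
  assert (h5 : INR G * (w * (by2 b - by1 b + 2 * slope * w)) = box_area b + 2 * slope * W * w).
  { unfold box_area; fold W; rewrite <- hwG; ring. }
  lra.
- assert (hb : box_ok b) by (split; assumption).
  assert (h0 : box_area b = 0) by (unfold box_area; fold W; rewrite <- hW0; ring).
  assert (h := outer_box b hb).
  assert (outer (setI (in_box b) E) <= outer (in_box b)).
  { apply outer_mono; [intros q []; assumption|apply bounded_box, hb]. }
  assert (outer (setD (in_box b) E) <= outer (in_box b)).
  { apply outer_mono; [intros q []; assumption|apply bounded_box, hb]. }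
  lra.
Qed.

Lemma splits_vertical (g : R) (E : pset) :
  (forall q, E q -> fst q <= g) -> (forall q, ~ E q -> g <= fst q) -> splits E.
Proof.
intros hE hnE; apply splits_of_boxes; intros b e [hx hy] he.
set (x := Rmax (bx1 b) (Rmin (bx2 b) g)).
assert (hxb : bx1 b <= x <= bx2 b) by (unfold x, Rmax, Rmin; repeat destruct Rle_dec; lra).
assert (h1 : outer (setI (in_box b) E) <= box_area (Box (bx1 b) x (by1 b) (by2 b))).
{ eapply Rle_trans; [apply outer_mono with (B := in_box (Box (bx1 b) x (by1 b) (by2 b)))|apply outer_box].
  - intros q [[hq hq'] hg]; split; [|exact hq']; simpl; apply hE in hg.
    unfold x, Rmax, Rmin; repeat destruct Rle_dec; lra.
  - apply bounded_box; split; simpl; lra.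
  - split; simpl; lra. }
assert (h2 : outer (setD (in_box b) E) <= box_area (Box x (bx2 b) (by1 b) (by2 b))).
{ eapply Rle_trans; [apply outer_mono with (B := in_box (Box x (bx2 b) (by1 b) (by2 b)))|apply outer_box].
  - intros q [[hq hq'] hg]; split; [|exact hq']; simpl; apply hnE in hg.
    unfold x, Rmax, Rmin; repeat destruct Rle_dec; lra.
  - apply bounded_box; split; simpl; lra.
  - split; simpl; lra. }
revert h1 h2; unfold box_area; simpl; lra.
Qed.

(** The boundary line may belong to [E] in any part, so that one statement serves open and closed
    half-planes. When [be] is negative, or zero with [al] negative, the complement is used; a
    vertical line is not a graph and is handled separately. *)
Lemma splits_halfplane (al be g : R) (E : pset) : al <> 0 \/ be <> 0 ->
  (forall q, E q -> al * fst q + be * snd q <= g) ->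
  (forall q, ~ E q -> g <= al * fst q + be * snd q) -> splits E.
Proof.
assert (pos : forall al be g E, 0 < be \/ be = 0 /\ 0 < al ->
  (forall q : pt, E q -> al * fst q + be * snd q <= g) ->
  (forall q, ~ E q -> g <= al * fst q + be * snd q) -> splits E).
{ clear; intros al be g E [h|[-> h]] hE hnE.
  - apply (splits_graph (- al / be) (g / be)); intros q hq.
    + apply hE in hq; apply (Rmult_le_reg_l be); [exact h|].
      replace (be * (- al / be * fst q + g / be)) with (- al * fst q + g) by (field; lra); lra.
    + apply hnE in hq; apply (Rmult_le_reg_l be); [exact h|].
      replace (be * (- al / be * fst q + g / be)) with (- al * fst q + g) by (field; lra); lra.
  - apply (splits_vertical (g / al)); intros q hq.
    + apply hE in hq; apply (Rmult_le_reg_l al); [exact h|].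
      replace (al * (g / al)) with g by (field; lra); lra.
    + apply hnE in hq; apply (Rmult_le_reg_l al); [exact h|].
      replace (al * (g / al)) with g by (field; lra); lra. }
intros h hE hnE.
destruct (classic (0 < be \/ be = 0 /\ 0 < al)) as [h'|h']; [apply (pos al be g); assumption|].
apply (splits_ext (setC (setC E))).
{ intros q; unfold setC; split; [apply NNPP|tauto]. }
apply splits_compl, (pos (- al) (- be) (- g)).
- destruct (Rtotal_order be 0) as [hb|[hb|hb]]; [left; lra| |tauto].
  right; split; [lra|]; destruct (Rtotal_order al 0) as [ha|[ha|ha]]; [lra|tauto|tauto].
- intros q hq; apply hnE in hq; lra.
- intros q hq; apply NNPP in hq; apply hE in hq; lra.
Qed.

(** * Thin strips *)

Lemma unit_dir_bound c s : unit_dir c s -> -1 <= c <= 1 /\ -1 <= s <= 1.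
Proof. unfold unit_dir; intros h; split; nra. Qed.

(** Axis-parallel squares of side [4 * d] are centred at points [d] apart along the strip. A point
    of the strip is within [d] of such a centre in both frame directions, hence within [2 * d] on
    each axis. At most [len / d + 1] squares of area [16 * d ^ 2] are used. *)
Lemma outer_strip p c s x0 y0 len d (A : pset) : unit_dir c s -> 0 < d -> 0 <= len ->
  (forall q, A q -> exists x y, x0 <= x <= x0 + d /\ y0 <= y <= y0 + len /\ q = frame_pt p c s x y) ->
  outer A <= 16 * (d * (len + d)).
Proof.
intros hu hd hlen hA; destruct (unit_dir_bound c s hu) as [hc hs].
destruct (archimed (len / d)) as [ha1 ha2].
assert (hz : (0 <= up (len / d))%Z).
{ apply le_IZR; assert (0 <= len / d) by (apply Rle_mult_inv_pos; lra); simpl; lra. }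
set (G := Z.to_nat (up (len / d))).
assert (hG : INR G = IZR (up (len / d))) by (unfold G; rewrite INR_IZR_INZ, Z2Nat.id; auto).
rewrite <- hG in ha1, ha2.
assert (e : len / d * d = len) by (field; lra).
assert (hG1 : len <= INR G * d) by (rewrite <- e; apply Rmult_le_compat_r; lra).
assert (hG2 : INR G * d <= len + d).
{ replace (len + d) with ((len / d + 1) * d) by (field; lra); apply Rmult_le_compat_r; lra. }
assert (hG0 : (0 < G)%nat).
{ apply INR_lt; assert (0 <= len / d) by (apply Rle_mult_inv_pos; lra); simpl; lra. }
pose (z := fun i => frame_pt p c s x0 (y0 + INR i * d)).
pose (B := fun i => Box (fst (z i) - 2 * d) (fst (z i) + 2 * d) (snd (z i) - 2 * d) (snd (z i) + 2 * d)).
apply Rle_trans with (lsum box_area (map B (seq 0 G))).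
- apply outer_le_list.
  + intros b hb; apply in_map_iff in hb; destruct hb as [i [<- _]]; split; simpl; lra.
  + intros q hq; destruct (hA q hq) as (x & y & hx & hy & ->).
    destruct (grid_index d y0 y G hd) as [i [hi hyi]]; [lra|exact hG0|].
    rewrite S_INR in hyi.
    exists (B i); split; [apply in_map, in_seq; lia|].
    assert (b1 : forall t, -1 <= t <= 1 -> - d <= (x - x0) * t <= d) by (intros t ht; split; nra).
    assert (b2 : forall t, -1 <= t <= 1 -> - d <= (y - (y0 + INR i * d)) * t <= d) by (intros t ht; split; nra).
    generalize (b1 c hc) (b1 s hs) (b2 c hc) (b2 s hs).
    unfold in_box; simpl; lra.
- assert (hmap : forall l, lsum box_area (map B l) = INR (length l) * (16 * (d * d))).
  { intros l; rewrite <- lsum_const; induction l as [|i l IH]; [reflexivity|].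
    simpl; rewrite IH; unfold box_area; simpl; ring. }
  rewrite hmap, length_seq.
  apply (Rmult_le_compat_r (16 * d)) in hG2; lra.
Qed.

(** A quarter turn of the frame exchanges its axes. *)
Lemma outer_strip_y p c s x0 y0 len d (A : pset) : unit_dir c s -> 0 < d -> 0 <= len ->
  (forall q, A q -> exists x y, x0 <= x <= x0 + len /\ y0 <= y <= y0 + d /\ q = frame_pt p c s x y) ->
  outer A <= 16 * (d * (len + d)).
Proof.
intros hu hd hlen hA.
apply (outer_strip p (- s) c y0 (- (x0 + len))); [unfold unit_dir in *; lra|assumption|assumption|].
intros q hq; destruct (hA q hq) as (x & y & hx & hy & ->).
exists y, (- x); split; [exact hy|split; [lra|]].
unfold frame_pt; f_equal; ring.
Qed.

(** * The area of a box *)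

Definition overlap (a b c d : R) : R := Rmax 0 (Rmin b d - Rmax a c).

Lemma overlap_split a b c d : a <= b -> c <= d ->
  overlap a b c d = overlap a b c ((c + d) / 2) + overlap a b ((c + d) / 2) d.
Proof. intros; unfold overlap, Rmax, Rmin; repeat destruct Rle_dec; lra. Qed.

Lemma overlap_bounds a b c d : a <= b -> 0 <= overlap a b c d <= b - a.
Proof. intros; unfold overlap, Rmax, Rmin; repeat destruct Rle_dec; lra. Qed.

Lemma overlap_inside a b c d : a <= c -> c <= d -> d <= b -> overlap a b c d = d - c.
Proof. intros; unfold overlap, Rmax, Rmin; repeat destruct Rle_dec; lra. Qed.

(** The area of the intersection of the two boxes; it is additive when [Q] is quartered, which
    drives the bisection. *)
Definition clip_area (B Q : box) : R :=
  overlap (bx1 B) (bx2 B) (bx1 Q) (bx2 Q) * overlap (by1 B) (by2 B) (by1 Q) (by2 Q).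

Definition quarter (Q : box) (j : corner) : box :=
  let mx := (bx1 Q + bx2 Q) / 2 in let my := (by1 Q + by2 Q) / 2 in
  Box (if fst j then mx else bx1 Q) (if fst j then bx2 Q else mx)
      (if snd j then my else by1 Q) (if snd j then by2 Q else my).

Lemma quarter_ok Q j : box_ok Q -> box_ok (quarter Q j).
Proof. unfold box_ok; destruct j as [[|] [|]]; simpl; lra. Qed.

Lemma clip_area_quarters B Q : box_ok B -> box_ok Q ->
  clip_area B Q = lsum (fun j => clip_area B (quarter Q j)) corners.
Proof.
intros [b1 b2] [q1 q2]; unfold clip_area; simpl.
rewrite (overlap_split (bx1 B)), (overlap_split (by1 B)) by assumption; ring.
Qed.

Lemma box_area_quarters Q : box_area Q = lsum (fun j => box_area (quarter Q j)) corners.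
Proof. unfold box_area; simpl; field. Qed.

Lemma clip_area_bounds B Q : box_ok B -> 0 <= clip_area B Q <= box_area B.
Proof.
intros [b1 b2]; unfold clip_area, box_area.
destruct (overlap_bounds (bx1 B) (bx2 B) (bx1 Q) (bx2 Q) b1) as [h1 h2].
destruct (overlap_bounds (by1 B) (by2 B) (by1 Q) (by2 Q) b2) as [h3 h4].
split; [apply Rmult_le_pos|apply Rmult_le_compat]; assumption.
Qed.

Definition widen (B : box) (d : R) : box := Box (bx1 B - d) (bx2 B + d) (by1 B - d) (by2 B + d).

Lemma widen_small B e : box_ok B -> 0 < e ->
  exists d, 0 < d /\ box_area (widen B d) <= box_area B + e.
Proof.
intros [h1 h2] he; set (w := bx2 B - bx1 B); set (h := by2 B - by1 B).
assert (hD : 0 < 2 * (w + h) + 4) by (unfold w, h; lra).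
exists (Rmin 1 (e / (2 * (w + h) + 4))); set (d := Rmin _ _).
assert (hd : 0 < d) by (apply Rmin_glb_lt; [lra|apply Rdiv_lt_0_compat; assumption]).
assert (hd1 : d <= 1) by apply Rmin_l.
assert (hd2 : d * (2 * (w + h) + 4) <= e).
{ apply Rle_trans with (e / (2 * (w + h) + 4) * (2 * (w + h) + 4)).
  - apply Rmult_le_compat_r; [lra|apply Rmin_r].
  - apply Req_le; field; lra. }
split; [exact hd|].
unfold box_area; simpl.
replace ((bx2 B + d - (bx1 B - d)) * (by2 B + d - (by1 B - d))) with
  ((bx2 B - bx1 B) * (by2 B - by1 B) + d * (2 * (w + h) + 4 * d)) by (unfold w, h; ring).
assert (d * (2 * (w + h) + 4 * d) <= d * (2 * (w + h) + 4)) by (apply Rmult_le_compat_l; lra).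
lra.
Qed.

(* Bisection: a box whose area exceeds all the partial sums of the clipped areas has a
   quarter with the same defect; the nested quarters shrink into one of the widened boxes. *)
Lemma cover_area (b : box) (B : nat -> box) (d : nat -> R) : box_ok b ->
  (forall k, box_ok (B k)) -> (forall k, 0 < d k) ->
  (forall q, in_box b q -> exists k, in_box (B k) q) ->
  exists N, box_area b <= lsum (fun k => clip_area (widen (B k) (d k)) b) (seq 0 N).
Proof.
intros hb hB hd hcov; apply NNPP; intros hno.
pose (bad := fun Q => box_ok Q /\
  forall N, lsum (fun k => clip_area (widen (B k) (d k)) Q) (seq 0 N) < box_area Q).
assert (hW : forall k, box_ok (widen (B k) (d k))).
{ intros k; destruct (hB k); generalize (hd k); unfold box_ok; simpl; lra. }
assert (hstep : forall Q, exists j, bad Q -> bad (quarter Q j)).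
{ intros Q; destruct (classic (exists j, bad (quarter Q j))) as [[j hj]|hn]; [exists j; auto|].
  exists (false, false); intros [hok hlt]; exfalso.
  assert (hN : forall j, exists N, box_area (quarter Q j) <=
    lsum (fun k => clip_area (widen (B k) (d k)) (quarter Q j)) (seq 0 N)).
  { intros j; apply NNPP; intros hj; apply hn; exists j; split; [apply quarter_ok, hok|].
    intros N; apply Rnot_le_lt; intros hle; apply hj; exists N; exact hle. }
  destruct (choice _ hN) as [f hf].
  pose (N := (f (false, false) + f (false, true) + f (true, false) + f (true, true))%nat).
  specialize (hlt N).
  rewrite box_area_quarters, (lsum_ext _ (fun k => lsum (fun j => clip_area (widen (B k) (d k)) (quarter Q j)) corners)) in hlt.
  - rewrite lsum_swap in hlt; apply Rlt_not_le in hlt; apply hlt, lsum_le; intros j _.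
    eapply Rle_trans; [apply hf|apply lsum_seq_mono].
    + intros k; apply clip_area_bounds, hW.
    + unfold N; destruct j as [[|] [|]]; lia.
  - intros k _; apply clip_area_quarters; [apply hW|exact hok]. }
destruct (choice _ hstep) as [f hf].
pose (Q := fun m => Nat.iter m (fun Q => quarter Q (f Q)) b).
assert (hQ : forall m, bad (Q m)).
{ induction m as [|m IH]; [|apply hf, IH].
  split; [exact hb|intros N; apply Rnot_le_lt; intros hle; apply hno; exists N; exact hle]. }
assert (hQS : forall m, bx1 (Q m) <= bx1 (Q (S m)) /\ bx2 (Q (S m)) <= bx2 (Q m) /\
  by1 (Q m) <= by1 (Q (S m)) /\ by2 (Q (S m)) <= by2 (Q m) /\
  bx2 (Q (S m)) - bx1 (Q (S m)) = (bx2 (Q m) - bx1 (Q m)) / 2 /\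
  by2 (Q (S m)) - by1 (Q (S m)) = (by2 (Q m) - by1 (Q m)) / 2).
{ intros m; change (Q (S m)) with (quarter (Q m) (f (Q m))).
  destruct (hQ m) as [[h1 h2] _]; destruct (f (Q m)) as [[|] [|]]; simpl; lra. }
assert (hw : forall m, bx2 (Q m) - bx1 (Q m) = (bx2 b - bx1 b) * (1 / 2) ^ m /\
  by2 (Q m) - by1 (Q m) = (by2 b - by1 b) * (1 / 2) ^ m).
{ induction m as [|m [IH1 IH2]]; [simpl; lra|].
  destruct (hQS m) as (_ & _ & _ & _ & -> & ->); rewrite IH1, IH2; simpl; lra. }
assert (hmono : forall m k, bx1 (Q m) <= bx1 (Q (k + m)%nat) /\ bx2 (Q (k + m)%nat) <= bx2 (Q m) /\
  by1 (Q m) <= by1 (Q (k + m)%nat) /\ by2 (Q (k + m)%nat) <= by2 (Q m)).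
{ intros m; induction k as [|k IH]; [simpl; lra|].
  generalize (hQS (k + m)%nat); simpl Nat.add; lra. }
assert (hcross : forall m k, bx1 (Q k) <= bx2 (Q m) /\ by1 (Q k) <= by2 (Q m)).
{ intros m k; generalize (hmono m k) (hmono k m); rewrite (Nat.add_comm m k).
  destruct (hQ (k + m)%nat) as [[h1 h2] _]; lra. }
destruct (completeness (fun x => exists m, x = bx1 (Q m))) as [x [hx1 hx2]].
{ exists (bx2 (Q 0%nat)); intros x [m ->]; apply hcross. }
{ exists (bx1 (Q 0%nat)), 0%nat; reflexivity. }
destruct (completeness (fun x => exists m, x = by1 (Q m))) as [y [hy1 hy2]].
{ exists (by2 (Q 0%nat)); intros y [m ->]; apply hcross. }
{ exists (by1 (Q 0%nat)), 0%nat; reflexivity. }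
assert (hin : forall m, in_box (Q m) (x, y)).
{ intros m; unfold in_box; simpl; repeat split.
  - apply hx1; exists m; reflexivity.
  - apply hx2; intros t [k ->]; apply hcross.
  - apply hy1; exists m; reflexivity.
  - apply hy2; intros t [k ->]; apply hcross. }
destruct (hcov (x, y) (hin 0%nat)) as [k hk].
destruct (pow_lt_1_zero (1 / 2)) with (y := d k / (bx2 b - bx1 b + (by2 b - by1 b) + 1)) as [m hm].
{ split_Rabs; lra. }
{ apply Rdiv_lt_0_compat; [apply hd|destruct hb; lra]. }
specialize (hm m (le_n m)).
assert (hp : 0 < (1 / 2) ^ m) by (apply pow_lt; lra).
rewrite Rabs_pos_eq in hm by lra.
assert (hsum : (bx2 b - bx1 b + (by2 b - by1 b) + 1) * (1 / 2) ^ m < d k).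
{ apply (Rmult_lt_compat_l (bx2 b - bx1 b + (by2 b - by1 b) + 1)) in hm; [|destruct hb; lra].
  replace ((bx2 b - bx1 b + (by2 b - by1 b) + 1) * (d k / (bx2 b - bx1 b + (by2 b - by1 b) + 1)))
    with (d k) in hm by (field; destruct hb; lra); exact hm. }
assert (hwx : 0 <= (bx2 b - bx1 b) * (1 / 2) ^ m) by (destruct hb; apply Rmult_le_pos; lra).
assert (hwy : 0 <= (by2 b - by1 b) * (1 / 2) ^ m) by (destruct hb; apply Rmult_le_pos; lra).
destruct (hQ m) as [[h1 h2] hlt]; destruct (hw m) as [w1 w2].
specialize (hlt (S k)); rewrite lsum_seq_S in hlt.
assert (0 <= lsum (fun k => clip_area (widen (B k) (d k)) (Q m)) (seq 0 k)).
{ apply lsum_nonneg; intros; apply clip_area_bounds, hW. }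
destruct hk as [hk1 hk2], (hin m) as [hi1 hi2]; simpl in hk1, hk2, hi1, hi2.
assert (clip_area (widen (B k) (d k)) (Q m) = box_area (Q m)); [|lra].
unfold clip_area, box_area; simpl.
rewrite !overlap_inside; [reflexivity|lra|lra|lra|lra|lra|lra].
Qed.

(** This gives the rectangle positive measure, hence the constant density a positive value, so that
    the infimum in [PropEF] ranges over a nonempty set. *)
Lemma outer_box_ge b : box_ok b -> box_area b <= outer (in_box b).
Proof.
intros hb; apply le_epsilon; intros e he.
destruct (outer_approx (in_box b) (e / 2)) as (B & h1 & h2 & h3); [apply bounded_box, hb|lra|].
assert (hd : forall k, exists d, 0 < d /\ box_area (widen (B k) d) <= box_area (B k) + e / 2 / 2 ^ S k).
{ intros k; apply widen_small; [apply h1|apply Rdiv_lt_0_compat; [lra|apply pow_lt; lra]]. }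
destruct (choice _ hd) as [d hd'].
destruct (cover_area b B d) as [N hN]; [exact hb|exact h1|intros k; apply hd'|exact h2|].
eapply Rle_trans; [exact hN|].
apply Rle_trans with (lsum (fun k => box_area (B k) + e / 2 / 2 ^ S k) (seq 0 N)).
- apply lsum_le; intros k _; eapply Rle_trans; [apply clip_area_bounds|apply hd'].
  destruct (h1 k), (hd' k); unfold box_ok; simpl; lra.
- rewrite lsum_plus; generalize (h3 N) (geometric_partial (e / 2) N); lra.
Qed.

(** * The integral *)

Definition simple_below (v : pt -> R) (X : pset) (N : nat) (A : nat -> pset) (c : nat -> R) : Prop :=
  (forall k, (k < N)%nat -> lmeas (A k) /\ 0 <= c k /\ forall q, A k q -> X q /\ c k <= v q) /\
  (forall j k, (j < N)%nat -> (k < N)%nat -> j <> k -> forall q, ~ (A j q /\ A k q)).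

Definition simple_integral (N : nat) (A : nat -> pset) (c : nat -> R) : R :=
  sumN (fun k => c k * outer (A k)) N.

Section Integral.
Variables (C : pset) (v : pt -> R) (M : R).
Hypothesis C_bounded : bounded_set C.
Hypothesis v_nonneg : forall q, C q -> 0 <= v q.
Hypothesis v_bound : forall q, C q -> v q <= M.
Hypothesis M_nonneg : 0 <= M.

Lemma simple_integral_le X N A c : subset X C -> simple_below v X N A c ->
  simple_integral N A c <= M * outer X.
Proof.
intros hX [hA hd].
assert (bX : bounded_set X) by (apply (bounded_subset _ C); assumption).
apply Rle_trans with (M * lsum (fun k => outer (A k)) (seq 0 N)).
- rewrite <- lsum_scal; apply lsum_le; intros k hk; apply in_seq in hk.
  destruct (hA k ltac:(lia)) as (_ & h1 & h2).
  destruct (classic (exists q, A k q)) as [[q hq]|hn].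
  + apply Rmult_le_compat_r; [apply outer_nonneg|].
    destruct (h2 q hq) as [hXq hc]; generalize (v_bound q (hX q hXq)); lra.
  + assert (outer (A k) = 0) as ->; [|lra].
    apply Rle_antisym; [|apply outer_nonneg].
    apply (outer_le_list _ []); [intros b []|intros q hq; exfalso; apply hn; exists q; exact hq].
- apply Rmult_le_compat_l; [exact M_nonneg|].
  apply outer_disjoint_sum; [exact bX| |exact hd].
  intros k hk; destruct (hA k hk) as (h1 & _ & h2); split; [apply lmeas_splits, h1|intros q hq; apply h2, hq].
Qed.

Lemma Vm_ge X N A c : subset X C -> simple_below v X N A c -> simple_integral N A c <= Vm v X.
Proof.
intros hX h; apply Rsup_ge.
- exists (M * outer X); intros t (N' & A' & c' & h1 & h2 & ->).
  apply simple_integral_le; [exact hX|split; assumption].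
- exists N, A, c; destruct h as [h1 h2]; auto.
Qed.

Lemma Vm_le X K : (forall N A c, simple_below v X N A c -> simple_integral N A c <= K) -> Vm v X <= K.
Proof.
intros h; apply Rsup_le.
- exists 0, 0%nat, (fun _ _ => False), (fun _ => 0).
  split; [intros k hk; lia|split; [intros j k hj; lia|reflexivity]].
- intros t (N & A & c & h1 & h2 & ->); apply h; split; assumption.
Qed.

Lemma Vm_nonneg X : subset X C -> 0 <= Vm v X.
Proof.
intros hX; apply (Vm_ge X 0 (fun _ _ => False) (fun _ => 0)); [exact hX|].
split; intros; lia.
Qed.

Lemma Vm_le_outer X : subset X C -> Vm v X <= M * outer X.
Proof. intros hX; apply Vm_le; intros; apply simple_integral_le; assumption. Qed.

Lemma Vm_mono X Y : subset X Y -> subset Y C -> Vm v X <= Vm v Y.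
Proof.
intros hXY hY; apply Vm_le; intros N A c [hA hd]; apply Vm_ge; [exact hY|split; [|exact hd]].
intros k hk; destruct (hA k hk) as (h1 & h2 & h3); split; [exact h1|split; [exact h2|]].
intros q hq; destruct (h3 q hq); split; auto.
Qed.

(** Every simple function below [v] on [X] is cut along [Y] into two simple functions, whose
    integrals add up because [Y] splits each of its level sets. *)
Lemma Vm_split X Y : subset X C -> splits Y -> Vm v X <= Vm v (setI X Y) + Vm v (setD X Y).
Proof.
intros hX hY; apply Vm_le; intros N A c [hA hd].
assert (bX : bounded_set X) by (apply (bounded_subset _ C); assumption).
assert (hI := Vm_ge (setI X Y) N (fun k => setI (A k) Y) c).
assert (hD := Vm_ge (setD X Y) N (fun k => setD (A k) Y) c).
assert (hs : simple_integral N A c =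
  simple_integral N (fun k => setI (A k) Y) c + simple_integral N (fun k => setD (A k) Y) c).
{ unfold simple_integral, sumN.
  change (lsum (fun k => c k * outer (A k)) (seq 0 N) =
    lsum (fun k => c k * outer (setI (A k) Y)) (seq 0 N) + lsum (fun k => c k * outer (setD (A k) Y)) (seq 0 N)).
  rewrite <- lsum_plus; apply lsum_ext; intros k hk; apply in_seq in hk.
  rewrite <- Rmult_plus_distr_l, <- splits_eq; [reflexivity|exact hY|].
  apply (bounded_subset _ X); [|exact bX]; intros q hq; apply (hA k); [lia|exact hq]. }
rewrite hs; apply Rplus_le_compat; [apply hI|apply hD].
- intros q [hq _]; apply hX, hq.
- split.
  + intros k hk; destruct (hA k hk) as (h1 & h2 & h3); split; [|split; [exact h2|]].
    * apply splits_lmeas, splits_inter; [apply lmeas_splits, h1|exact hY].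
    * intros q [hq hq']; destruct (h3 q hq); repeat split; assumption.
  + intros j k hj hk hjk q [[h1 _] [h2 _]]; apply (hd j k hj hk hjk q); split; assumption.
- intros q [hq _]; apply hX, hq.
- split.
  + intros k hk; destruct (hA k hk) as (h1 & h2 & h3); split; [|split; [exact h2|]].
    * apply splits_lmeas, (splits_inter (A k) (setC Y)); [apply lmeas_splits, h1|apply splits_compl, hY].
    * intros q [hq hq']; destruct (h3 q hq); repeat split; assumption.
  + intros j k hj hk hjk q [[h1 _] [h2 _]]; apply (hd j k hj hk hjk q); split; assumption.
Qed.

(** Turns a difference set of small measure into a small difference of values; the continuity of
    cell values and the neglect of boundaries rest on it. *)
Lemma Vm_sub X Y : subset X C -> subset Y C -> splits Y -> Vm v X <= Vm v Y + M * outer (setD X Y).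
Proof.
intros hX hY hs; eapply Rle_trans; [apply Vm_split; eassumption|].
apply Rplus_le_compat.
- apply Vm_mono; [intros q []; assumption|exact hY].
- apply Vm_le_outer; intros q [hq _]; apply hX, hq.
Qed.

End Integral.

(** * Cells of a rectangle *)

Definition frame_x (p : pt) (c s : R) (q : pt) : R := (fst q - fst p) * c + (snd q - snd p) * s.
Definition frame_y (p : pt) (c s : R) (q : pt) : R := (snd q - snd p) * c - (fst q - fst p) * s.

Lemma frame_pt_xy p c s q : unit_dir c s -> q = frame_pt p c s (frame_x p c s q) (frame_y p c s q).
Proof.
intros hu; destruct p as [p1 p2], q as [q1 q2]; unfold frame_pt, frame_x, frame_y; simpl.
unfold unit_dir in hu; f_equal.
- replace (p1 + _ * c - _ * s) with (p1 + (q1 - p1) * (c ^ 2 + s ^ 2)) by ring; rewrite hu; ring.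
- replace (p2 + _ * s + _ * c) with (p2 + (q2 - p2) * (c ^ 2 + s ^ 2)) by ring; rewrite hu; ring.
Qed.

Lemma frame_x_pt p c s x y : unit_dir c s -> frame_x p c s (frame_pt p c s x y) = x.
Proof.
unfold unit_dir, frame_x, frame_pt; intros hu; simpl.
replace (_ + _) with (x * (c ^ 2 + s ^ 2)) by ring; rewrite hu; ring.
Qed.

Lemma frame_y_pt p c s x y : unit_dir c s -> frame_y p c s (frame_pt p c s x y) = y.
Proof.
unfold unit_dir, frame_y, frame_pt; intros hu; simpl.
replace (_ - _) with (y * (c ^ 2 + s ^ 2)) by ring; rewrite hu; ring.
Qed.

Lemma open_rect_shift p c s x0 y0 a b q : unit_dir c s ->
  open_rect (frame_pt p c s x0 y0) c s a b q <->
  x0 < frame_x p c s q < x0 + a /\ y0 < frame_y p c s q < y0 + b.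
Proof.
intros hu.
assert (hsh : forall x y, frame_pt (frame_pt p c s x0 y0) c s x y = frame_pt p c s (x0 + x) (y0 + y)).
{ intros; unfold frame_pt; simpl; f_equal; ring. }
split.
- intros (x & y & hx & hy & ->); rewrite hsh, frame_x_pt, frame_y_pt by exact hu; lra.
- intros [hx hy]; exists (frame_x p c s q - x0), (frame_y p c s q - y0).
  split; [lra|split; [lra|]]; rewrite hsh.
  rewrite (frame_pt_xy p c s q hu) at 1; f_equal; ring.
Qed.

Lemma closed_rect_shift p c s x0 y0 a b q : unit_dir c s ->
  closed_rect (frame_pt p c s x0 y0) c s a b q <->
  x0 <= frame_x p c s q <= x0 + a /\ y0 <= frame_y p c s q <= y0 + b.
Proof.
intros hu.
assert (hsh : forall x y, frame_pt (frame_pt p c s x0 y0) c s x y = frame_pt p c s (x0 + x) (y0 + y)).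
{ intros; unfold frame_pt; simpl; f_equal; ring. }
split.
- intros (x & y & hx & hy & ->); rewrite hsh, frame_x_pt, frame_y_pt by exact hu; lra.
- intros [hx hy]; exists (frame_x p c s q - x0), (frame_y p c s q - y0).
  split; [lra|split; [lra|]]; rewrite hsh.
  rewrite (frame_pt_xy p c s q hu) at 1; f_equal; ring.
Qed.

Lemma frame_pt_0 p c s : frame_pt p c s 0 0 = p.
Proof. destruct p; unfold frame_pt; simpl; f_equal; ring. Qed.

Lemma frame_near p c s q q' e : unit_dir c s -> 0 < e ->
  (fst q' - fst q) ^ 2 + (snd q' - snd q) ^ 2 < e ^ 2 ->
  - e < frame_x p c s q' - frame_x p c s q < e /\ - e < frame_y p c s q' - frame_y p c s q < e.
Proof.
intros hu he hd; set (X := fst q' - fst q) in *; set (Y := snd q' - snd q) in *.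
assert (ex : frame_x p c s q' - frame_x p c s q = X * c + Y * s) by (unfold frame_x, X, Y; ring).
assert (ey : frame_y p c s q' - frame_y p c s q = Y * c - X * s) by (unfold frame_y, X, Y; ring).
assert (h : (X * c + Y * s) ^ 2 + (Y * c - X * s) ^ 2 = X ^ 2 + Y ^ 2).
{ replace (X ^ 2 + Y ^ 2) with ((X ^ 2 + Y ^ 2) * (c ^ 2 + s ^ 2)) by (rewrite hu; ring); ring. }
rewrite ex, ey; generalize dependent (X * c + Y * s); generalize dependent (Y * c - X * s).
intros u _ w _ h; repeat split; nra.
Qed.

Lemma open_rect_open p c s a b : unit_dir c s -> Defs.open_set (open_rect p c s a b).
Proof.
intros hu q hq; rewrite <- (frame_pt_0 p c s) in hq |- *.
apply open_rect_shift in hq; [|exact hu]; destruct hq as [hx hy].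
set (x := frame_x p c s q) in *; set (y := frame_y p c s q) in *.
pose (e := Rmin (Rmin x (a - x)) (Rmin y (b - y))).
assert (he : 0 < e) by (unfold e; repeat apply Rmin_glb_lt; lra).
assert (hle : e <= x /\ e <= a - x /\ e <= y /\ e <= b - y).
{ unfold e, Rmin; repeat destruct Rle_dec; lra. }
exists e; split; [exact he|]; intros q' hq'.
apply open_rect_shift; [exact hu|].
destruct (frame_near p c s q q' e hu he hq') as [h1 h2]; fold x y in h1, h2; lra.
Qed.

(* Evaluation near the four corners of the open rectangle. *)
Lemma linear_extent (A B k u w a : R) : 0 < A -> 0 < B -> 0 < a ->
  (forall x y, 0 < x < A -> 0 < y < B -> 0 <= k + x * u + y * w <= a) ->
  A * Rabs u + B * Rabs w <= a.
Proof.
intros hA hB ha h; apply Rnot_lt_le; intros hlt.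
set (S := A * Rabs u + B * Rabs w) in *.
(* Corners moved inwards by the fraction [e] of each side still span [S - 2 * (e * S)], the midpoint
   between [a] and [S]. *)
set (e := (S - a) / (4 * S)).
assert (heS : e * S = (S - a) / 4) by (unfold e; field; lra).
assert (he : 0 < e) by (apply Rdiv_lt_0_compat; lra).
assert (he2 : e < 1 / 2).
{ apply (Rmult_lt_reg_r S); [lra|]; lra. }
assert (hin : forall L, 0 < L -> 0 < e * L < L /\ 0 < L - e * L < L).
{ intros L hL; assert (0 < e * L) by (apply Rmult_lt_0_compat; lra).
  assert (e * L < 1 / 2 * L) by (apply Rmult_lt_compat_r; lra); lra. }
destruct (hin A hA) as [a1 a2], (hin B hB) as [b1 b2].
generalize (h _ _ a1 b1) (h _ _ a1 b2) (h _ _ a2 b1) (h _ _ a2 b2).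
assert (hS : S - 2 * (e * S) > a) by lra.
replace (e * S) with (e * A * Rabs u + e * B * Rabs w) in hS by (unfold S; ring).
unfold S in hS; clear - hS; revert hS.
unfold Rabs; destruct (Rcase_abs u), (Rcase_abs w); lra.
Qed.

(** When [(c', s')] is also a unit vector, the absolute values are the cosine and the sine of the
    angle between the frames, and the left sides are the widths of the inner rectangle along the
    axes of the outer one. *)
Lemma rect_extent p c s a b p' c' s' A B : unit_dir c s -> 0 < a -> 0 < b -> 0 < A -> 0 < B ->
  subset (open_rect p' c' s' A B) (closed_rect p c s a b) ->
  A * Rabs (c * c' + s * s') + B * Rabs (c' * s - c * s') <= a /\
  A * Rabs (c' * s - c * s') + B * Rabs (c * c' + s * s') <= b.
Proof.
intros hu ha hb hA hB hsub.
assert (h : forall x y, 0 < x < A -> 0 < y < B ->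
  0 <= frame_x p c s (frame_pt p' c' s' x y) <= a /\ 0 <= frame_y p c s (frame_pt p' c' s' x y) <= b).
{ intros x y hx hy.
  assert (hin : closed_rect p c s a b (frame_pt p' c' s' x y)).
  { apply hsub; exists x, y; repeat split; lra. }
  rewrite <- (frame_pt_0 p c s) in hin; apply closed_rect_shift in hin; [lra|exact hu]. }
split.
- apply (linear_extent A B (frame_x p c s p')); [assumption|assumption|assumption|].
  intros x y hx hy; destruct (h x y hx hy) as [h1 _].
  unfold frame_x, frame_pt in *; simpl in h1; lra.
- rewrite <- (Rabs_Ropp (c' * s - c * s')).
  apply (linear_extent A B (frame_y p c s p')); [assumption|assumption|assumption|].
  intros x y hx hy; destruct (h x y hx hy) as [_ h1].
  unfold frame_y, frame_pt in *; simpl in h1; lra.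
Qed.

(** The two squares may be tilted against the rectangle. With [K] and [D] the absolute cosine and
    sine of the tilt, the inner square needs [Lm * (K + D)] of either side. The outer one gives
    [a * K + b * D <= Lp] and [a * D + b * K <= Lp], so $K^2 + D^2 = 1$ yields [a <= Lp * (K + D)],
    and likewise for [b]. The factor [K + D] thus occurs on both sides. *)
Lemma fat_aspect Rf c s a b X : 0 < Rf -> unit_dir c s -> rect_with c s a b X -> fat Rf X ->
  a <= Rf * b /\ b <= Rf * a.
Proof.
intros hR hu (ha & hb & p & h1 & h2) (c' & s' & Bm & Bp & Lm & Lp & hu' & Hm & Hp & hBm & hBp & hL).
destruct Hm as (hm & _ & pm & hm1 & _), Hp as (hp & _ & pp & _ & hp2).
destruct (rect_extent p c s a b pm c' s' Lm Lm) as [e1 e2]; try assumption.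
{ intros q hq; apply h2, hBm, hm1, hq. }
destruct (rect_extent pp c' s' Lp Lp p c s a b) as [e3 e4]; try assumption.
{ intros q hq; apply hp2, hBp, h1, hq. }
assert (hk : c' * c + s' * s = c * c' + s * s') by ring.
assert (hk' : Rabs (c * s' - c' * s) = Rabs (c' * s - c * s')) by apply Rabs_minus_sym.
rewrite hk, hk' in e3, e4; clear hk hk'.
assert (hone : Rabs (c * c' + s * s') ^ 2 + Rabs (c' * s - c * s') ^ 2 = 1).
{ rewrite !pow2_abs; unfold unit_dir in *.
  replace (_ + _) with ((c ^ 2 + s ^ 2) * (c' ^ 2 + s' ^ 2)) by ring; rewrite hu, hu'; ring. }
generalize (Rabs_pos (c * c' + s * s')) (Rabs_pos (c' * s - c * s')).
generalize dependent (Rabs (c * c' + s * s')); generalize dependent (Rabs (c' * s - c * s')).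
intros D K e1 e2 e3 e4 hone hK hD.
assert (hLR : Lp <= Rf * Lm).
{ apply (Rmult_le_compat_r Lm) in hL; [|lra].
  replace (Lp / Lm * Lm) with Lp in hL by (field; lra); exact hL. }
assert (hab : a <= Lp * (K + D) /\ b <= Lp * (K + D)).
{ assert (0 <= K * D) by (apply Rmult_le_pos; assumption).
  assert ((a * K + b * D) * K <= Lp * K) by (apply Rmult_le_compat_r; assumption).
  assert ((a * K + b * D) * D <= Lp * D) by (apply Rmult_le_compat_r; assumption).
  assert ((a * D + b * K) * K <= Lp * K) by (apply Rmult_le_compat_r; assumption).
  assert ((a * D + b * K) * D <= Lp * D) by (apply Rmult_le_compat_r; assumption).
  assert (0 <= a * (K * D)) by (apply Rmult_le_pos; lra).
  assert (0 <= b * (K * D)) by (apply Rmult_le_pos; lra).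
  assert (ea : a * K ^ 2 + a * D ^ 2 = a) by (rewrite <- Rmult_plus_distr_l, hone; ring).
  assert (eb : b * K ^ 2 + b * D ^ 2 = b) by (rewrite <- Rmult_plus_distr_l, hone; ring).
  lra. }
assert (Lp * (K + D) <= Rf * Lm * (K + D)) by (apply Rmult_le_compat_r; lra).
assert (Rf * (Lm * K + Lm * D) <= Rf * a) by (apply Rmult_le_compat_l; lra).
assert (Rf * (Lm * D + Lm * K) <= Rf * b) by (apply Rmult_le_compat_l; lra).
lra.
Qed.

(** * Open cells in normalised coordinates of the rectangle *)

Section Cells.
Variables (p : pt) (c s a b : R) (C : pset).
Hypothesis cs_unit : unit_dir c s.
Hypothesis a_pos : 0 < a.
Hypothesis b_pos : 0 < b.
Hypothesis C_above : subset (open_rect p c s a b) C.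
Hypothesis C_below : subset C (closed_rect p c s a b).

Definition coordinate (horizontal : bool) (q : pt) : R :=
  if horizontal then frame_x p c s q / a else frame_y p c s q / b.

(** Openness makes the pieces of squares with a common edge disjoint. A cell with positive side has
    the proportions [a : b] of the whole rectangle, hence is just as fat. *)
Definition cell (Q : square) : pset := fun q =>
  sx Q < coordinate true q < sx Q + side Q /\ sy Q < coordinate false q < sy Q + side Q.

Lemma div_lt_iff x t w : 0 < w -> (t < x / w <-> t * w < x) /\ (x / w < t <-> x < t * w).
Proof.
intros hw; assert (e : x / w * w = x) by (field; lra).
split; split; intros h.
- rewrite <- e; apply Rmult_lt_compat_r; assumption.
- rewrite <- e in h; apply Rmult_lt_reg_r in h; assumption.
- rewrite <- e; apply Rmult_lt_compat_r; assumption.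
- rewrite <- e in h; apply Rmult_lt_reg_r in h; assumption.
Qed.

Lemma div_le_iff x t w : 0 < w -> (t <= x / w <-> t * w <= x) /\ (x / w <= t <-> x <= t * w).
Proof.
intros hw; destruct (div_lt_iff x t w hw) as [[h1 h2] [h3 h4]].
split; split; intros h; apply Rnot_lt_le; intros hlt; apply Rlt_not_le in h; auto.
Qed.

Lemma cell_open_rect Q q : cell Q q <->
  open_rect (frame_pt p c s (sx Q * a) (sy Q * b)) c s (side Q * a) (side Q * b) q.
Proof.
rewrite open_rect_shift by exact cs_unit; unfold cell, coordinate.
rewrite <- !Rmult_plus_distr_r.
destruct (div_lt_iff (frame_x p c s q) (sx Q) a a_pos) as [e1 _].
destruct (div_lt_iff (frame_x p c s q) (sx Q + side Q) a a_pos) as [_ e2].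
destruct (div_lt_iff (frame_y p c s q) (sy Q) b b_pos) as [e3 _].
destruct (div_lt_iff (frame_y p c s q) (sy Q + side Q) b b_pos) as [_ e4].
tauto.
Qed.

Lemma coordinate_bounds q h : C q -> 0 <= coordinate h q <= 1.
Proof.
intros hq; apply C_below in hq; rewrite <- (frame_pt_0 p c s) in hq.
apply closed_rect_shift in hq; [|exact cs_unit]; unfold coordinate; destruct h.
- destruct (div_le_iff (frame_x p c s q) 0 a a_pos) as [[_ e1] _].
  destruct (div_le_iff (frame_x p c s q) 1 a a_pos) as [_ [_ e2]].
  split; [apply e1|apply e2]; lra.
- destruct (div_le_iff (frame_y p c s q) 0 b b_pos) as [[_ e1] _].
  destruct (div_le_iff (frame_y p c s q) 1 b b_pos) as [_ [_ e2]].
  split; [apply e1|apply e2]; lra.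
Qed.

Lemma cell_subset Q : valid Q -> subset (cell Q) C.
Proof.
intros (h1 & h2 & h3 & h4 & h5) q hq; apply C_above.
rewrite <- (frame_pt_0 p c s); replace a with (1 * a) by ring; replace b with (1 * b) by ring.
assert (h := proj1 (cell_open_rect unit_square q)); simpl in h; rewrite !Rmult_0_l in h; apply h.
destruct hq; unfold cell; cbn [sx sy side unit_square]; lra.
Qed.

Lemma frame_bounded : bounded_set C.
Proof.
destruct (unit_dir_bound c s cs_unit) as [hc hs].
exists (Box (fst p - (a + b)) (fst p + (a + b)) (snd p - (a + b)) (snd p + (a + b))).
split; [split; simpl; lra|]; intros q hq.
apply C_below in hq; destruct hq as (x & y & hx & hy & ->).
assert (b1 : forall t, -1 <= t <= 1 -> - a <= x * t <= a) by (intros t ht; split; nra).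
assert (b2 : forall t, -1 <= t <= 1 -> - b <= y * t <= b) by (intros t ht; split; nra).
generalize (b1 c hc) (b1 s hs) (b2 c hc) (b2 s hs); unfold in_box; simpl; lra.
Qed.

Lemma splits_coordinate h t : splits (fun q => t < coordinate h q) /\ splits (fun q => coordinate h q < t).
Proof.
assert (hne : c <> 0 \/ s <> 0).
{ destruct (Req_dec c 0) as [e|e]; [right; intros e'|left; exact e].
  unfold unit_dir in cs_unit; rewrite e, e' in cs_unit; lra. }
assert (hc := Ropp_neq_0_compat c); assert (hs := Ropp_neq_0_compat s).
destruct h; unfold coordinate.
- split.
  + apply (splits_halfplane (- c) (- s) (- (t * a + fst p * c + snd p * s))); [tauto| |];
      intros q hq; rewrite (proj1 (div_lt_iff (frame_x p c s q) t a a_pos)) in hq; unfold frame_x in hq; lra.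
  + apply (splits_halfplane c s (t * a + fst p * c + snd p * s)); [tauto| |];
      intros q hq; rewrite (proj2 (div_lt_iff (frame_x p c s q) t a a_pos)) in hq; unfold frame_x in hq; lra.
- split.
  + apply (splits_halfplane s (- c) (- (t * b + snd p * c - fst p * s))); [tauto| |];
      intros q hq; rewrite (proj1 (div_lt_iff (frame_y p c s q) t b b_pos)) in hq; unfold frame_y in hq; lra.
  + apply (splits_halfplane (- s) c (t * b + snd p * c - fst p * s)); [tauto| |];
      intros q hq; rewrite (proj2 (div_lt_iff (frame_y p c s q) t b b_pos)) in hq; unfold frame_y in hq; lra.
Qed.

Lemma splits_cell Q : splits (cell Q).
Proof.
apply (splits_ext (setI
  (setI (fun q => sx Q < coordinate true q) (fun q => coordinate true q < sx Q + side Q))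
  (setI (fun q => sy Q < coordinate false q) (fun q => coordinate false q < sy Q + side Q)))).
- intros q; reflexivity.
- apply splits_inter; apply splits_inter; apply splits_coordinate.
Qed.

Lemma outer_coordinate_strip (A : pset) h t d : subset A C -> 0 < d <= 1 ->
  (forall q, A q -> t <= coordinate h q <= t + d) -> outer A <= 16 * (a + b) ^ 2 * d.
Proof.
intros hA hd ht.
assert (hq : forall q, A q -> 0 <= frame_x p c s q <= 0 + a /\ 0 <= frame_y p c s q <= 0 + b).
{ intros q hq; apply hA, C_below in hq; rewrite <- (frame_pt_0 p c s) in hq.
  apply closed_rect_shift in hq; assumption. }
destruct h.
- apply Rle_trans with (16 * (d * a * (b + d * a))).
  + apply (outer_strip p c s (t * a) 0); [exact cs_unit|apply Rmult_lt_0_compat; lra|lra|].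
    intros q hAq; exists (frame_x p c s q), (frame_y p c s q).
    split; [|split; [apply hq, hAq|apply frame_pt_xy, cs_unit]].
    destruct (ht q hAq) as [h1 h2].
    apply (proj1 (div_le_iff _ _ a a_pos)) in h1; apply (proj2 (div_le_iff _ _ a a_pos)) in h2; lra.
  + assert (0 <= (1 - d) * (d * a * a)) by (repeat apply Rmult_le_pos; lra).
    assert (0 <= d * a * b) by (repeat apply Rmult_le_pos; lra).
    assert (0 <= d * (b * b)) by (repeat apply Rmult_le_pos; lra).
    lra.
- apply Rle_trans with (16 * (d * b * (a + d * b))).
  + apply (outer_strip_y p c s 0 (t * b)); [exact cs_unit|apply Rmult_lt_0_compat; lra|lra|].
    intros q hAq; exists (frame_x p c s q), (frame_y p c s q).
    split; [apply hq, hAq|split; [|apply frame_pt_xy, cs_unit]].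
    destruct (ht q hAq) as [h1 h2].
    apply (proj1 (div_le_iff _ _ b b_pos)) in h1; apply (proj2 (div_le_iff _ _ b b_pos)) in h2; lra.
  + assert (0 <= (1 - d) * (d * b * b)) by (repeat apply Rmult_le_pos; lra).
    assert (0 <= d * b * a) by (repeat apply Rmult_le_pos; lra).
    assert (0 <= d * (a * a)) by (repeat apply Rmult_le_pos; lra).
    lra.
Qed.

Lemma outer_coordinate_strips (l : list (bool * R)) (A : pset) d : subset A C -> 0 < d <= 1 ->
  (forall q, A q -> exists h t, In (h, t) l /\ t <= coordinate h q <= t + d) ->
  outer A <= INR (length l) * (16 * (a + b) ^ 2 * d).
Proof.
intros hA hd; revert A hA; induction l as [|[h t] l IH]; intros A hA hl.
- simpl; rewrite Rmult_0_l.
  apply (outer_le_list _ []); [intros b' []|intros q hq; destruct (hl q hq) as (h & t & [] & _)].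
- simpl length; rewrite S_INR, Rmult_plus_distr_r, Rmult_1_l, Rplus_comm.
  pose (A1 := fun q => A q /\ t <= coordinate h q <= t + d).
  assert (h1 : subset A1 C) by (intros q [hq _]; apply hA, hq).
  assert (h2 : subset (setD A A1) C) by (intros q [hq _]; apply hA, hq).
  eapply Rle_trans; [apply (outer_union A1 (setD A A1))|apply Rplus_le_compat].
  + apply (bounded_subset _ C); [exact h1|apply frame_bounded].
  + apply (bounded_subset _ C); [exact h2|apply frame_bounded].
  + intros q hq; destruct (classic (A1 q)); [left|right; split]; assumption.
  + apply (outer_coordinate_strip _ h t); [exact h1|exact hd|intros q [_ hq]; exact hq].
  + apply IH; [exact h2|]; intros q [hq hn]; destruct (hl q hq) as (h' & t' & [e|hin] & ht').
    * injection e; intros; subst; exfalso; apply hn; split; assumption.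
    * exists h', t'; auto.
Qed.

Lemma outer_lines (l : list (bool * R)) (A : pset) : subset A C ->
  (forall q, A q -> exists h, In (h, coordinate h q) l) -> outer A <= 0.
Proof.
intros hA hl.
set (K := INR (length l) * (16 * (a + b) ^ 2)).
assert (hK : 0 <= K) by (unfold K; apply Rmult_le_pos; [apply pos_INR|nra]).
apply le_epsilon; intros e he; rewrite Rplus_0_l.
set (d := Rmin 1 (e / (K + 1))).
assert (hd : 0 < d) by (apply Rmin_glb_lt; [lra|apply Rdiv_lt_0_compat; lra]).
assert (hdK : d * (K + 1) <= e).
{ apply Rle_trans with (e / (K + 1) * (K + 1)); [apply Rmult_le_compat_r; [lra|apply Rmin_r]|].
  apply Req_le; field; lra. }
assert (h := outer_coordinate_strips l A d hA (conj hd (Rmin_l _ _))).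
apply Rle_trans with (INR (length l) * (16 * (a + b) ^ 2 * d)); [|unfold K in hdK; lra].
apply h; intros q hq; destruct (hl q hq) as [h' hin]; exists h', (coordinate h' q); split; [exact hin|lra].
Qed.

Lemma fat_cell Rf Q : 0 < side Q -> a <= Rf * b -> b <= Rf * a -> 1 <= Rf -> fat_rect Rf (cell Q).
Proof.
intros hQ hab hba hR; set (pQ := frame_pt p c s (sx Q * a) (sy Q * b)).
assert (ha : 0 < side Q * a) by (apply Rmult_lt_0_compat; assumption).
assert (hb : 0 < side Q * b) by (apply Rmult_lt_0_compat; assumption).
assert (hopen : forall q, cell Q q <-> open_rect pQ c s (side Q * a) (side Q * b) q) by apply cell_open_rect.
split; [|split].
- apply borel_open; intros q hq; apply hopen in hq.
  destruct (open_rect_open pQ c s _ _ cs_unit q hq) as [e [he h]].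
  exists e; split; [exact he|intros q' hq'; apply hopen, h, hq'].
- exists c, s, (side Q * a), (side Q * b); split; [exact cs_unit|].
  split; [exact ha|split; [exact hb|exists pQ; split; intros q hq]].
  + apply hopen, hq.
  + apply hopen in hq; destruct hq as (x & y & hx & hy & e); exists x, y; repeat split; lra || exact e.
- pose (lm := Rmin a b); pose (lp := Rmax a b).
  assert (hlm : 0 < lm <= a /\ lm <= b) by (unfold lm, Rmin; destruct Rle_dec; lra).
  assert (hlp : a <= lp /\ b <= lp) by (unfold lp, Rmax; destruct Rle_dec; lra).
  assert (hl : lp <= Rf * lm).
  { assert (a * 1 <= a * Rf) by (apply Rmult_le_compat_l; lra).
    assert (b * 1 <= b * Rf) by (apply Rmult_le_compat_l; lra).
    unfold lp, lm, Rmax, Rmin; repeat destruct Rle_dec; lra. }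
  exists c, s, (open_rect pQ c s (side Q * lm) (side Q * lm)),
    (closed_rect pQ c s (side Q * lp) (side Q * lp)), (side Q * lm), (side Q * lp).
  assert (0 < side Q * lm) by (apply Rmult_lt_0_compat; lra).
  assert (0 < side Q * lp) by (apply Rmult_lt_0_compat; lra).
  assert (side Q * lm <= side Q * a /\ side Q * lm <= side Q * b)
    by (split; apply Rmult_le_compat_l; lra).
  assert (side Q * a <= side Q * lp /\ side Q * b <= side Q * lp)
    by (split; apply Rmult_le_compat_l; lra).
  split; [exact cs_unit|split; [|split; [|split; [|split]]]].
  + split; [assumption|split; [assumption|exists pQ; split; intros q hq; [exact hq|]]].
    destruct hq as (x & y & hx & hy & e); exists x, y; repeat split; lra || exact e.
  + split; [assumption|split; [assumption|exists pQ; split; intros q hq; [|exact hq]]].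
    destruct hq as (x & y & hx & hy & e); exists x, y; repeat split; lra || exact e.
  + intros q (x & y & hx & hy & e); apply hopen; exists x, y; repeat split; lra || exact e.
  + intros q hq; apply hopen in hq; destruct hq as (x & y & hx & hy & e).
    exists x, y; repeat split; lra || exact e.
  + apply (Rmult_le_reg_r (side Q * lm)); [assumption|].
    replace (side Q * lp / (side Q * lm) * (side Q * lm)) with (side Q * lp) by (field; lra).
    apply (Rmult_le_compat_l (side Q)) in hl; lra.
Qed.

Lemma cells_disjoint P Q q : separated P Q -> ~ (cell P q /\ cell Q q).
Proof. unfold separated, cell; lra. Qed.

Lemma C_outer_pos : 0 < outer C.
Proof.
destruct (unit_dir_bound c s cs_unit) as [hc hs].
set (z := frame_pt p c s (a / 2) (b / 2)); set (r := Rmin a b / 8).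
assert (hr : 0 < r) by (unfold r, Rmin; destruct Rle_dec; lra).
assert (hra : 4 * r < a /\ 4 * r < b) by (unfold r, Rmin; destruct Rle_dec; lra).
set (B := Box (fst z - r) (fst z + r) (snd z - r) (snd z + r)).
assert (hB : box_ok B) by (split; simpl; lra).
apply Rlt_le_trans with (box_area B).
- unfold box_area, B; cbn [bx1 bx2 by1 by2]; replace (_ * _) with (4 * (r * r)) by ring.
  assert (0 < r * r) by (apply Rmult_lt_0_compat; assumption); lra.
- eapply Rle_trans; [apply outer_box_ge, hB|apply outer_mono; [|apply frame_bounded]].
  intros q [hx hy]; unfold B in hx, hy; cbn [bx1 bx2 by1 by2] in hx, hy; apply C_above.
  rewrite <- (frame_pt_0 p c s); apply open_rect_shift; [exact cs_unit|].
  assert (ex := frame_x_pt p c s (a / 2) (b / 2) cs_unit).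
  assert (ey := frame_y_pt p c s (a / 2) (b / 2) cs_unit).
  fold z in ex, ey; clearbody z; unfold frame_x, frame_y in *.
  assert (b1 : forall t, -1 <= t <= 1 -> - r <= (fst q - fst z) * t <= r) by (intros t ht; split; nra).
  assert (b2 : forall t, -1 <= t <= 1 -> - r <= (snd q - snd z) * t <= r) by (intros t ht; split; nra).
  generalize (b1 c hc) (b1 s hs) (b2 c hc) (b2 s hs); lra.
Qed.

Lemma outer_boundary : outer (setD C (cell unit_square)) <= 0.
Proof.
apply (outer_lines [(true, 0); (true, 1); (false, 0); (false, 1)]); [intros q []; assumption|].
intros q [hq hn]; apply NNPP; intros hno; apply hn.
assert (h1 := coordinate_bounds q true hq); assert (h2 := coordinate_bounds q false hq).
assert (hne : forall h t, t = 0 \/ t = 1 -> coordinate h q <> t).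
{ intros h t ht e; apply hno; exists h; rewrite e; destruct h; destruct ht; subst; simpl; auto. }
assert (d1 := hne true 0 (or_introl eq_refl)); assert (d2 := hne true 1 (or_intror eq_refl)).
assert (d3 := hne false 0 (or_introl eq_refl)); assert (d4 := hne false 1 (or_intror eq_refl)).
unfold cell; cbn [sx sy side unit_square]; lra.
Qed.

(** [C] is the open unit cell with some part of its boundary, a null set; the union is written with
    complements and an intersection. *)
Lemma splits_C : splits C.
Proof.
apply (splits_ext (setC (setI (setC (cell unit_square)) (setC (setD C (cell unit_square)))))).
- intros q; unfold setC, setI, setD.
  assert (h : cell unit_square q -> C q) by (apply cell_subset; unfold valid; simpl; lra); tauto.
- apply splits_compl, splits_inter; apply splits_compl; [apply splits_cell|].
  apply splits_null; [apply outer_boundary|].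
  apply (bounded_subset _ C); [intros q []; assumption|apply frame_bounded].
Qed.

(** On a leg [Some j] the three children of ratio $(1+t)/2$ leave free only the square of ratio
    $(1-t)/2$ at corner [j], which is the fourth child. On the common leg all ratios are at least
    1/2. What the open children miss therefore lies on their edges. *)
Lemma uncovered_lines Q g t q : cell Q q -> 0 <= t <= 1 ->
  (forall j, ~ cell (child Q j (pattern g t j)) q) ->
  exists h, In (h, coordinate h q)
    [(true, sx Q + side Q * ((1 - t) / 2)); (true, sx Q + side Q * ((1 + t) / 2));
     (false, sy Q + side Q * ((1 - t) / 2)); (false, sy Q + side Q * ((1 + t) / 2))].
Proof.
intros [hx hy] ht hn; apply NNPP; intros hno.
set (wm := side Q * ((1 - t) / 2)) in *; set (wp := side Q * ((1 + t) / 2)) in *.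
set (x := coordinate true q) in *; set (y := coordinate false q) in *.
assert (d1 : x <> sx Q + wm) by (intros e; apply hno; exists true; left; f_equal; symmetry; exact e).
assert (d2 : x <> sx Q + wp) by (intros e; apply hno; exists true; right; left; f_equal; symmetry; exact e).
assert (d3 : y <> sy Q + wm) by (intros e; apply hno; exists false; right; right; left; f_equal; symmetry; exact e).
assert (d4 : y <> sy Q + wp) by (intros e; apply hno; exists false; right; right; right; left; f_equal; symmetry; exact e).
assert (hw : wm + wp = side Q) by (unfold wm, wp; field).
assert (hs : 0 < side Q) by lra.
assert (hwt : wp - wm = side Q * t) by (unfold wm, wp; field).
assert (0 <= side Q * t) by (apply Rmult_le_pos; lra).
assert (hcell : forall j, let w := if leg_eq_dec g (Some j) then wm else wp in
  ~ (sx Q + bit (fst j) * (side Q - w) < x < sx Q + bit (fst j) * (side Q - w) + w /\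
     sy Q + bit (snd j) * (side Q - w) < y < sy Q + bit (snd j) * (side Q - w) + w)).
{ intros j w h; apply (hn j); unfold cell, child; fold x y; simpl.
  assert (hp : side Q * pattern g t j = w) by (unfold pattern, w, wm, wp; destruct leg_eq_dec; reflexivity).
  replace (side Q * (1 - pattern g t j)) with (side Q - w) by (rewrite <- hp; ring).
  rewrite hp; exact h. }
clear hn hno; clearbody wm wp x y.
generalize (hcell (false, false)) (hcell (false, true)) (hcell (true, false)) (hcell (true, true)).
clear hcell; unfold bit; simpl.
destruct g as [[[|] [|]]|]; repeat (destruct leg_eq_dec; try discriminate; try congruence);
  intros; destruct (Rlt_le_dec x (sx Q + wm)), (Rlt_le_dec x (sx Q + wp)),
  (Rlt_le_dec y (sy Q + wm)), (Rlt_le_dec y (sy Q + wp)); lra.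
Qed.

(** * The value of a cell as a function of its square *)

Section Value.
Variables (v : pt -> R) (M : R).
Hypothesis v_nonneg : forall q, C q -> 0 <= v q.
Hypothesis v_bound : forall q, C q -> v q <= M.
Hypothesis M_nonneg : 0 <= M.

Definition cell_value (Q : square) : R := Vm v (cell Q).

Lemma cell_value_nonneg Q : valid Q -> 0 <= cell_value Q.
Proof. intros hQ; apply (Vm_nonneg C v M); auto using frame_bounded, cell_subset. Qed.

Lemma cell_value_point Q : valid Q -> side Q = 0 -> cell_value Q = 0.
Proof.
intros hQ hs; apply Rle_antisym; [|apply cell_value_nonneg, hQ].
apply Rle_trans with (M * outer (cell Q)).
- apply (Vm_le_outer C v M); auto using frame_bounded, cell_subset.
- assert (outer (cell Q) <= 0).
  { apply (outer_lines []); [apply cell_subset, hQ|intros q [hq _]; exfalso; lra]. }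
  generalize (outer_nonneg (cell Q)); intros; assert (outer (cell Q) = 0) as -> by lra; lra.
Qed.

Lemma Vm_cover (Ys : list square) X : subset X C -> (forall Q, In Q Ys -> valid Q) ->
  Vm v X <= lsum cell_value Ys + M * outer (fun q => X q /\ forall Q, In Q Ys -> ~ cell Q q).
Proof.
revert X; induction Ys as [|Q Ys IH]; intros X hX hY.
- simpl; rewrite Rplus_0_l; eapply Rle_trans; [apply (Vm_le_outer C v M); auto using frame_bounded|].
  apply Rmult_le_compat_l; [exact M_nonneg|apply outer_mono].
  + intros q hq; split; [exact hq|intros Q []].
  + apply (bounded_subset _ C); [intros q []; auto|apply frame_bounded].
- eapply Rle_trans; [apply (Vm_split C v M) with (Y := cell Q); auto using frame_bounded, splits_cell|].
  simpl; rewrite Rplus_assoc; apply Rplus_le_compat.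
  + apply (Vm_mono C v M); auto using frame_bounded.
    * intros q []; assumption.
    * apply cell_subset, hY; left; reflexivity.
  + eapply Rle_trans; [apply IH|].
    * intros q [hq _]; apply hX, hq.
    * intros P hP; apply hY; right; exact hP.
    * apply Rplus_le_compat_l, Rmult_le_compat_l; [exact M_nonneg|].
      apply outer_mono; [|apply (bounded_subset _ C); [intros q []; auto|apply frame_bounded]].
      intros q [[hq hn] hn']; split; [exact hq|intros P [<-|hP]; auto].
Qed.

Lemma cell_value_cover Q g t : valid Q -> 0 <= t <= 1 ->
  cell_value Q <= lsum (fun j => cell_value (child Q j (pattern g t j))) corners.
Proof.
intros hQ ht.
assert (h := Vm_cover (map (fun j => child Q j (pattern g t j)) corners) (cell Q)).
replace (lsum cell_value (map (fun j => child Q j (pattern g t j)) corners)) with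
  (lsum (fun j => cell_value (child Q j (pattern g t j))) corners) in h by reflexivity.
eapply Rle_trans; [apply h|].
- apply cell_subset, hQ.
- intros P hP; apply in_map_iff in hP; destruct hP as [j [<- _]]; apply child_valid; [exact hQ|].
  unfold pattern; destruct leg_eq_dec; lra.
- rewrite <- Rplus_0_r; apply Rplus_le_compat_l.
  apply Rle_trans with (M * 0); [|lra].
  apply Rmult_le_compat_l; [exact M_nonneg|].
  eapply outer_lines.
  + intros q [hq _]; apply (cell_subset Q hQ q hq).
  + intros q [hq hn]; apply (uncovered_lines Q g t); [exact hq|exact ht|].
    intros j; apply hn, in_map_iff; exists j; split; [reflexivity|apply in_corners].
Qed.

(** A point of the cell of [P] outside that of [Q] lies in one of four strips of width [d] along the
    sides of [Q], each contributing an area of at most [16 * (a + b) ^ 2 * d]. *)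
Lemma cell_value_near P Q d : valid P -> valid Q -> 0 < d <= 1 ->
  Rabs (sx P - sx Q) <= d -> Rabs (sy P - sy Q) <= d ->
  Rabs (sx P + side P - (sx Q + side Q)) <= d -> Rabs (sy P + side P - (sy Q + side Q)) <= d ->
  cell_value P <= cell_value Q + 64 * M * (a + b) ^ 2 * d.
Proof.
intros hP hQ hd h1 h2 h3 h4.
eapply Rle_trans; [apply (Vm_sub C v M) with (Y := cell Q); auto using frame_bounded, cell_subset, splits_cell|].
apply Rplus_le_compat_l.
apply Rle_trans with (M * (4 * (16 * (a + b) ^ 2 * d))); [|lra].
apply Rmult_le_compat_l; [exact M_nonneg|].
replace 4 with (INR 4) by (simpl; ring).
apply (outer_coordinate_strips [(true, sx Q - d); (true, sx Q + side Q); (false, sy Q - d); (false, sy Q + side Q)]);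
  [intros q [hq _]; apply (cell_subset P hP q hq)|exact hd|].
intros q [[hx hy] hn]; apply NNPP; intros hno; apply hn.
assert (hstrip : forall h t, In (h, t) [(true, sx Q - d); (true, sx Q + side Q); (false, sy Q - d); (false, sy Q + side Q)] ->
  ~ (t <= coordinate h q <= t + d)).
{ intros h t hin ht; apply hno; exists h, t; auto. }
generalize (hstrip true (sx Q - d) ltac:(simpl; auto)) (hstrip true (sx Q + side Q) ltac:(simpl; auto))
  (hstrip false (sy Q - d) ltac:(simpl; auto)) (hstrip false (sy Q + side Q) ltac:(simpl; auto)).
revert h1 h2 h3 h4; unfold cell; clear - hx hy; split_Rabs; lra.
Qed.

Lemma cell_value_continuous (Qs : nat -> square) Q : (forall m, valid (Qs m)) -> valid Q ->
  Un_cv (fun m => sx (Qs m)) (sx Q) -> Un_cv (fun m => sy (Qs m)) (sy Q) ->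
  Un_cv (fun m => side (Qs m)) (side Q) -> Un_cv (fun m => cell_value (Qs m)) (cell_value Q).
Proof.
intros hQs hQ cx cy cs e he.
set (K := 64 * M * (a + b) ^ 2).
assert (hK : 0 <= K) by (unfold K; apply Rmult_le_pos; [lra|apply pow2_ge_0]).
set (d := Rmin 1 (e / (K + 1))).
assert (hd : 0 < d) by (apply Rmin_glb_lt; [lra|apply Rdiv_lt_0_compat; lra]).
assert (hdK : d * (K + 1) <= e).
{ apply Rle_trans with (e / (K + 1) * (K + 1)); [apply Rmult_le_compat_r; [lra|apply Rmin_r]|].
  apply Req_le; field; lra. }
(* Half of [d] for each number, because the far sides are sums of two of them. *)
destruct (cx (d / 2)) as [N1 H1]; [lra|]; destruct (cy (d / 2)) as [N2 H2]; [lra|].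
destruct (cs (d / 2)) as [N3 H3]; [lra|].
exists (N1 + N2 + N3)%nat; intros m hm.
specialize (H1 m ltac:(lia)); specialize (H2 m ltac:(lia)); specialize (H3 m ltac:(lia)).
unfold R_dist in *.
assert (n1 : cell_value (Qs m) <= cell_value Q + K * d).
{ apply cell_value_near; auto; [split; [exact hd|apply Rmin_l]| | | |]; split_Rabs; lra. }
assert (n2 : cell_value Q <= cell_value (Qs m) + K * d).
{ apply cell_value_near; auto; [split; [exact hd|apply Rmin_l]| | | |]; split_Rabs; lra. }
split_Rabs; lra.
Qed.

Lemma cell_value_total : Vm v C <= cell_value unit_square.
Proof.
eapply Rle_trans; [apply (Vm_sub C v M) with (Y := cell unit_square); auto using frame_bounded, splits_cell|].
- intros q hq; exact hq.
- apply cell_subset; unfold valid; simpl; lra.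
- assert (h := outer_boundary); assert (h' := outer_nonneg (setD C (cell unit_square))).
  assert (outer (setD C (cell unit_square)) = 0) as -> by lra; unfold cell_value; lra.
Qed.

End Value.
End Cells.

(** * Envy-free allocations *)

Lemma minN_ge f n m : (1 <= n)%nat -> (forall i, (i < n)%nat -> m <= f i) -> m <= minN f n.
Proof.
intros hn h; unfold minN.
assert (hl : forall k, In k (seq 0 n) -> m <= f k) by (intros k hk; apply in_seq in hk; apply h; lia).
induction (seq 0 n) as [|k l IH]; simpl; [apply h; lia|].
apply Rmin_glb; [apply hl; left; reflexivity|apply IH; intros k' hk'; apply hl; right; exact hk'].
Qed.

Lemma minN_le f n : minN f n <= f 0%nat.
Proof.
unfold minN; induction (seq 0 n) as [|k l IH]; simpl; [lra|].
eapply Rle_trans; [apply Rmin_r|exact IH].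
Qed.

(** A fat piece is itself the best fat rectangle inside it, so envy compares plain values. *)
Lemma VS_fat Rf C v M X : bounded_set C -> (forall q, C q -> 0 <= v q) -> (forall q, C q -> v q <= M) ->
  0 <= M -> subset X C -> fat_rect Rf X -> VS Rf v X = Vm v X.
Proof.
intros hC hv hM M0 hX hfat.
assert (hub : forall t, (exists s, fat_rect Rf s /\ subset s X /\ t = Vm v s) -> t <= Vm v X).
{ intros t (s & _ & hs & ->); apply (Vm_mono C v M); assumption. }
assert (hself : exists s, fat_rect Rf s /\ subset s X /\ Vm v X = Vm v s).
{ exists X; split; [exact hfat|split; [intros q hq; exact hq|reflexivity]]. }
apply Rle_antisym.
- apply Rsup_le; [exists (Vm v X); exact hself|exact hub].
- apply Rsup_ge; [exists (Vm v X); exact hub|exact hself].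
Qed.

Lemma value_density_bound C v : value_density C v ->
  (forall q, C q -> 0 <= v q) /\ (exists M, 0 <= M /\ forall q, C q -> v q <= M) /\ 0 < Vm v C.
Proof.
intros (h1 & [M h2] & _ & h3); split; [exact h1|split; [|exact h3]].
exists (Rmax M 0); split; [apply Rmax_r|intros q hq; eapply Rle_trans; [apply h2, hq|apply Rmax_l]].
Qed.

Lemma log2_up_pow n : (1 <= n)%nat -> INR n <= 2 ^ Nat.log2_up n /\ 2 ^ Nat.log2_up n < 2 * INR n.
Proof.
intros hn.
assert (e : forall k, 2 ^ k = INR (2 ^ k)) by (intros k; rewrite pow_INR; reflexivity).
rewrite e; destruct (Nat.eq_dec n 1) as [-> |hn1]; [simpl; lra|].
destruct (Nat.log2_up_spec n) as [h1 h2]; [lia|].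
split; [apply le_INR, h2|].
replace 2 with (INR 2) by (simpl; ring); rewrite <- mult_INR; apply lt_INR.
assert (hpos : (0 < Nat.log2_up n)%nat) by (apply Nat.log2_up_pos; lia).
replace (Nat.log2_up n) with (S (pred (Nat.log2_up n))) by lia; simpl; lia.
Qed.

(** From 4 on, $n^2 - (6 n - 8) = (n - 2)(n - 4)$ is nonnegative. At 3 the square 9 falls short of
    10, but the exponent is rounded up and gives 16. *)
Lemma divisor_bound n : (2 <= n)%nat -> 6 * INR n - 8 <= 2 ^ (2 * Nat.log2_up n).
Proof.
intros hn; rewrite Nat.mul_comm, pow_mult.
destruct (log2_up_pow n) as [h _]; [lia|].
destruct (Nat.eq_dec n 2) as [-> |h2]; [simpl; lra|].
destruct (Nat.eq_dec n 3) as [-> |h3]; [simpl; lra|].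
assert (hn4 : 4 <= INR n) by (replace 4 with (INR 4) by (simpl; ring); apply le_INR; lia).
assert (INR n ^ 2 <= (2 ^ Nat.log2_up n) ^ 2) by (apply pow_incr; lra).
assert (0 <= (INR n - 4) * (INR n - 2)) by (apply Rmult_le_pos; lra).
lra.
Qed.

Lemma constant_density c s a b p C : unit_dir c s -> 0 < a -> 0 < b ->
  subset (open_rect p c s a b) C -> subset C (closed_rect p c s a b) ->
  value_density C (fun _ => 1).
Proof.
intros hu ha hb h1 h2.
assert (hs : splits C) by (apply (splits_C p c s a b); assumption).
assert (hpos : 0 < outer C) by (eapply (C_outer_pos p c s a b); eassumption).
assert (hbd : bounded_set C) by (eapply (frame_bounded p c s a b); eassumption).
split; [intros; lra|split; [exists 1; intros; lra|split]].
- intros t; apply splits_lmeas; destruct (Rlt_le_dec t 1) as [ht|ht].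
  + apply (splits_ext C); [intros q; tauto|exact hs].
  + apply splits_null.
    * apply (outer_le_list _ []); [intros b' []|intros q []; lra].
    * apply (bounded_subset _ C); [intros q []; assumption|exact hbd].
- eapply Rlt_le_trans; [exact hpos|].
  apply Rle_trans with (simple_integral 1 (fun _ => C) (fun _ => 1)).
  + unfold simple_integral, sumN; simpl; lra.
  + apply (Vm_ge C (fun _ => 1) 1); try (intros; lra); [exact hbd|intros q hq; exact hq|].
    split; [|intros; lia].
    intros k _; split; [apply splits_lmeas, hs|split; [lra|]].
    intros q hq; split; [exact hq|lra].
Qed.

Lemma envy_free_allocation Rf C n v : 1 <= Rf -> fat_rect Rf C -> (1 <= n)%nat ->
  (forall i, (i < n)%nat -> value_density C (v i)) ->
  exists X, EF_alloc C n Rf v X /\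
    forall i, (i < n)%nat -> Vm (v i) C <= 2 ^ (2 * Nat.log2_up n) * Vm (v i) (X i).
Proof.
intros hR hC hn hv.
(* The capacity $n/(n-1)$ presupposes two agents; a single one receives all of [C]. *)
destruct (Nat.eq_dec n 1) as [-> |hn1].
{ exists (fun _ => C); split; [split; [|split]|].
  - intros i _; split; [exact hC|intros q hq; exact hq].
  - intros i j hi hj hij; lia.
  - intros i j _ _; apply Rle_refl.
  - intros i _; simpl; lra. }
destruct hC as (_ & (c & s & a & b & hu & hrect) & hfat).
destruct (fat_aspect Rf c s a b C) as [hab hba]; try assumption; [lra|].
destruct hrect as (ha & hb & p & h1 & h2).
(* Indices from [n] on are copies of agent 0, since the valuations of squares are assumed well
   behaved at every index. *)
pose (w := fun i => v (if lt_dec i n then i else 0%nat)).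
assert (hw : forall i, value_density C (w i)) by (intros i; unfold w; destruct lt_dec; apply hv; lia).
assert (ew : forall i, (i < n)%nat -> w i = v i) by (intros i hi; unfold w; destruct lt_dec; [reflexivity|lia]).
assert (hbd : bounded_set C) by (eapply (frame_bounded p c s a b); eassumption).
assert (hcell : forall Q, valid Q -> subset (cell p c s a b Q) C) by (intros; eapply (cell_subset p c s a b); eassumption).
pose (V := fun i => cell_value p c s a b (w i)).
assert (hpos : forall i, 0 < V i unit_square).
{ intros i; destruct (value_density_bound C (w i) (hw i)) as (v0 & [M [M0 vM]] & hVC).
  eapply Rlt_le_trans; [exact hVC|]; eapply (cell_value_total p c s a b); eassumption. }
destruct (envy_free_squares n V) as (T & hT & hsep & henvy & hprop).
- lia.
- intros i Q hQ; destruct (value_density_bound C (w i) (hw i)) as (v0 & [M [M0 vM]] & _).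
  eapply (cell_value_nonneg p c s a b); eassumption.
- intros i Q hQ hs; destruct (value_density_bound C (w i) (hw i)) as (v0 & [M [M0 vM]] & _).
  eapply (cell_value_point p c s a b); eassumption.
- intros i Q g t hQ ht; destruct (value_density_bound C (w i) (hw i)) as (v0 & [M [M0 vM]] & _).
  eapply (cell_value_cover p c s a b); eassumption.
- intros i Qs Q hQs hQ c1 c2 c3; destruct (value_density_bound C (w i) (hw i)) as (v0 & [M [M0 vM]] & _).
  eapply (cell_value_continuous p c s a b); eassumption.
- exact hpos.
- assert (hn2 : 2 <= INR n) by (replace 2 with (INR 2) by (simpl; ring); apply le_INR; lia).
  assert (hTpos : forall i, (i < n)%nat -> 0 < V i (T i)).
  { intros i hi; apply Rnot_le_lt; intros hle; generalize (hprop i hi) (hpos i).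
    assert (0 <= (6 * INR n - 8) * - V i (T i)) by (apply Rmult_le_pos; lra); lra. }
  (* A degenerate square would have an empty cell, which is no rectangle; the positive value
     obtained excludes it. *)
  assert (hside : forall i, (i < n)%nat -> 0 < side (T i)).
  { intros i hi; destruct (hT i) as (_ & _ & hs & _).
    destruct (Rle_lt_or_eq_dec _ _ hs) as [h|h]; [exact h|exfalso].
    destruct (value_density_bound C (w i) (hw i)) as (v0 & [M [M0 vM]] & _).
    assert (V i (T i) = 0) by (eapply (cell_value_point p c s a b); eauto).
    generalize (hTpos i hi); lra. }
  assert (hfr : forall i, (i < n)%nat -> fat_rect Rf (cell p c s a b (T i))).
  { intros i hi; apply fat_cell; auto. }
  exists (fun i => cell p c s a b (T i)); split; [split; [|split]|].
  + intros i hi; split; [apply hfr, hi|apply hcell, hT].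
  + intros i j hi hj hij q; apply cells_disjoint, hsep; assumption.
  + intros i j hi hj.
    destruct (value_density_bound C (v i) (hv i hi)) as (v0 & [M [M0 vM]] & _).
    rewrite !(VS_fat Rf C (v i) M) by auto.
    assert (h := henvy i j hi hj); unfold V, cell_value in h; rewrite ew in h by exact hi; exact h.
  + intros i hi.
    destruct (value_density_bound C (v i) (hv i hi)) as (v0 & [M [M0 vM]] & _).
    assert (hp := hprop i hi); assert (hp0 := hTpos i hi).
    unfold V, cell_value in hp, hp0; rewrite ew in hp, hp0 by exact hi.
    eapply Rle_trans; [eapply (cell_value_total p c s a b); eassumption|].
    eapply Rle_trans; [exact hp|apply Rmult_le_compat_r; [lra|apply divisor_bound; lia]].
Qed.

Theorem theorem2 (Rf : R) (C : pset) (n : nat) :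
  1 <= Rf -> fat_rect Rf C -> (1 <= n)%nat ->
  1 / 2 ^ (2 * Nat.log2_up n) <= PropEF C n Rf /\
  1 / (4 * INR n ^ 2) < 1 / 2 ^ (2 * Nat.log2_up n).
Proof.
intros hR hC hn.
assert (hK : 0 < 2 ^ (2 * Nat.log2_up n)) by (apply pow_lt; lra).
assert (hn1 : 1 <= INR n) by (replace 1 with (INR 1) by reflexivity; apply le_INR, hn).
split.
- assert (hbd : bounded_set C).
  { destruct hC as (_ & (c & s & a & b & hu & ha & hb & p & h1 & h2) & _).
    eapply (frame_bounded p c s a b); eassumption. }
  apply Rinf_ge.
  (* Over an empty set [Rinf] would take its conventional value 0, so some admissible densities must
     be exhibited. *)
  + eexists; exists (fun _ _ => 1); split; [|reflexivity]; intros i _.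
    destruct hC as (_ & (c & s & a & b & hu & ha & hb & p & h1 & h2) & _).
    eapply (constant_density c s a b p); eassumption.
  + intros r (v & hv & ->).
    destruct (envy_free_allocation Rf C n v hR hC hn hv) as (X & hX & hval).
    apply Rle_trans with (minN (fun i => Vm (v i) (X i) / Vm (v i) C) n).
    * apply minN_ge; [exact hn|intros i hi].
      destruct (value_density_bound C (v i) (hv i hi)) as (_ & _ & hVC).
      apply (Rmult_le_reg_r (Vm (v i) C)); [exact hVC|].
      replace (Vm (v i) (X i) / Vm (v i) C * Vm (v i) C) with (Vm (v i) (X i)) by (field; lra).
      apply (Rmult_le_reg_l (2 ^ (2 * Nat.log2_up n))); [exact hK|].
      replace (2 ^ (2 * Nat.log2_up n) * (1 / 2 ^ (2 * Nat.log2_up n) * Vm (v i) C))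
        with (Vm (v i) C) by (field; lra).
      apply hval, hi.
    * apply Rsup_ge; [|exists X; split; [exact hX|reflexivity]].
      (* [Rsup] is a true supremum only for bounded sets: the minimum is at most the share of agent
         0, which is at most 1. *)
      exists 1; intros r (Y & (hY & _) & ->); eapply Rle_trans; [apply minN_le|].
      destruct (value_density_bound C (v 0%nat) (hv 0%nat hn)) as (v0 & [M [M0 vM]] & hVC).
      apply (Rmult_le_reg_r (Vm (v 0%nat) C)); [exact hVC|].
      replace (Vm (v 0%nat) (Y 0%nat) / Vm (v 0%nat) C * Vm (v 0%nat) C) with (Vm (v 0%nat) (Y 0%nat))
        by (field; lra).
      rewrite Rmult_1_l; apply (Vm_mono C (v 0%nat) M); auto; [apply hY, hn|intros q hq; exact hq].
- destruct (log2_up_pow n hn) as [_ h].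
  rewrite (Nat.mul_comm 2), pow_mult.
  assert (hp : 0 < 2 ^ Nat.log2_up n) by (apply pow_lt; lra).
  apply Rmult_lt_compat_l; [lra|].
  apply Rinv_lt_contravar; [|nra].
  apply Rmult_lt_0_compat; [apply pow_lt, hp|nra].
Qed.
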